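(* Let $b\ge2$ be an integer, let $0<\sigma<\sqrt{2\log b}$, and let $W=e^{\sigma N-\sigma^2/2}$ with $N$ a standard real Gaussian random variable. Let $\mu_\infty$ be the Mandelbrot canonical cascade measure on $[0,1]$ associated with $(W,b)$. Then, almost surely, $$\dim_F(\mu_\infty)=\begin{cases}1-\dfrac{\sigma^2}{\log b} & \text{if }\dfrac{\sigma^2}{\log b}\le\dfrac12,\\[3mm] 2\Big(1-\dfrac{\sigma}{\sqrt{2\log b}}\Big)^2=1-\dfrac{\sigma^2}{\log b}+\Big(1-\sqrt{\dfrac{2\sigma^2}{\log b}}\Big)^2 & \text{if }\dfrac12<\dfrac{\sigma^2}{\log b}<2.\end{cases}$$
   Context: Cascade measure. Let $\mathcal{A}=\{0,1,\dots,b-1\}$ and $\mathcal{A}^*=\bigsqcup_{n\ge0}\mathcal{A}^n$ (finite words, $\mathcal{A}^0=\{\emptyset\}$); $|u|$ is the length of $u$, $u_k$ its $k$-th letter, $u|_j$ its prefix of length $j$. For $|u|=n$ let $I_u=[\sum_{k=1}^n u_kb^{-k},\ \sum_{k=1}^n u_kb^{-k}+b^{-n})$. Let $(W(u))_{u\in\mathcal{A}^*\setminus\{\emptyset\}}$ be i.i.d. copies of $W$ and $W(\emptyset)=1$. Define random measures on $[0,1]$ by $\mu_n(dt)=\sum_{|u|=n}\big(\prod_{j=0}^nW(u|_j)\big)\mathbf{1}_{I_u}(t)\,dt$. Almost surely $\mu_n$ converges weakly to a random measure $\mu_\infty$, the Mandelbrot canonical cascade measure (here $\mu_\infty\ne0$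 almost surely). For a finite nonzero Borel measure $\mu$ on $[0,1]$, $\widehat{\mu}(\zeta)=\int e^{-2\pi i\zeta x}d\mu(x)$ and $\dim_F(\mu)=\sup\{D\in[0,1]: |\widehat{\mu}(\zeta)|^2=O(|\zeta|^{-D})\text{ as }|\zeta|\to\infty\}$. *)

(* Defs.v *)
From HB Require Import structures.
From mathcomp Require Import all_boot all_order all_algebra.
From mathcomp Require Import complex.
From mathcomp Require Import all_classical all_reals all_analysis.
From mathcomp Require Import measurable_realfun.

Set Implicit Arguments.
Unset Strict Implicit.
Unset Printing Implicit Defensive.
Import Order.TTheory GRing.Theory Num.Theory.
Import numFieldNormedType.Exports.
Local Open Scope classical_set_scope.
Local Open Scope ring_scope.

Section probability.
Context {d d' : measure_display} {R : realType}.

Definition mutually_independent {T : measurableType d} (P : probability T R)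
    {I : eqType} (X : I -> T -> R) : Prop :=
  forall (s : seq I) (A : I -> set R), uniq s -> (forall i, measurable (A i)) ->
    (P (\bigcap_(i in [set` s]) (X i @^-1` A i)) =
     \prod_(i <- s) P (X i @^-1` A i))%E.

Definition same_law {T : measurableType d} {T' : measurableType d'}
    (P : probability T R) (X : T -> R) (P' : probability T' R) (X' : T' -> R) :
    Prop :=
  forall A : set R, measurable A -> P (X @^-1` A) = P' (X' @^-1` A).

Definition iid_copies {T : measurableType d} {T' : measurableType d'}
    (P : probability T R) {I : eqType} (X : I -> T -> R)
    (P' : probability T' R) (X' : T' -> R) : Prop :=
  mutually_independent P X /\ forall i, same_law P (X i) P' X'.

End probability.

(* Finite words over {0, ..., b-1} are sequences over 'I_b, and the prefix of u
   of length j is take j u. *)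
Definition nonempty_word (b : nat) := {u : seq 'I_b | u != [::]}.

Section cascade.
Context {R : realType} {b : nat}.

Definition word_left (u : seq 'I_b) : R :=
  \sum_(k < size u) (nth 0%N (map val u) k)%:R * b%:R ^- k.+1.

Definition word_interval (u : seq 'I_b) : set R :=
  `[word_left u, word_left u + b%:R ^- size u[%classic.

Definition cascade_density (w : seq 'I_b -> R) (n : nat) (t : R) : R :=
  \sum_(u : n.-tuple 'I_b)
    (\prod_(j < n.+1) w (take j u)) * \1_(word_interval u) t.

Lemma cascade_density_ge0 (w : seq 'I_b -> R) (w0 : forall u, 0 <= w u) n t :
  0 <= cascade_density w n t.
Proof. by apply: sumr_ge0 => u _; rewrite mulr_ge0// prodr_ge0. Qed.

Lemma measurable_cascade_density (w : seq 'I_b -> R) n :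
  measurable_fun setT (cascade_density w n).
Proof.
apply: measurable_sum => u; apply: measurable_funM => //.
by apply: measurable_indic; exact: measurable_itv.
Qed.

(* mu_n for a fixed realization w of the weights. All the intervals
   word_interval u lie in [0, 1), so this measure on R is carried by [0, 1].
   The nonnegativity proof w0 is an argument because it is what makes this set
   function a measure. *)
Definition cascade_approx (w : seq 'I_b -> R) (w0 : forall u, 0 <= w u)
    (n : nat) : set R -> \bar R :=
  fun A => (\int[lebesgue_measure]_(t in A) (cascade_density w n t)%:E)%E.

Section measure.
Variables (w : seq 'I_b -> R) (w0 : forall u, 0 <= w u) (n : nat).

Let cascade_approx0 : cascade_approx w0 n set0 = 0%E.
Proof. by rewrite /cascade_approx integral_set0. Qed.

Let cascade_approx_ge0 A : (0 <= cascade_approx w0 n A)%E.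
Proof. by apply: integral_ge0 => t _; rewrite lee_fin cascade_density_ge0. Qed.

Let cascade_approx_sigma_additive : semi_sigma_additive (cascade_approx w0 n).
Proof.
move=> /= A mA tA mUA; rewrite /cascade_approx ge0_integral_bigcup//=.
- apply: is_cvg_ereal_nneg_natsum_cond => k _ _.
  by apply: integral_ge0 => t _; rewrite lee_fin cascade_density_ge0.
- apply/measurable_EFinP; apply: measurable_funTS.
  exact: measurable_cascade_density.
- by move=> t _; rewrite lee_fin cascade_density_ge0.
Qed.

HB.instance Definition _ := isMeasure.Build _ _ _
  (cascade_approx w0 n) cascade_approx0 cascade_approx_ge0
  cascade_approx_sigma_additive.

End measure.
End cascade.

(* A finite Borel measure on [0, 1] is represented by a finite Borel measure on
   R for which the complement of [0, 1] is null. *)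
Definition carried_by01 {R : realType} (mu : {measure set R -> \bar R}) : Prop :=
  mu (~` `[0, 1]) = 0%E.

Definition weak_cvg01 {R : realType} (mu_ : nat -> {measure set R -> \bar R})
    (mu : {measure set R -> \bar R}) : Prop :=
  forall f : R -> R, {within `[0, 1], continuous f} ->
    (\int[mu_ n]_(t in `[0, 1]) f t)%R @[n --> \oo] -->
    (\int[mu]_(t in `[0, 1]) f t)%R.

Definition random_measure01 {d : measure_display} {T : measurableType d}
    {R : realType} (mu : T -> {finite_measure set R -> \bar R}) : Prop :=
  (forall x, carried_by01 (mu x)) /\
  (forall A : set R, measurable A -> measurable_fun setT (fun x => mu x A)).

(* mu is (a version of) the cascade measure of the weights W. *)
Definition is_cascade_measure {d : measure_display} {T : measurableType d}
    {R : realType} (P : probability T R) {b : nat}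
    (W : seq 'I_b -> T -> R) (W0 : forall u x, 0 <= W u x)
    (mu : T -> {finite_measure set R -> \bar R}) : Prop :=
  random_measure01 mu /\
  {ae P, forall x, weak_cvg01 (cascade_approx (fun u => W0 u x)) (mu x)}.

Section fourier.
Context {R : realType}.

Definition cexpi (y : R) : R[i] := Complex (cos y) (sin y).

Definition cintegral (mu : {measure set R -> \bar R}) (f : R -> R[i]) : R[i] :=
  Complex (\int[mu]_x (complex.Re (f x)))%R (\int[mu]_x (complex.Im (f x)))%R.

Definition fourier_transform (mu : {measure set R -> \bar R}) (z : R) : R[i] :=
  cintegral mu (fun x => cexpi (- (2 * pi * z * x))).

Definition fourier_decay (mu : {measure set R -> \bar R}) (D : R) : Prop :=
  exists C M : R, forall z : R, M <= `|z| ->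
    ComplexField.Normc.normc (fourier_transform mu z) ^+ 2 <= C * `|z| `^ (- D).

Definition fourier_dim (mu : {measure set R -> \bar R}) : R :=
  sup [set D : R | 0 <= D <= 1 /\ fourier_decay mu D].

End fourier.

(* Main.v *)
From HB Require Import structures.
Require Import Defs.
From mathcomp Require Import all_boot all_order all_algebra.
From mathcomp Require Import complex.
From mathcomp Require Import ring lra.
From mathcomp Require Import all_classical all_reals all_analysis.
From mathcomp Require Import measurable_realfun.
Set Implicit Arguments.
Unset Strict Implicit.
Unset Printing Implicit Defensive.
Import Order.TTheory GRing.Theory Num.Theory.
Import numFieldNormedType.Exports.
Local Open Scope classical_set_scope.
Local Open Scope ring_scope.

(* Write [W u = exp (sigma * X u - sigma ^ 2 / 2)] with the [X u] independent
   standard Gaussians, and let [a_u] be the product of the weights along [u].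

   Lower bound. For a trigonometric function [f] of frequency [z], the increment
   [\int f d(mu_(n+1) - mu_n)] is a combination of independent centred variables with
   coefficients depending on the first [n] generations. Divided by
   [B_n = (\sum_(|u| = n) a_u ^ q) ^ (1 / q)], [1 < q <= 2], all its even moments are
   bounded by the corresponding power of the size of the coefficients, because
   [\sum a_u ^ 2 <= B_n ^ 2]. Taking moments of high order, the union bound over the
   frequencies [sqrt j] costs nothing, and the growth rate of [B_n] yields decay
   of order [D] for every [D < 2 (q - 1) (1 - q a ^ 2) / q],
   [a = sigma / sqrt (2 ln b)]. The best choice is [q = min (2, 1 / a)].

   Upper bound. By a Fejer kernel argument, decay of order [D] forces
   [\sum_(|u| = n) mu (I_u) ^ 2 = O(b ^ (- n D))]. Now [mu (I_u) = b ^ (- n) a_u Z_u]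
   with [Z_u] independent of [a_u], and [Z_u] is bounded below on most words for
   the weights [a_u ^ th]. If [th a < 1], the sums [\sum a_u ^ th] have the size of
   their expectation, so [\sum a_u ^ 2] is bounded below by interpolation,
   which contradicts the decay when [D] is too large. *)

(** * Words and b-adic intervals *)

(** All probability estimates are made at finite depth: the masses of subtrees are replaced by
    [Zmass] of depth [k], bounded below uniformly in [k]. The measure itself enters only path by
    path, through weak convergence, so neither the nondegeneracy of a limit nor the mass of a single
    interval has to be studied on its own. Origin of the exponent: [B_n] grows like
    [b ^ (n ((q ^ 2 - q) a ^ 2 + 1) / q)], while a wave of frequency [z] has integral at most
    [b ^ (n (th - 1)) z ^ (- th)] over an interval of generation [n]. The product must decrease with
    [n], which bounds [th], and [D] is [2 th]. The obstacle is that for [a >= 1/2] the expectation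
    of [\sum a_u ^ 2] is carried by rare large weights. In the lower bound this forces powers
    [q < 2] as soon as [a > 1/2]. In the upper bound it forces [th] below [1 / a], the squares being
    recovered by truncating the weights at the level that dominates [\sum a_u ^ th]. The two bounds
    meet because [1 / a] is both the maximiser of [(q - 1) (1 - q a ^ 2) / q] and the critical
    power. *)

Section words.
Variable b : nat.
Implicit Types (u w : seq 'I_b) (n k : nat).

(** Plain lists rather than tuples, so that words of different generations can be cut and
    concatenated without casts; [sum_words_tuple] links them to [cascade_density]. *)
Fixpoint words n : seq (seq 'I_b) :=
  if n is n'.+1 then [seq a :: w | a <- enum 'I_b, w <- words n'] else [:: [::]].

Lemma mem_words n u : (u \in words n) = (size u == n).
Proof.
elim: n u => [|n IH] [|a u] //=; rewrite ?inE //.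
  by apply/allpairsP => -[[c w] [_ _ /=]].
rewrite eqSS -IH; apply/allpairsP/idP => [[[c w] /= [_ wn [_ ->]]] //|un].
by exists (a, u); rewrite /= mem_enum.
Qed.

Lemma words_uniq n : uniq (words n).
Proof.
elim: n => //= n IH; apply: allpairs_uniq => //; first exact: enum_uniq.
by move=> [a u] [c w] _ _ [-> ->].
Qed.

Lemma sum_words_cons (V : nmodType) n (F : seq 'I_b -> V) :
  \sum_(u <- words n.+1) F u = \sum_(a < b) \sum_(w <- words n) F (a :: w).
Proof. by rewrite /= big_allpairs_dep big_enum. Qed.

Lemma sum_words_cat (V : nmodType) n k (F : seq 'I_b -> V) :
  \sum_(u <- words (n + k)) F u =
  \sum_(u <- words n) \sum_(w <- words k) F (u ++ w).
Proof.
elim: n F => [|n IH] F; first by rewrite big_seq1.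
rewrite addSn !sum_words_cons; apply: eq_bigr => a _; rewrite IH.
by [].
Qed.

Lemma sum_words_rcons (V : nmodType) n (F : seq 'I_b -> V) :
  \sum_(u <- words n.+1) F u = \sum_(u <- words n) \sum_(a < b) F (rcons u a).
Proof.
rewrite -addn1 sum_words_cat; apply: eq_bigr => u _.
rewrite sum_words_cons; apply: eq_bigr => a _.
by rewrite big_seq1 cats1.
Qed.

Lemma sum_words_tuple (V : nmodType) n (F : seq 'I_b -> V) :
  \sum_(u : n.-tuple 'I_b) F u = \sum_(u <- words n) F u.
Proof.
rewrite -[LHS]big_enum /= -(big_map val xpredT F) /=; apply: perm_big.
apply: uniq_perm.
- by rewrite map_inj_uniq ?enum_uniq//; exact: val_inj.
- exact: words_uniq.
- move=> u; rewrite mem_words; apply/mapP/idP => [[t _ ->]|un].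
    by rewrite size_tuple.
  by exists (Tuple un); rewrite // mem_enum.
Qed.

Lemma size_words n : size (words n) = (b ^ n)%N.
Proof.
elim: n => //= n IH.
by rewrite size_allpairs IH -cardE card_ord expnS.
Qed.

End words.

Section geometry.
Context {R : realType} {b : nat}.
Hypothesis b_gt0 : (0 < b)%N.
Implicit Types u w : seq 'I_b.
Local Notation left := (@word_left R b).

Let bR_gt0 : 0 < b%:R :> R. Proof. by rewrite ltr0n. Qed.
Let bR_neq0 : b%:R != 0 :> R. Proof. by rewrite gt_eqF. Qed.

Lemma word_left_cons a w : left (a :: w) = (a%:R + left w) / b%:R.
Proof.
rewrite /word_left /= big_ord_recl /= expr1 mulrDl; congr (_ + _).
rewrite mulr_suml; apply: eq_bigr => i _ /=.
by rewrite -mulrA exprS invfM; congr (_ * _); rewrite mulrC.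
Qed.

Lemma word_left_cat u w : left (u ++ w) = left u + left w / b%:R ^+ size u.
Proof.
elim: u => [|a u IH] /=.
  by rewrite expr0 divr1 /word_left big_ord0 add0r.
rewrite !word_left_cons IH exprS invfM; move: (_ ^-1) => c.
by ring.
Qed.

Lemma word_left_ge0 u : 0 <= left u.
Proof. by apply: sumr_ge0 => i _; rewrite mulr_ge0// ?ler0n// invr_ge0 exprn_ge0// ltW. Qed.

Lemma word_left_le1 u : left u + b%:R ^- size u <= 1.
Proof.
elim: u => [|a u IH] /=; first by rewrite /word_left big_ord0 add0r expr0 invr1.
rewrite word_left_cons exprS invfM [_^-1 * _]mulrC -mulrDl ler_pdivrMr// mul1r.
rewrite -addrA.
apply: (@le_trans _ _ (a%:R + 1)); first by rewrite lerD2l.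
by rewrite natr1 ler_nat.
Qed.

(** For [F] a primitive of [f], this is the integral of [f] over [word_interval u]. Additivity over
    the children of [u] is then a telescoping sum, and no integral enters the probabilistic
    estimates. *)
Definition word_coef (F : R -> R) u : R := F (left u + b%:R ^- size u) - F (left u).

Lemma word_left_rcons u a : left (rcons u a) = left u + a%:R * b%:R ^- (size u).+1.
Proof.
rewrite -cats1 word_left_cat word_left_cons exprS invfM.
rewrite [left [::]]/word_left big_ord0 addr0; congr (_ + _).
by rewrite mulrA.
Qed.

Lemma word_coef_rcons F u : \sum_(a < b) word_coef F (rcons u a) = word_coef F u.
Proof.
have E (a : 'I_b) : word_coef F (rcons u a) =
    F (left u + a.+1%:R * b%:R ^- (size u).+1) - F (left u + a%:R * b%:R ^- (size u).+1).
  rewrite /word_coef word_left_rcons size_rcons -addrA; congr (F (_ + _) - _).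
  by rewrite -natr1; move: (b%:R ^- _) => c; ring.
rewrite (eq_bigr _ (fun a _ => E a)).
rewrite -(big_mkord xpredT (fun a => F (left u + a.+1%:R * b%:R ^- (size u).+1) - F (left u + a%:R * b%:R ^- (size u).+1))).
rewrite telescope_sumr// mul0r addr0 /word_coef exprS invfM mulrA mulfV// mul1r.
by [].
Qed.

End geometry.

(** * Independence and moments *)

Section independence.
Context {d : measure_display} {T : measurableType d} {R : realType}.
Variable P : probability T R.
Context {I : choiceType}.
Implicit Types (X : I -> T -> R) (Q D : set I).

(** Independence is restricted to [D] because the variables will be indexed by all words, whereas
    the one at the empty word is not part of the family. *)
Definition indep_family D X : Prop :=
  forall (s : seq I) (A : I -> set R), uniq s -> {in s, forall i, D i} ->
    (forall i, measurable (A i)) ->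
    (P (\bigcap_(i in [set` s]) (X i @^-1` A i)) =
     \prod_(i <- s) P (X i @^-1` A i))%E.

Definition cylinders Q X : set_system T :=
  [set E | exists (s : seq I) (A : I -> set R), [/\ uniq s, {in s, forall i, Q i},
     (forall i, measurable (A i)) & E = \bigcap_(i in [set` s]) (X i @^-1` A i)]].

Definition past Q X : set_system T :=
  [set E | exists i (A : set R), [/\ Q i, measurable A & E = X i @^-1` A]].

Lemma past_sub_cylinders Q X : past Q X `<=` cylinders Q X.
Proof.
move=> E [i [A [Qi mA ->]]]; exists [:: i], (fun=> A); split => //.
  by move=> j; rewrite inE => /eqP ->.
apply/seteqP; split => [x xA j|x /(_ i)] /=; first by rewrite inE => /eqP ->.
by apply; rewrite inE.
Qed.

Lemma cylinders_setI Q X : setI_closed (cylinders Q X).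
Proof.
move=> E F [s [A [us sQ mA ->]]] [t [B [ut tQ mB ->]]].
pose C i := (if i \in s then A i else setT) `&` (if i \in t then B i else setT).
exists (undup (s ++ t)), C; split.
- exact: undup_uniq.
- by move=> i; rewrite mem_undup mem_cat => /orP[/sQ|/tQ].
- by move=> i; rewrite /C; apply: measurableI; case: ifP.
- apply/seteqP; split=> x /=.
    move=> [xs xt] i; rewrite /= mem_undup mem_cat => _; split.
      by case: ifPn => // /xs.
    by case: ifPn => // /xt.
  move=> H; split=> i /= is_.
    by have /= := H i; rewrite mem_undup mem_cat is_ => /(_ isT)[]; rewrite is_.
  by have /= := H i; rewrite mem_undup mem_cat is_ orbT => /(_ isT)[]; rewrite is_.
Qed.

Lemma measurable_cylinders Q X : (forall i, measurable_fun setT (X i)) ->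
  cylinders Q X `<=` measurable.
Proof.
move=> mX E [s [A [_ _ mA ->]]].
rewrite bigcap_seq; apply: big_ind => //; first exact: measurableI.
by move=> i _; rewrite -[X in measurable X]setTI; exact: mX.
Qed.

Lemma indep_cylinders D Q Q' X : indep_family D X ->
  Q `<=` D -> Q' `<=` D -> Q `&` Q' = set0 ->
  forall E F, cylinders Q X E -> cylinders Q' X F -> P (E `&` F) = (P E * P F)%E.
Proof.
move=> iX QD Q'D QQ' E F [s [A [us sQ mA ->]]] [t [B [ut tQ mB ->]]].
have st i : i \in s -> i \in t -> False.
  by move=> /sQ Qi /tQ Q'i; have : (Q `&` Q') i by []; rewrite QQ'.
pose C i := if i \in s then A i else B i.
have -> : \bigcap_(i in [set` s]) X i @^-1` A i `&` \bigcap_(i in [set` t]) X i @^-1` B i =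
    \bigcap_(i in [set` s ++ t]) X i @^-1` C i.
  apply/seteqP; split=> x /=.
    move=> [xs xt] i; rewrite /= mem_cat /C; case: ifPn => [/xs//|_ /= /xt //].
  move=> H; split=> i /= i_.
    by have /= := H i; rewrite mem_cat i_ /C i_ => /(_ isT).
  have /= := H i; rewrite mem_cat i_ orbT /C => /(_ isT).
  by case: ifPn => // /st/(_ i_).
rewrite iX//; last 3 first.
- rewrite cat_uniq us ut andbT/=; apply/hasPn => i it; apply/negP => /st; exact.
- by move=> i; rewrite mem_cat => /orP[/sQ/QD|/tQ/Q'D].
- by move=> i; rewrite /C; case: ifP.
rewrite iX//; last by move=> i /sQ/QD.
rewrite iX//; last by move=> i /tQ/Q'D.
rewrite big_cat/=; congr (_ * _)%E.
  by apply: eq_big_seq => i is_; rewrite /C is_.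
by apply: eq_big_seq => i it_; rewrite /C; case: ifPn => // /st/(_ it_).
Qed.

(** The finite measures [P (_]&[F)] and [P F * P] agree on the pi-system [G], hence on the
    sigma-algebra it generates. *)
Lemma indep_ext (G : set_system T) F : setI_closed G -> G `<=` measurable ->
  measurable F -> (forall E, G E -> P (E `&` F) = (P E * P F)%E) ->
  forall E, <<s G >> E -> P (E `&` F) = (P E * P F)%E.
Proof.
move=> GI Gm mF GF E GE.
(* Uniqueness of measures needs a cover of the whole space by members of the generating class, so
   [setT] is adjoined. *)
pose G' := [set E | G E \/ E = setT].
have r0 : 0 <= fine (P F) by apply: fine_ge0.
have PF : P F \is a fin_num by exact: fin_num_measure.
pose m1 := mrestr P mF.
pose m2 := mscale (NngNum r0) P.
have G'E : <<s G' >> E.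
  by move: E GE; apply: sub_sigma_algebra2 => A GA; left.
have m1E A : m1 A = P (A `&` F) by [].
have m2E A : m2 A = (P F * P A)%E by rewrite /m2 /mscale /= fineK.
suff : m1 E = m2 E by rewrite m1E m2E muleC.
apply: (@g_sigma_algebra_measure_unique _ _ _ G' _ (fun=> setT)) => //.
- by move=> A [/Gm//|->].
- by move=> _; right.
- by rewrite bigcup_const//; exists 0%N.
- move=> A B [GA|->] [GB|->]; rewrite ?setIT ?setTI; [left|left|left|right] => //.
  exact: GI.
- move=> A GA; change (m1 A = m2 A); rewrite m1E m2E.
  case: GA => [GA|->]; first by rewrite GF// muleC.
  by rewrite setTI probability_setT mule1.
- move=> k; change (m1 setT < +oo)%E.
  by rewrite m1E ltey_eq fin_num_measure//; apply: measurableI.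
Qed.

(** Independence of cylinders is extended one argument at a time, by [indep_ext] applied to [F] and
    then to [E]. *)
Lemma indep_past D Q Q' X : indep_family D X ->
  (forall i, measurable_fun setT (X i)) ->
  Q `<=` D -> Q' `<=` D -> Q `&` Q' = set0 ->
  forall E F, <<s past Q X >> E -> <<s past Q' X >> F ->
  P (E `&` F) = (P E * P F)%E.
Proof.
move=> iX mX QD Q'D QQ' E F sE sF.
have {}sE : <<s cylinders Q X >> E.
  by move: E sE; apply: sub_sigma_algebra2; exact: past_sub_cylinders.
have {}sF : <<s cylinders Q' X >> F.
  by move: F sF; apply: sub_sigma_algebra2; exact: past_sub_cylinders.
have mc Q0 : cylinders Q0 X `<=` measurable := @measurable_cylinders Q0 X mX.
have mE : measurable E.
  by apply: (smallest_sub (@sigma_algebra_measurable _ T) (mc Q)).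
rewrite setIC muleC; move: F sF; apply: indep_ext => //.
- exact: cylinders_setI.
move=> F cF; rewrite setIC muleC; move: E sE mE => E sE _; move: E sE.
apply: indep_ext => //; first exact: cylinders_setI.
  exact: (mc Q') cF.
move=> E cE; exact: (indep_cylinders iX QD Q'D QQ').
Qed.

End independence.

Section adapted.
Context {d : measure_display} {T : measurableType d} {R : realType}.
Context {I : choiceType}.
Variable (X : I -> T -> R).
Implicit Types (Q : set I) (f g : T -> R).

(* Measurability with respect to the sigma-algebra generated by [X i], [i \in Q]. *)
Definition adapted Q f : Prop :=
  measurable_fun (setT : set (g_sigma_algebraType (past Q X))) f.

Lemma adapted_var Q i : Q i -> adapted Q (X i).
Proof.
move=> Qi _ A mA; rewrite setTI; apply: sub_sigma_algebra.
by exists i, A.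
Qed.

Lemma adapted_sub Q Q' f : Q `<=` Q' -> adapted Q f -> adapted Q' f.
Proof.
move=> QQ' af _ A mA; have := af measurableT A mA.
apply: sub_sigma_algebra2 => E [i [B [Qi mB ->]]].
by exists i, B; split => //; exact: QQ'.
Qed.

Lemma adapted_cst Q r : adapted Q (fun=> r).
Proof. exact: measurable_cst. Qed.

Lemma adaptedM Q f g : adapted Q f -> adapted Q g -> adapted Q (fun x => f x * g x).
Proof. by move=> af ag; apply: measurable_funM. Qed.

Lemma adapted_comp Q f (h : R -> R) : measurable_fun setT h ->
  adapted Q f -> adapted Q (fun x => h (f x)).
Proof. by move=> mh af; apply: measurableT_comp. Qed.

Lemma adapted_sum Q (J : Type) (s : seq J) (f : J -> T -> R) :
  (forall j, adapted Q (f j)) -> adapted Q (fun x => \sum_(j <- s) f j x).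
Proof. by move=> af; apply: measurable_sum. Qed.

Lemma adapted_sum_seq Q (J : eqType) (s : seq J) (f : J -> T -> R) :
  {in s, forall j, adapted Q (f j)} -> adapted Q (fun x => \sum_(j <- s) f j x).
Proof.
move=> af; pose g j := if j \in s then f j else fun=> 0.
rewrite (_ : (fun x => _) = (fun x => \sum_(j <- s) g j x)).
  apply: adapted_sum => j; rewrite /g; case: ifPn => [/af//|_].
  exact: adapted_cst.
by apply/funext => x; apply: eq_big_seq => j js; rewrite /g js.
Qed.

Lemma adapted_measurable Q f : (forall i, measurable_fun setT (X i)) ->
  adapted Q f -> measurable_fun setT f.
Proof.
move=> mX af _ A mA; have := af measurableT A mA.
apply: smallest_sub; first exact: sigma_algebra_measurable.
by move=> E [i [B [_ mB ->]]]; rewrite -[X in measurable X]setTI; exact: mX.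
Qed.

End adapted.

Section nice.
Context {d : measure_display} {T : measurableType d} {R : realType}.
Variable P : probability T R.
Implicit Types (f g : T -> R) (k : nat).

(** Finiteness of all absolute moments gives a class stable under sums and products, in which the
    real-valued [EX] is linear and monotone with no further integrability conditions. *)
Definition nice f : Prop := measurable_fun setT f /\
  forall k, (\int[P]_x (`|f x| ^+ k)%:E < +oo)%E.

Definition EX f : R := (\int[P]_x f x)%R.

Lemma nice_measurable f : nice f -> measurable_fun setT f. Proof. by case. Qed.

Let measX f k : measurable_fun setT f ->
  measurable_fun setT (fun x => (`|f x| ^+ k)%:E).
Proof.
move=> mf; apply/measurable_EFinP; apply: measurable_funX.
by apply: measurableT_comp.
Qed.

Lemma nice_integrable f : nice f -> P.-integrable setT (EFin \o f).
Proof.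
move=> [mf fk]; apply/integrableP; split; first exact/measurable_EFinP.
by have := fk 1%N; congr (_ < _)%E; apply: eq_integral => x _; rewrite /= expr1.
Qed.

Lemma nice_le f g : measurable_fun setT f -> nice g ->
  (forall x, `|f x| <= `|g x|) -> nice f.
Proof.
move=> mf [mg gk] fg; split => // k; apply: le_lt_trans (gk k).
apply: ge0_le_integral => //; try exact: measX.
by move=> x _; rewrite lee_fin lerXn2r// nnegrE.
Qed.

Lemma nice_cst r : nice (fun=> r).
Proof.
split => // k; rewrite integral_cst// (_ : _ setT = 1%E) ?mule1 ?ltry//; exact: (@probability_setT _ _ _ P).
Qed.

Lemma niceD f g : nice f -> nice g -> nice (fun x => f x + g x).
Proof.
move=> [mf fk] [mg gk]; split; first exact: measurable_funD.
move=> k; apply: (@le_lt_trans _ _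
  (\int[P]_x ((2 ^+ k)%:E * ((`|f x| ^+ k)%:E + (`|g x| ^+ k)%:E)))%E).
  apply: ge0_le_integral => //.
  - by apply: measX; exact: measurable_funD.
  - by apply: emeasurable_funM => //; apply: emeasurable_funD; exact: measX.
  move=> x _.
  suff : `|f x + g x| ^+ k <= 2 ^+ k * (`|f x| ^+ k + `|g x| ^+ k).
    by rewrite -lee_fin EFinM EFinD.
  apply: (@le_trans _ _ ((2 * Num.max `|f x| `|g x|) ^+ k)).
    rewrite lerXn2r// ?nnegrE// ?mulr_ge0// ?le_max ?normr_ge0//.
    by rewrite (le_trans (ler_normD _ _))// mulr_natl mulr2n lerD// le_max lexx ?orbT.
  rewrite exprMn ler_wpM2l// ?exprn_ge0//.
  by case: (leP `|f x| `|g x|) => _; rewrite ?lerDl ?lerDr exprn_ge0.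
rewrite ge0_integralZl//; first last.
- by move=> x _; rewrite adde_ge0.
- by apply: emeasurable_funD; exact: measX.
rewrite ge0_integralD//; try exact: measX.
rewrite lte_mul_pinfty// ?lee_fin ?exprn_ge0// lte_add_pinfty//.
Qed.

Lemma niceM f g : nice f -> nice g -> nice (fun x => f x * g x).
Proof.
move=> [mf fk] [mg gk]; split; first exact: measurable_funM.
move=> k; apply: (@le_lt_trans _ _
  (\int[P]_x ((`|f x| ^+ (k * 2))%:E + (`|g x| ^+ (k * 2))%:E))%E).
  apply: ge0_le_integral => //.
  - by apply: measX; exact: measurable_funM.
  - by apply: emeasurable_funD; exact: measX.
  move=> x _.
  suff : `|f x * g x| ^+ k <= `|f x| ^+ (k * 2) + `|g x| ^+ (k * 2).
    by rewrite -lee_fin EFinD.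
  rewrite normrM exprMn !exprM.
  move: (`|f x| ^+ k) (`|g x| ^+ k) => a c.
  have := sqr_ge0 (a - c); have := sqr_ge0 a; have := sqr_ge0 c.
  by nra.
rewrite ge0_integralD//; try exact: measX.
by rewrite lte_add_pinfty.
Qed.

Lemma niceZ r f : nice f -> nice (fun x => r * f x).
Proof. by move=> nf; apply: niceM => //; exact: nice_cst. Qed.

Lemma niceN f : nice f -> nice (fun x => - f x).
Proof.
move=> nf; rewrite (_ : (fun x => _) = fun x => -1 * f x); first exact: niceZ.
by apply/funext => x; rewrite mulN1r.
Qed.

Lemma niceB f g : nice f -> nice g -> nice (fun x => f x - g x).
Proof. by move=> nf ng; apply: niceD => //; exact: niceN. Qed.

Lemma niceX f k : nice f -> nice (fun x => f x ^+ k).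
Proof.
move=> nf; elim: k => [|k IH].
  rewrite (_ : (fun x => _) = fun=> 1); first exact: nice_cst.
  by apply/funext => x; rewrite expr0.
rewrite (_ : (fun x => _) = fun x => f x * f x ^+ k); first exact: niceM.
by apply/funext => x; rewrite exprS.
Qed.

Lemma nice_norm f : nice f -> nice (fun x => `|f x|).
Proof.
move=> nf; apply: (@nice_le _ f) => //; last by move=> x; rewrite normr_id.
by apply: measurableT_comp => //; case: nf.
Qed.

Lemma nice_sum (J : Type) (s : seq J) (f : J -> T -> R) :
  (forall j, nice (f j)) -> nice (fun x => \sum_(j <- s) f j x).
Proof.
move=> nf; elim: s => [|j s IH].
  rewrite (_ : (fun x => _) = fun=> 0); first exact: nice_cst.
  by apply/funext => x; rewrite big_nil.
rewrite (_ : (fun x => _) = fun x => f j x + \sum_(i <- s) f i x); first exact: niceD.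
by apply/funext => x; rewrite big_cons.
Qed.

Lemma EX_cst r : EX (fun=> r) = r.
Proof. 
rewrite /EX Rintegral_cst// (_ : _ setT = 1%E) ?mulr1//.
exact: (@probability_setT _ _ _ P). Qed.

Lemma EXD f g : nice f -> nice g -> EX (fun x => f x + g x) = EX f + EX g.
Proof. by move=> nf ng; rewrite /EX RintegralD//; exact: nice_integrable. Qed.

Lemma EXZ r f : nice f -> EX (fun x => r * f x) = r * EX f.
Proof. by move=> nf; rewrite /EX RintegralZl//; exact: nice_integrable. Qed.

Lemma EXB f g : nice f -> nice g -> EX (fun x => f x - g x) = EX f - EX g.
Proof. by move=> nf ng; rewrite /EX RintegralB//; exact: nice_integrable. Qed.

Lemma EX_sum (J : Type) (s : seq J) (f : J -> T -> R) :
  (forall j, nice (f j)) ->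
  EX (fun x => \sum_(j <- s) f j x) = \sum_(j <- s) EX (f j).
Proof.
move=> nf; elim: s => [|j s IH].
  rewrite big_nil -[RHS]EX_cst; congr EX.
  by apply/funext => x; rewrite big_nil.
rewrite big_cons -IH -EXD//; last exact: nice_sum.
by congr EX; apply/funext => x; rewrite big_cons.
Qed.

Lemma EX_le f g : nice f -> nice g -> (forall x, f x <= g x) -> EX f <= EX g.
Proof.
move=> nf ng fg; apply: le_Rintegral => //; try exact: nice_integrable.
Qed.

Lemma EX_ge0 f : (forall x, 0 <= f x) -> 0 <= EX f.
Proof. by move=> f0; apply: Rintegral_ge0. Qed.

Lemma EFin_EX f : nice f -> (EX f)%:E = (\int[P]_x (f x)%:E)%E.
Proof.
move=> nf; rewrite /EX /Rintegral fineK//.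
by apply: integrable_fin_num => //; exact: nice_integrable.
Qed.

End nice.

Section independent_expectation.
Context {d : measure_display} {T : measurableType d} {R : realType}.
Variable P : probability T R.

(** The hypothesis on rectangles identifies the law of the pair [(f, g)] with the product of the two
    laws; the formula is then Fubini's theorem for the function [z.1 * z.2]. *)
Lemma EX_indep_RV (f g : T -> R) : nice P f -> nice P g ->
  (forall A B, measurable A -> measurable B ->
    (P (f @^-1` A `&` g @^-1` B) = P (f @^-1` A) * P (g @^-1` B))%E) ->
  EX P (fun x => f x * g x) = EX P f * EX P g.
Proof.
move=> nf ng fgI.
have mf := nice_measurable nf; have mg := nice_measurable ng.
pose f_mixin := isMeasurableFun.Build _ _ _ _ f mf.
pose f_RV : {RV P >-> R} := HB.pack f f_mixin.
pose g_mixin := isMeasurableFun.Build _ _ _ _ g mg.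
pose g_RV : {RV P >-> R} := HB.pack g g_mixin.
pose m1 := distribution P f_RV.
pose m2 := distribution P g_RV.
pose h x := (f x, g x).
have mh : measurable_fun setT h by exact: measurable_fun_pair.
pose F (z : R * R) : \bar R := (z.1 * z.2)%:E.
have mF : measurable_fun setT F.
  by apply/measurable_EFinP; apply: measurable_funM.
have nfg := niceM nf ng.
have iF : P.-integrable (h @^-1` setT) (F \o h).
  by rewrite preimage_setT; exact: (nice_integrable nfg).
have eqm (A : set (R * R)) : measurable A -> A `<=` setT ->
    (m1 \x m2)%E A = pushforward P h A.
  by move=> mA _; apply: product_measure_unique.
have i12 : (m1 \x m2)%E.-integrable setT F.
  have := integrable_pushforward mh mF iF measurableT.
  move=> /integrableP[_ ioo]; apply/integrableP; split => //.
  by rewrite (eq_measure_integral (pushforward P h)).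
apply: EFin_inj; rewrite EFin_EX//.
transitivity (\int[pushforward P h]_z F z)%E.
  rewrite integral_pushforward// preimage_setT.
rewrite -(eq_measure_integral _ eqm).
rewrite -integral12_prod_meas1//.
have E2 x : fubini_F m2 F x = (x * EX P g)%:E.
  rewrite /fubini_F /F /=.
  under eq_integral do rewrite EFinM.
  rewrite integralZl//=.
    rewrite EFinM; congr (_ * _)%E.
    rewrite integral_distribution//=; last exact: nice_integrable.
    by rewrite EFin_EX.
  by have := @integrable_pushforward _ _ _ _ _ g mg P setT EFin
    _ (nice_integrable ng) measurableT; apply; exact/measurable_EFinP.
under eq_integral do rewrite E2 EFinM.
rewrite integralZr//=.
  rewrite EFinM; congr (_ * _)%E.
  rewrite integral_distribution//=; last exact: nice_integrable.
  by rewrite EFin_EX.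
by have := @integrable_pushforward _ _ _ _ _ f mf P setT EFin
  _ (nice_integrable nf) measurableT; apply; exact/measurable_EFinP.
exact: mh.
Qed.

Context {I : choiceType}.

Lemma EX_indep (D Q Q' : set I) (X : I -> T -> R) (f g : T -> R) :
  indep_family P D X -> (forall i, measurable_fun setT (X i)) ->
  Q `<=` D -> Q' `<=` D -> Q `&` Q' = set0 ->
  adapted X Q f -> adapted X Q' g -> nice P f -> nice P g ->
  EX P (fun x => f x * g x) = EX P f * EX P g.
Proof.
move=> iX mX QD Q'D QQ' af ag nf ng; apply: EX_indep_RV => // A B mA mB.
apply: (indep_past iX mX QD Q'D QQ').
- by have := af measurableT A mA; rewrite setTI.
- by have := ag measurableT B mB; rewrite setTI.
Qed.

End independent_expectation.

(** * Gaussian weights *)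

Section density.
Context {d : measure_display} {T : measurableType d} {R : realType}.
Variables (mu : {sigma_finite_measure set T -> \bar R}) (nu : {finite_measure set T -> \bar R}).
Variable g : T -> R.
Hypothesis g0 : forall x, 0 <= g x.
Hypothesis mg : measurable_fun setT g.
Hypothesis nuE : forall A, measurable A -> nu A = (\int[mu]_(x in A) (g x)%:E)%E.

(** By uniqueness, [g] agrees almost everywhere with the Radon-Nikodym derivative of [nu], for which
    the change of variables is known. *)
Lemma ge0_integral_density (E : set T) (f : T -> \bar R) :
  measurable E -> (forall x, 0 <= f x)%E -> measurable_fun E f ->
  (\int[nu]_(x in E) f x = \int[mu]_(x in E) (f x * (g x)%:E))%E.
Proof.
move=> mE f0 mf.
have mEg : measurable_fun setT (EFin \o g) by exact/measurable_EFinP.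
have numu : nu `<< mu.
  apply/null_content_dominatesP => A mA muA; rewrite nuE//.
  by apply: null_set_integral => //; exact: measurable_funTS.
have ig : mu.-integrable setT (EFin \o g).
  apply/integrableP; split=> //.
  under eq_integral do rewrite /= ger0_norm//.
  by rewrite -nuE// ltey_eq fin_num_measure.
have gE : ae_eq mu E (EFin \o g) (Radon_Nikodym_SigmaFinite.f nu mu).
  apply: integral_ae_eq => //.
  - exact: integrableS ig.
  - apply: measurable_funTS.
    exact: measurable_int (Radon_Nikodym_SigmaFinite.f_integrable numu).
  by move=> A _ mA; rewrite -nuE// (Radon_Nikodym_SigmaFinite.f_integral numu).
rewrite -(Radon_Nikodym_SigmaFinite.change_of_variables numu f0 mE mf).
apply: ae_eq_integral => //.
- apply: emeasurable_funM => //; apply: measurable_funTS.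
  exact: measurable_int (Radon_Nikodym_SigmaFinite.f_integrable numu).
- by apply: emeasurable_funM => //; exact: measurable_funTS.
- by apply: ae_eqe_mul2l; exact/ae_eq_sym.
Qed.

End density.

Section gaussian.
Context {d : measure_display} {T : measurableType d} {R : realType}.
Variable P : probability T R.

Definition gaussian (X : T -> R) : Prop := measurable_fun setT X /\
  forall A, measurable A -> P (X @^-1` A) = normal_prob 0 1 A.

(** Completing the square: the exponential moment of a Gaussian becomes the total mass of a
    translated Gaussian density. *)
Lemma normal_pdf_shift (t x : R) :
  expR (t * x) * normal_pdf 0 1 x = expR (t ^+ 2 / 2) * normal_pdf t 1 x.
Proof.
rewrite !normal_pdfE ?oner_neq0// /normal_fun mulrCA [RHS]mulrCA.
congr (_ * _); rewrite -!expRD; congr expR.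
by rewrite subr0 expr1n; field.
Qed.

Lemma integral_expR_gaussian X (t : R) : gaussian X ->
  (\int[P]_x (expR (t * X x))%:E = (expR (t ^+ 2 / 2))%:E)%E.
Proof.
move=> [mX XN].
have me : measurable_fun setT (fun y : measurableTypeR R => expR (t * y)).
  by apply: measurableT_comp => //; exact: measurable_funM.
have mX' : measurable_fun setT (X : T -> measurableTypeR R) by exact: mX.
have -> : (\int[P]_x (expR (t * X x))%:E =
    \int[pushforward P (X : T -> measurableTypeR R)]_y (expR (t * y))%:E)%E.
  by rewrite ge0_integral_pushforward//; exact/measurable_EFinP.
transitivity (\int[@normal_prob R 0 1]_y (expR (t * y))%:E)%E.
  by apply: eq_measure_integral => A mA _; exact: XN.
rewrite (@ge0_integral_density _ _ _ lebesgue_measure (@normal_prob R 0 1) (normal_pdf 0 1))//.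
- under eq_integral do rewrite -EFinM normal_pdf_shift EFinM.
  rewrite ge0_integralZl//.
  + by rewrite integral_normal_pdf mule1.
  + by apply/measurable_EFinP; exact: measurable_normal_pdf.
  + by move=> x _; rewrite lee_fin normal_pdf_ge0.
- exact: normal_pdf_ge0.
- exact: measurable_normal_pdf.
- exact/measurable_EFinP.
Qed.

Lemma nice_expR_gaussian X (t : R) : gaussian X -> nice P (fun x => expR (t * X x)).
Proof.
move=> gX; split.
  apply: measurableT_comp => //; apply: measurable_funM => //.
  by case: gX.
move=> k; under eq_integral => x _.
  rewrite ger0_norm ?expR_ge0// -expRM_natl mulrA; over.
by rewrite integral_expR_gaussian// ltry.
Qed.

Lemma EX_expR_gaussian X (t : R) : gaussian X ->
  EX P (fun x => expR (t * X x)) = expR (t ^+ 2 / 2).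
Proof.
move=> gX; apply: EFin_inj; rewrite EFin_EX; last exact: nice_expR_gaussian.
exact: integral_expR_gaussian.
Qed.

End gaussian.

(** * Moments of sums of independent centred variables *)

Section binomial_bound.
Variable R : realFieldType.

Lemma exprn_even_interp (s x : R) (m i : nat) : (i <= 2 * m)%N ->
  `|s ^+ (2 * m - i) * x ^+ i| <= s ^+ (2 * m) + x ^+ (2 * m).
Proof.
move=> im.
have E (y : R) : y ^+ (2 * m) = `|y| ^+ (2 * m).
  by rewrite !exprM -normrX ger0_norm// sqr_ge0.
rewrite E (E x) normrM !normrX.
have [sx|xs] := leP `|s| `|x|.
  apply: (@le_trans _ _ (`|x| ^+ (2 * m))); last by rewrite lerDr exprn_ge0.
  by rewrite -[in leRHS](subnK im) exprD ler_wpM2r ?exprn_ge0// lerXn2r ?nnegrE.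
apply: (@le_trans _ _ (`|s| ^+ (2 * m))); last by rewrite lerDl exprn_ge0.
by rewrite -[in leRHS](subnK im) exprD ler_wpM2l ?exprn_ge0// lerXn2r ?nnegrE// ltW.
Qed.

(** The linear term is kept exact because it will have zero expectation. Every later monomial
    contains [x ^+ 2], its other factor is controlled by [exprn_even_interp], and the binomial
    coefficients sum to at most [2 ^+ (2 * m.+1)]. *)
Lemma exprDn_second_order (s x : R) (m : nat) :
  (s + x) ^+ (2 * m.+1) <= s ^+ (2 * m.+1) + (2 * m.+1)%:R * (s ^+ (2 * m).+1 * x)
    + 2 ^+ (2 * m.+1) * (x ^+ 2 * (s ^+ (2 * m) + x ^+ (2 * m))).
Proof.
have -> : (2 * m.+1 = (2 * m).+2)%N by rewrite mulnS.
have E (y z : R) n : (y + z) ^+ n = \sum_(i < n.+1) 'C(n, i)%:R * (y ^+ (n - i) * z ^+ i).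
  by rewrite exprDn; apply: eq_bigr => i _; rewrite mulr_natl.
rewrite E big_ord_recl big_ord_recl /= subn0 expr0 mulr1 bin0 mul1r.
rewrite /bump /= addn0 subn1 /= expr1 bin1 addrA lerD2l.
have c0 : 0 <= x ^+ 2 * (s ^+ (2 * m) + x ^+ (2 * m)).
  by rewrite mulr_ge0 ?sqr_ge0// addr_ge0// exprM exprn_ge0// sqr_ge0.
apply: (@le_trans _ _ (\sum_(i < (2 * m).+1)
    ('C((2 * m).+2, i.+2))%:R * (x ^+ 2 * (s ^+ (2 * m) + x ^+ (2 * m))))).
  apply: ler_sum => i _; rewrite ler_wpM2l// /bump /= !add1n.
  rewrite !subSS -[i.+2]/(2 + i)%N exprD mulrCA ler_wpM2l ?sqr_ge0//.
  by apply: le_trans (ler_norm _) _; apply: exprn_even_interp; rewrite -ltnS.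
rewrite -mulr_suml ler_wpM2r//.
have -> : (2 : R) = 1 + 1 by [].
rewrite E [leRHS]big_ord_recl [X in _ <= _ + X]big_ord_recl addrA.
apply: ler_wpDl; first by rewrite !expr1n addr_ge0// !mulr1.
by apply: ler_sum => i _; rewrite !expr1n !mulr1.
Qed.

End binomial_bound.

Section moments.
Context {R : realType}.

(** Here [M k] bounds the moment of order [2 * k] of one variable. The recursion mirrors the
    remainder in [exprDn_second_order]: its first summand pairs a second moment with the previous
    order, its second is a single top-order moment. *)
Fixpoint momc (M : nat -> R) (m : nat) : R :=
  if m is m'.+1 then 2 ^+ (2 * m'.+1) * (momc M m' * M 1%N + M m'.+1) else 1.

Lemma momc_ge0 M m : (forall k, 0 <= M k) -> 0 <= momc M m.
Proof.
move=> M0; elim: m => //= m IH.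
by rewrite mulr_ge0// ?exprn_ge0// addr_ge0// mulr_ge0.
Qed.

Context {d : measure_display} {T : measurableType d} (P : probability T R).
Context {I : choiceType} (D Q : set I) (X : I -> T -> R) (h : R -> R) (M : nat -> R).
Hypothesis iX : indep_family P D X.
Hypothesis mX : forall i, measurable_fun setT (X i).
Hypothesis mh : measurable_fun setT h.
Hypothesis nh : forall i, D i -> nice P (fun x => h (X i x)).
Hypothesis h0 : forall i, D i -> EX P (fun x => h (X i x)) = 0.
Hypothesis hM : forall i k, D i -> EX P (fun x => h (X i x) ^+ (2 * k)) <= M k.
Hypothesis QD : Q `<=` D.

Lemma past_new_moment (Q' : set I) (f : T -> R) i k : Q' `<=` D -> D i -> ~ Q' i ->
  adapted X Q' f -> nice P f ->
  EX P (fun x => f x * h (X i x) ^+ k) = EX P f * EX P (fun x => h (X i x) ^+ k).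
Proof.
move=> Q'D Di Q'i af nf.
apply: (EX_indep (D := D) (Q := Q') (Q' := [set i]) iX mX Q'D _ _ af) => //.
- by move=> _ ->.
- by rewrite -subset0 => j [Q'j /= ij]; apply: Q'i; rewrite -ij.
- apply: (adapted_comp (h := fun y => h y ^+ k)).
    by apply: measurable_funX.
  by apply: adapted_var.
- exact/niceX/nh.
Qed.

(** A moment inequality of Marcinkiewicz-Zygmund type with random coefficients fixed by the past.
    The induction is double, on the order and on the list. The weight [G] makes it work: peeling off
    [v] multiplies [G] by [al v ^+ 2], again a function of the past, and lowers the order by two. *)
Lemma conditional_moment_bound (l : seq I) (m : nat) (G : T -> R) (al : I -> T -> R) :
  uniq l -> {in l, forall i, D i /\ ~ Q i} ->
  (forall x, 0 <= G x) -> nice P G -> adapted X Q G ->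
  (forall i, nice P (al i)) -> (forall i, adapted X Q (al i)) ->
  EX P (fun x => G x * (\sum_(i <- l) al i x * h (X i x)) ^+ (2 * m)) <=
  momc M m * EX P (fun x => G x * (\sum_(i <- l) al i x ^+ 2) ^+ m).
Proof.
(* Nonnegativity of [M k] comes from comparison with a moment at some index of [D], so the case of
   an empty [D] is treated apart. *)
have [D0|] := eqVneq D set0.
  case: l => [|i l] ul lD G0 nG aG nal aal; last first.
    by have [] := lD i (mem_head _ _); rewrite D0.
  case: m => [|m]; first by rewrite muln0 mul1r lexx.
  rewrite (_ : (fun x => _) = fun=> 0); last first.
    by apply/funext => x; rewrite big_nil mulnS expr0n mulr0.
  rewrite [X in _ <= _ * EX _ X](_ : _ = fun=> 0); last first.
    by apply/funext => x; rewrite big_nil expr0n mulr0.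
  by rewrite EX_cst mulr0.
move=> /set0P[i0 Di0].
have M0 k : 0 <= M k.
  apply: le_trans (hM k Di0); apply: EX_ge0 => x.
  by rewrite exprM exprn_ge0// sqr_ge0.
elim: m l G => [|m IHm] l G ul lD G0 nG aG nal aal.
  by rewrite muln0 mul1r.
elim: l ul lD => [|v l IHl].
  move=> _ _; rewrite (_ : (fun x => _) = fun=> 0); last first.
    by apply/funext => x; rewrite big_nil mulnS expr0n mulr0.
  rewrite [X in _ <= _ * EX _ X](_ : _ = fun=> 0); last first.
    by apply/funext => x; rewrite big_nil expr0n mulr0.
  by rewrite EX_cst mulr0.
move=> /= /andP[vl ul] lD.
have [Dv Qv] := lD v (mem_head _ _).
have {}lD : {in l, forall i, D i /\ ~ Q i}.
  by move=> i il; apply: lD; rewrite inE il orbT.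
pose Q' := Q `|` [set` l].
have Q'D : Q' `<=` D by move=> i [/QD//|/lD[]].
have Q'v : ~ Q' v by move=> [//|/=]; rewrite (negbTE vl).
pose S x := \sum_(i <- l) al i x * h (X i x).
pose V x := \sum_(i <- l) al i x ^+ 2.
have nS : nice P S.
  pose g i x := if i \in l then al i x * h (X i x) else 0.
  rewrite (_ : S = fun x => \sum_(i <- l) g i x); last first.
    by apply/funext => x; apply: eq_big_seq => i il; rewrite /g il.
  apply: nice_sum => i; rewrite /g; have [il|_] := boolP (i \in l); last exact: nice_cst.
  by apply: niceM => //; apply: nh; have [] := lD i il.
have aS : adapted X Q' S.
  apply: adapted_sum_seq => i il; apply: adaptedM.
    by apply: adapted_sub (aal i) => j; left.
  by apply: adapted_comp => //; apply: adapted_var; right.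
have nV : nice P V by apply: nice_sum => i; exact: niceX.
have QQ' : Q `<=` Q' by move=> j; left.
have adX Q0 f k : adapted X Q0 f -> adapted X Q0 (fun x => f x ^+ k).
  by move=> af; apply: (adapted_comp (h := fun y => y ^+ k)) => //; exact: measurable_funX.
pose C : R := 2 ^+ (2 * m.+1).
have C0 : 0 <= C by rewrite exprn_ge0.
have V0 x : 0 <= V x by apply: sumr_ge0 => i _; exact: sqr_ge0.
(* the cross term vanishes because [h (X v)] is centred and independent of the rest *)
have cross : EX P (fun x => G x * S x ^+ (2 * m).+1 * al v x * h (X v x) ^+ 1) = 0.
  rewrite (@past_new_moment Q')//.
  - have -> : (fun x => h (X v x) ^+ 1) = (fun x => h (X v x)) by [].
    by rewrite h0// mulr0.
  - by apply: adaptedM; [apply: adaptedM; [exact: adapted_sub aG|exact: adX]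
      |exact: adapted_sub (aal v)].
  - by apply: niceM => //; apply: niceM => //; exact: niceX.
have nhv := nh Dv.
have quad : EX P (fun x => G x * al v x ^+ 2 * S x ^+ (2 * m) * h (X v x) ^+ 2) <=
    M 1%N * (momc M m * EX P (fun x => G x * al v x ^+ 2 * V x ^+ m)).
  rewrite (@past_new_moment Q')//; last 2 first.
  - apply: adaptedM; last exact: adX.
    by apply: adaptedM; [exact: adapted_sub aG|apply: adX; exact: adapted_sub (aal v)].
  - by apply: niceM; [apply: niceM => //; exact: niceX|exact: niceX].
  rewrite mulrC; apply: ler_pM.
  - by apply: EX_ge0 => x; exact: sqr_ge0.
  - apply: EX_ge0 => x; rewrite mulr_ge0//; first by rewrite mulr_ge0// sqr_ge0.
    by rewrite exprM exprn_ge0// sqr_ge0.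
  - exact: (hM 1).
  apply: (IHm l (fun x => G x * al v x ^+ 2)) => //.
  - by move=> x; rewrite mulr_ge0// sqr_ge0.
  - by apply: niceM => //; exact: niceX.
  - by apply: adaptedM => //; exact: adX.
have high : EX P (fun x => G x * al v x ^+ (2 * m.+1) * h (X v x) ^+ (2 * m.+1)) <=
    M m.+1 * EX P (fun x => G x * al v x ^+ (2 * m.+1)).
  rewrite (@past_new_moment Q)//; last 2 first.
  - by apply: adaptedM => //; exact: adX.
  - by apply: niceM => //; exact: niceX.
  rewrite mulrC; apply: ler_wpM2r; last exact: hM.
  by apply: EX_ge0 => x; rewrite mulr_ge0// exprM exprn_ge0// sqr_ge0.
have first_ : EX P (fun x => G x * S x ^+ (2 * m.+1)) <=
    momc M m.+1 * EX P (fun x => G x * V x ^+ m.+1).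
  exact: IHl.
pose U1 x := G x * S x ^+ (2 * m.+1).
pose U2 x := G x * S x ^+ (2 * m).+1 * al v x * h (X v x) ^+ 1.
pose U3 x := G x * al v x ^+ 2 * S x ^+ (2 * m) * h (X v x) ^+ 2.
pose U4 x := G x * al v x ^+ (2 * m.+1) * h (X v x) ^+ (2 * m.+1).
have nU1 : nice P U1 by apply: niceM => //; exact: niceX.
have nU2 : nice P U2.
  by apply: niceM; [apply: niceM => //; apply: niceM => //; exact: niceX|exact: niceX].
have nU3 : nice P U3.
  by apply: niceM; [apply: niceM; [apply: niceM => //|]|]; exact: niceX.
have nU4 : nice P U4.
  by apply: niceM; [apply: niceM => //|]; exact: niceX.
apply: (@le_trans _ _ (EX P (fun x => U1 x + (2 * m.+1)%:R * U2 x + C * (U3 x + U4 x)))).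
  apply: EX_le.
  - apply: niceM => //; apply: niceX; apply: (nice_le (g := fun x => al v x * h (X v x) + S x)).
    + apply: (adapted_measurable (Q := Q' `|` [set v]) mX).
      apply: adapted_sum_seq => i; rewrite inE => il; apply: adaptedM.
        by apply: adapted_sub (aal i) => j Qj; left; left.
      apply: adapted_comp => //; apply: adapted_var.
      by case/orP: il => [/eqP ->|il]; [right|left; right].
    + by apply: niceD => //; exact: niceM.
    + by move=> x; rewrite big_cons.
  - by apply: niceD; [apply: niceD => //; exact: niceZ|apply: niceZ; exact: niceD].
  move=> x; rewrite big_cons -/(S x) addrC.
  have := ler_wpM2l (G0 x) (exprDn_second_order (S x) (al v x * h (X v x)) m).
  move/le_trans; apply; rewrite le_eqVlt; apply/orP; left; apply/eqP.
  rewrite /U1 /U2 /U3 /U4 -/C expr1 mulnS !exprD !exprMn.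
  move: (S x ^+ _) (S x ^+ _) (al v x ^+ (2 * m)) (h (X v x) ^+ (2 * m)) => A1 A2 A3 A4.
  by ring.
rewrite EXD; [|by apply: niceD => //; exact: niceZ|by apply: niceZ; exact: niceD].
rewrite EXD//; last exact: niceZ.
rewrite EXZ// EXZ; last exact: niceD.
rewrite EXD// cross mulr0 addr0.
pose W x := G x * al v x ^+ 2 * V x ^+ m.
pose W' x := G x * al v x ^+ (2 * m.+1).
have nW : nice P W by apply: niceM; [apply: niceM => //|]; exact: niceX.
have nW' : nice P W' by apply: niceM => //; exact: niceX.
have nGV : nice P (fun x => G x * V x ^+ m.+1) by apply: niceM => //; exact: niceX.
(* Both remainders are dominated by [H], and with [y = al v ^+ 2] the sum closes by [y * (y + V) ^+
   m + V ^+ m.+1 <= (y + V) ^+ m.+1]. *)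
pose H x := G x * al v x ^+ 2 * (al v x ^+ 2 + V x) ^+ m.
have nH : nice P H.
  by apply: niceM; [apply: niceM => //; exact: niceX|apply: niceX; apply: niceD => //; exact: niceX].
have G2 x : 0 <= G x * al v x ^+ 2 by rewrite mulr_ge0// sqr_ge0.
have WH : EX P W <= EX P H.
  apply: EX_le => // x; rewrite /W /H ler_wpM2l// lerXn2r// ?nnegrE//.
    by rewrite addr_ge0// sqr_ge0.
  by rewrite lerDr sqr_ge0.
have W'H : EX P W' <= EX P H.
  apply: EX_le => // x; rewrite /W' /H mulnS exprD mulrA ler_wpM2l// exprM.
  by rewrite lerXn2r// ?nnegrE ?sqr_ge0 ?addr_ge0 ?sqr_ge0// lerDl.
apply: (@le_trans _ _ (momc M m.+1 * (EX P (fun x => G x * V x ^+ m.+1) + EX P H))).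
  rewrite [leRHS]mulrDr lerD//= -mulrA -/C ler_wpM2l//.
  rewrite mulrDl lerD//.
    apply: (le_trans quad); rewrite -/W [_ * M 1%N]mulrC -mulrA ler_wpM2l//.
    by rewrite ler_wpM2l// momc_ge0.
  by apply: (le_trans high); rewrite ler_wpM2l.
rewrite ler_wpM2l ?momc_ge0// -EXD//; apply: EX_le.
- exact: niceD.
- apply: niceM => //; apply: niceX.
  by apply: nice_sum => i; exact: niceX.
move=> x; rewrite /H big_cons -/(V x) -mulrA -mulrDr ler_wpM2l//.
rewrite [leRHS]exprS mulrDl addrC lerD2l exprS ler_wpM2l//.
by rewrite lerXn2r// ?nnegrE// ?addr_ge0 ?sqr_ge0// lerDr sqr_ge0.
Qed.

End moments.

(** * Gaussian cascades *)

Section gauss_family.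
Context {d : measure_display} {T : measurableType d} {R : realType} {b : nat}.
Implicit Types (X : seq 'I_b -> T -> R) (u v w : seq 'I_b) (t q : R) (n : nat).

Definition nonnil : set (seq 'I_b) := [set u | u != [::]].

Definition upto n : set (seq 'I_b) := [set u | u != [::] /\ (size u <= n)%N].

Definition gauss_family (P : probability T R) X : Prop :=
  [/\ forall u, measurable_fun setT (X u), indep_family P nonnil X &
      forall u, nonnil u -> gaussian P (X u)].

Definition subtree u X : seq 'I_b -> T -> R := fun w => X (u ++ w).

Definition psum X u x : R := \sum_(j < size u) X (take j.+1 u) x.

(** The parameter [t] is left free because, by [gwt_powR], the [q]-th power of a weight of parameter
    [t] is a constant times the weight of parameter [q * t]. Power sums of weights are thus total
    masses of another normalised cascade. *)
Definition gwt t X u x : R := expR (t * psum X u x - t ^+ 2 / 2 * (size u)%:R).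

Definition Zmass t X n x : R := (b%:R ^+ n)^-1 * \sum_(u <- words b n) gwt t X u x.

Lemma psum_cat X u w x : psum X (u ++ w) x = psum X u x + psum (subtree u X) w x.
Proof.
rewrite /psum size_cat big_split_ord /=; congr (_ + _); apply: eq_bigr => j _.
  rewrite take_cat; case: ltnP => // uj.
  have -> : j.+1 = size u by apply/eqP; rewrite eqn_leq uj ltn_ord.
  by rewrite subnn take0 cats0 take_size.
by rewrite /subtree take_cat ltnNge -addnS leq_addr/= addKn.
Qed.

Lemma psum_rcons X u a x : psum X (rcons u a) x = psum X u x + X (rcons u a) x.
Proof. by rewrite -cats1 psum_cat /psum/= big_ord1 /subtree. Qed.

Lemma gwt_cat t X u w x : gwt t X (u ++ w) x = gwt t X u x * gwt t (subtree u X) w x.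
Proof.
by rewrite /gwt -expRD psum_cat size_cat natrD; congr expR; ring.
Qed.

Lemma gwt_rcons t X u a x :
  gwt t X (rcons u a) x = gwt t X u x * expR (t * X (rcons u a) x - t ^+ 2 / 2).
Proof.
by rewrite /gwt -expRD psum_rcons size_rcons -natr1; congr expR; ring.
Qed.

Lemma gwt_gt0 t X u x : 0 < gwt t X u x. Proof. exact: expR_gt0. Qed.
Lemma gwt_ge0 t X u x : 0 <= gwt t X u x. Proof. exact: expR_ge0. Qed.

Lemma gwt_nil t X x : gwt t X [::] x = 1.
Proof. by rewrite /gwt /psum big_ord0 /= !mulr0 subrr expR0. Qed.

Lemma gwt_powR t q X u x : gwt t X u x `^ q =
  expR ((q ^+ 2 - q) * t ^+ 2 / 2) ^+ size u * gwt (q * t) X u x.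
Proof.
by rewrite /gwt -expRM -expRM_natl -expRD; congr expR; field.
Qed.

Lemma Zmass_ge0 t X n x : 0 <= Zmass t X n x.
Proof.
by rewrite /Zmass mulr_ge0 ?invr_ge0 ?exprn_ge0//; apply: sumr_ge0 => u _; exact: gwt_ge0.
Qed.

Lemma Zmass_cat t X n k x : Zmass t X (n + k) x =
  (b%:R ^+ n)^-1 * \sum_(u <- words b n) gwt t X u x * Zmass t (subtree u X) k x.
Proof.
rewrite /Zmass exprD invfM -mulrA; congr (_ * _).
rewrite sum_words_cat mulr_sumr; apply: eq_bigr => u _.
rewrite mulrCA; congr (_ * _); rewrite mulr_sumr; apply: eq_bigr => w _.
by rewrite gwt_cat.
Qed.

Lemma adapted_psum X u (Q : set (seq 'I_b)) :
  (forall j, (j < size u)%N -> Q (take j.+1 u)) -> adapted X Q (psum X u).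
Proof.
by move=> Qu; apply: adapted_sum => j; apply: adapted_var; exact: Qu.
Qed.

Lemma adapted_gwt t X u (Q : set (seq 'I_b)) :
  (forall j, (j < size u)%N -> Q (take j.+1 u)) -> adapted X Q (gwt t X u).
Proof.
move=> Qu; apply: (adapted_comp (h := fun y => expR (t * y - t ^+ 2 / 2 * (size u)%:R))).
  by apply: measurableT_comp => //; apply: measurable_funB => //; exact: measurable_funM.
exact: adapted_psum.
Qed.

Lemma upto_take n u j : (size u <= n)%N -> (j < size u)%N -> upto n (take j.+1 u).
Proof.
move=> un ju; split; first by rewrite -size_eq0 size_takel.
by rewrite size_takel// (leq_trans ju un).
Qed.

Lemma adapted_gwt_upto t X u n : (size u <= n)%N -> adapted X (upto n) (gwt t X u).
Proof. by move=> un; apply: adapted_gwt => j; exact: upto_take. Qed.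

Lemma adapted_Zmass t X n : adapted X (upto n) (Zmass t X n).
Proof.
apply: adaptedM; first exact: adapted_cst.
apply: adapted_sum_seq => u; rewrite mem_words => /eqP un.
by apply: adapted_gwt_upto; rewrite un.
Qed.

Variable P : probability T R.

Lemma gauss_family_subtree X u : gauss_family P X -> gauss_family P (subtree u X).
Proof.
move=> [mX iX gX]; split => [w||w]; first exact: mX.
  move=> s A us ns mA.
  pose B v := A (drop (size u) v).
  have := iX [seq u ++ w | w <- s] B.
  rewrite map_inj_uniq; last by move=> v w /eqP; rewrite eqseq_cat// eqxx => /eqP.
  move=> /(_ us) H.
  have H1 : {in [seq u ++ w | w <- s], forall v, nonnil v}.
    by move=> v /mapP[w ws ->]; have := ns _ ws; rewrite /nonnil /=; case: (u).
  have H2 v : measurable (B v) by exact: mA.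
  have {H1 H2}H := H H1 H2.
  rewrite (_ : \bigcap_(i in _) _ =
      \bigcap_(i in [set` [seq u ++ w | w <- s]]) X i @^-1` B i).
    rewrite H big_map; apply: eq_bigr => w _.
    by rewrite /B drop_size_cat.
  apply/seteqP; split => x /= H1 w /=.
    by move=> /mapP[v vs ->]; rewrite /B drop_size_cat//; exact: H1.
  move=> ws; have := H1 (u ++ w); rewrite /B drop_size_cat//; apply.
  by apply/mapP; exists w.
by move=> nw; apply: gX; move: nw; rewrite /nonnil /=; case: (u).
Qed.

Variable X : seq 'I_b -> T -> R.
Hypothesis gX : gauss_family P X.

Let mX u : measurable_fun setT (X u). Proof. by case: gX. Qed.
Let iX : indep_family P nonnil X. Proof. by case: gX. Qed.
Let gauX u : nonnil u -> gaussian P (X u). Proof. by case: gX => _ _; apply. Qed.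

Lemma upto_nonnil n : upto n `<=` nonnil. Proof. by move=> u []. Qed.

Lemma measurable_gwt t u : measurable_fun setT (gwt t X u).
Proof. by apply: (adapted_measurable (Q := upto (size u)) mX); exact: adapted_gwt_upto. Qed.

Lemma measurable_Zmass t n : measurable_fun setT (Zmass t X n).
Proof. by apply: (adapted_measurable (Q := upto n) mX); exact: adapted_Zmass. Qed.

Lemma nice_step t v : nonnil v -> nice P (fun x => expR (t * X v x - t ^+ 2 / 2)).
Proof.
move=> nv; rewrite (_ : (fun x => _) = fun x => expR (- (t ^+ 2 / 2)) * expR (t * X v x)).
  by apply: niceZ; apply: nice_expR_gaussian; exact: gauX.
by apply/funext => x; rewrite -expRD addrC.
Qed.

Lemma EX_step t v : nonnil v -> EX P (fun x => expR (t * X v x - t ^+ 2 / 2)) = 1.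
Proof.
move=> nv; rewrite (_ : (fun x => _) = fun x => expR (- (t ^+ 2 / 2)) * expR (t * X v x)).
  rewrite EXZ; last by apply: nice_expR_gaussian; exact: gauX.
  by rewrite (EX_expR_gaussian _ (gauX nv)) -expRD addrC subrr expR0.
by apply/funext => x; rewrite -expRD addrC.
Qed.

Lemma nonnil_rcons u a : nonnil (rcons u a).
Proof. by rewrite /nonnil /=; case: (u). Qed.

Lemma nice_gwt t u : nice P (gwt t X u).
Proof.
elim/last_ind: u => [|u a IH].
  rewrite (_ : gwt t X [::] = fun=> 1); first exact: nice_cst.
  by apply/funext => x; rewrite gwt_nil.
rewrite (_ : gwt t X _ = fun x => gwt t X u x * expR (t * X (rcons u a) x - t ^+ 2 / 2)).
  by apply: niceM => //; apply: nice_step; exact: nonnil_rcons.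
by apply/funext => x; rewrite gwt_rcons.
Qed.

Lemma EX_gwt t u : EX P (gwt t X u) = 1.
Proof.
elim/last_ind: u => [|u a IH].
  rewrite (_ : gwt t X [::] = fun=> 1); first exact: EX_cst.
  by apply/funext => x; rewrite gwt_nil.
rewrite (_ : gwt t X _ = fun x => gwt t X u x * expR (t * X (rcons u a) x - t ^+ 2 / 2)).
  rewrite (EX_indep (D := nonnil) (Q := upto (size u)) (Q' := [set rcons u a]) iX mX).
  - by rewrite IH EX_step ?mulr1//; exact: nonnil_rcons.
  - exact: upto_nonnil.
  - by move=> _ ->; exact: nonnil_rcons.
  - rewrite -subset0 => v [[_ vu] /= vE].
    by move: vu; rewrite vE size_rcons ltnn.
  - exact: adapted_gwt_upto.
  - apply: (adapted_comp (h := fun y => expR (t * y - t ^+ 2 / 2))).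
      apply: measurableT_comp => //; apply: measurable_funB => //.

    exact: adapted_var.
  - exact: nice_gwt.
  - by apply: nice_step; exact: nonnil_rcons.
by apply/funext => x; rewrite gwt_rcons.
Qed.

Lemma nice_Zmass t n : nice P (Zmass t X n).
Proof. by apply: niceZ; apply: nice_sum => u; exact: nice_gwt. Qed.

Lemma EX_Zmass t n : (0 < b)%N -> EX P (Zmass t X n) = 1.
Proof.
move=> b0; rewrite EXZ; last by apply: nice_sum => u; exact: nice_gwt.
rewrite EX_sum; last by move=> u; exact: nice_gwt.
under eq_bigr do rewrite EX_gwt.
rewrite big_const_seq count_predT size_words iter_addr_0 natrX mulVf//.
by rewrite expf_neq0// pnatr_eq0 -lt0n.
Qed.

End gauss_family.

(** * Power sums of the weights and increments between generations *)

Section increments.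
Context {d : measure_display} {T : measurableType d} {R : realType} {b : nat}.
Implicit Types (X : seq 'I_b -> T -> R) (u v w : seq 'I_b) (t q : R) (n : nat).

Definition Sq t q X n x : R := \sum_(u <- words b n) gwt t X u x `^ q.
Definition Bq t q X n x : R := Sq t q X n x `^ q^-1.
Definition hstep t (y : R) : R := expR (t * y - t ^+ 2 / 2) - 1.
(* For [c = word_coef F], with [F] a primitive of [f], this is
   [\int f d(mu_(n+1) - mu_n)]. *)
Definition incr t X (c : seq 'I_b -> R) n x : R :=
  \sum_(v <- words b n.+1) gwt t X (take n v) x * c v * hstep t (X v x).

Lemma incrE t X c n x : incr t X c n x =
  \sum_(v <- words b n.+1) gwt t X v x * c v -
  \sum_(u <- words b n) gwt t X u x * \sum_(a < b) c (rcons u a).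
Proof.
rewrite /incr !sum_words_rcons -sumrB; apply: eq_big_seq => u.
rewrite mem_words => /eqP un.
rewrite mulr_sumr -sumrB; apply: eq_bigr => a _.
rewrite -cats1 -un take_size_cat// cats1 gwt_rcons /hstep.
by ring.
Qed.

(** Comes from [(y - 1) ^+ (2 * k) <= 2 ^+ (2 * k) * (y ^+ (2 * k) + 1)] for [y >= 0] and the
    exponential moment of a Gaussian. *)
Definition step_moment t (k : nat) : R :=
  2 ^+ (2 * k) * (expR (((2 * k)%:R ^+ 2 - (2 * k)%:R) * t ^+ 2 / 2) + 1).

(** The expectation of the [q]-th power of a single weight. *)
Definition mgq t q : R := expR ((q ^+ 2 - q) * t ^+ 2 / 2).

Lemma SqE t q X n x : Sq t q X n x =
  mgq t q ^+ n * \sum_(u <- words b n) gwt (q * t) X u x.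
Proof.
rewrite /Sq mulr_sumr; apply: eq_big_seq => u; rewrite mem_words => /eqP un.
by rewrite gwt_powR un.
Qed.

Lemma Sq_Zmass t q X n x : (0 < b)%N ->
  Sq t q X n x = (mgq t q * b%:R) ^+ n * Zmass (q * t) X n x.
Proof.
move=> b0; rewrite SqE /Zmass exprMn mulrA mulfK//.
by rewrite expf_neq0// pnatr_eq0 -lt0n.
Qed.

Lemma step_moment_ge0 t k : 0 <= step_moment t k.
Proof. by rewrite mulr_ge0 ?exprn_ge0 ?addr_ge0 ?expR_ge0. Qed.

Lemma adapted_Sq t q X n : adapted X (upto n) (Sq t q X n).
Proof.
apply: adapted_sum_seq => u; rewrite mem_words => /eqP un.
apply: (adapted_comp (h := fun y => y `^ q)); first exact: measurable_powR.
by apply: adapted_gwt_upto; rewrite un.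
Qed.

Lemma adapted_Bq t q X n : adapted X (upto n) (Bq t q X n).
Proof.
apply: (adapted_comp (h := fun y => y `^ q^-1)); first exact: measurable_powR.
exact: adapted_Sq.
Qed.

Hypothesis b0 : (0 < b)%N.

Lemma gwt_le_Sq t q X n x u : u \in words b n -> gwt t X u x `^ q <= Sq t q X n x.
Proof.
move=> un; rewrite /Sq (bigD1_seq u) ?words_uniq//= lerDl.
by apply: sumr_ge0 => v _; rewrite powR_ge0.
Qed.

Lemma Sq_gt0 t q X n x : 0 < Sq t q X n x.
Proof.
have un : nseq n (Ordinal b0) \in words b n by rewrite mem_words size_nseq.
by apply: lt_le_trans (gwt_le_Sq t q X x un); rewrite powR_gt0// gwt_gt0.
Qed.

Lemma Bq_gt0 t q X n x : 0 < Bq t q X n x.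
Proof. by rewrite powR_gt0// Sq_gt0. Qed.

Lemma Bq_powR t q X n x : 0 < q -> Bq t q X n x `^ q = Sq t q X n x.
Proof. by move=> q0; rewrite -powRrM mulVf ?gt_eqF// powRr1// ltW// Sq_gt0. Qed.

Lemma gwt_le_Bq t q X n x u : 0 < q -> u \in words b n ->
  gwt t X u x <= Bq t q X n x.
Proof.
move=> q0 un.
rewrite -[leLHS]powRr1 ?gwt_ge0// -(@mulfV _ q) ?gt_eqF// powRrM.
apply: ge0_ler_powR; rewrite ?nnegrE ?powR_ge0 ?invr_ge0 ?(ltW q0)//.
  by rewrite ltW// Sq_gt0.
exact: gwt_le_Sq.
Qed.

(** Each ratio is at most one, so its square is at most its [q]-th power when [q <= 2], and the
    [q]-th powers sum to one. This is the origin of the cap [q <= 2]. *)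
Lemma sum_gwt_Bq_sqr t q X n x : 0 < q <= 2 ->
  \sum_(u <- words b n) (gwt t X u x / Bq t q X n x) ^+ 2 <= 1.
Proof.
move=> /andP[q0 q2].
have B0 := Bq_gt0 t q X n x.
apply: (@le_trans _ _ (\sum_(u <- words b n) (gwt t X u x / Bq t q X n x) `^ q)).
  rewrite big_seq [leRHS]big_seq; apply: ler_sum => u un.
  have z0 : 0 < gwt t X u x / Bq t q X n x by rewrite divr_gt0// gwt_gt0.
  have z1 : gwt t X u x / Bq t q X n x <= 1.
    by rewrite ler_pdivrMr// mul1r gwt_le_Bq.
  rewrite -powR_mulrn ?(ltW z0)//; move: (_ / _) z0 z1 => z z0 z1.
  by apply: ler_wiXn2l || rewrite /powR gt_eqF// ler_expR ler_wnM2r// ln_le0.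
under eq_bigr do rewrite powRM ?gwt_ge0 ?invr_ge0 ?(ltW B0)//.
rewrite -mulr_suml -/(Sq t q X n x) -[X in X * _](Bq_powR _ _ _ _ q0).
rewrite -powRM ?invr_ge0 ?(ltW B0)// mulfV ?gt_eqF// powR1.
exact: lexx.
Qed.

Variable P : probability T R.
Variable X : seq 'I_b -> T -> R.
Hypothesis gX : gauss_family P X.

Let mX u : measurable_fun setT (X u). Proof. by case: gX. Qed.
Let iX : indep_family P nonnil X. Proof. by case: gX. Qed.

Lemma nice_hstep t v : nonnil v -> nice P (fun x => hstep t (X v x)).
Proof. by move=> nv; apply: niceB; [exact: (nice_step gX)|exact: nice_cst]. Qed.

Lemma EX_hstep t v : nonnil v -> EX P (fun x => hstep t (X v x)) = 0.
Proof.
move=> nv; rewrite EXB; [|exact: (nice_step gX)|exact: nice_cst].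
by rewrite (EX_step gX)// EX_cst subrr.
Qed.

Lemma EX_hstep_moment t v k : nonnil v ->
  EX P (fun x => hstep t (X v x) ^+ (2 * k)) <= step_moment t k.
Proof.
move=> nv; have gv : gaussian P (X v) by case: gX => _ _; apply.
pose f x := 2 ^+ (2 * k) * (expR (- ((2 * k)%:R * (t ^+ 2 / 2))) * expR (((2 * k)%:R * t) * X v x) + 1).
have nf1 : nice P (fun x => expR (- ((2 * k)%:R * (t ^+ 2 / 2))) * expR (((2 * k)%:R * t) * X v x)).
  by apply: niceZ; exact: nice_expR_gaussian.
have nf : nice P f by apply: niceZ; apply: niceD => //; exact: nice_cst.
apply: (@le_trans _ _ (EX P f)).
  apply: EX_le => //; first by apply: niceX; exact: nice_hstep.
  move=> x; rewrite /f /hstep.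
  set y := expR (t * X v x - t ^+ 2 / 2).
  have y0 : 0 <= y by exact: expR_ge0.
  have -> : expR (- ((2 * k)%:R * (t ^+ 2 / 2))) * expR ((2 * k)%:R * t * X v x) = y ^+ (2 * k).
    by rewrite -expRD -expRM_natl; congr expR; ring.
  have -> : (y - 1) ^+ (2 * k) = `|y - 1| ^+ (2 * k).
    by rewrite !exprM -[in RHS]normrX [`|_ ^+ 2|]ger0_norm// sqr_ge0.
  have [y1|y1] := leP y 1.
    apply: (@le_trans _ _ 1).
      rewrite exprn_ile1// ler0_norm ?subr_le0//; lra.
    rewrite -[leLHS]mul1r ler_pM// ?exprn_ege1 ?ler1n// lerDr exprn_ge0//.
  rewrite ger0_norm ?subr_ge0 ?(ltW y1)//.
  apply: (@le_trans _ _ (y ^+ (2 * k))).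
    by rewrite lerXn2r// ?nnegrE ?subr_ge0 ?(ltW y1)// gerDl lerN10.
  rewrite -[leLHS]mul1r ler_pM// ?exprn_ge0 ?exprn_ege1 ?ler1n// lerDl//.
rewrite EXZ; last by apply: niceD => //; exact: nice_cst.
rewrite EXD//; last exact: nice_cst.
rewrite EXZ; last exact: nice_expR_gaussian.
rewrite EX_expR_gaussian// EX_cst /step_moment ler_wpM2l ?exprn_ge0// lerD2r.
rewrite -expRD ler_expR le_eqVlt; apply/orP; left; apply/eqP.
by field.
Qed.

Lemma nice_Sq t q n : nice P (Sq t q X n).
Proof.
rewrite (_ : Sq t q X n = fun x => mgq t q ^+ n * \sum_(u <- words b n) gwt (q * t) X u x).
  by apply: niceZ; apply: nice_sum => u; exact: nice_gwt.
by apply/funext => x; rewrite SqE.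
Qed.

Lemma EX_Sq t q n : EX P (Sq t q X n) = (mgq t q * b%:R) ^+ n.
Proof.
rewrite (_ : Sq t q X n = fun x => (mgq t q * b%:R) ^+ n * Zmass (q * t) X n x).
  by rewrite EXZ ?EX_Zmass ?mulr1//; exact: nice_Zmass.
by apply/funext => x; rewrite Sq_Zmass.
Qed.

Lemma measurable_Bq t q n : measurable_fun setT (Bq t q X n).
Proof. by apply: (adapted_measurable (Q := upto n) mX); exact: adapted_Bq. Qed.

Lemma le_1D_powR (z q : R) : 0 <= z -> 1 <= q -> z <= 1 + z `^ q.
Proof.
move=> z0 q1; have [z1|z1] := leP z 1.
  by apply: (le_trans z1); rewrite lerDl powR_ge0.
apply: (@le_trans _ _ (z `^ q)); last by rewrite lerDr.
by rewrite -[leLHS]powRr1//; apply: ler_powR => //; exact: ltW.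
Qed.

Lemma nice_Bq t q n : 1 <= q -> nice P (Bq t q X n).
Proof.
move=> q1; apply: (nice_le (g := fun x => 1 + Sq t q X n x)).
- exact: measurable_Bq.
- by apply: niceD; [exact: nice_cst|exact: nice_Sq].
- move=> x; have q0 : 0 < q by exact: lt_le_trans q1.
  rewrite ger0_norm ?(ltW (Bq_gt0 _ _ _ _ _))// ger0_norm; last first.
    by rewrite addr_ge0// ltW// Sq_gt0.
  by rewrite -(Bq_powR _ _ _ _ q0) le_1D_powR// ltW// Bq_gt0.
Qed.

(** In place of Jensen's inequality: after scaling by the [q]-th root of the expectation of [Sq],
    the bound [z <= 1 + z ^ q] costs only a factor 2. *)
Lemma EX_Bq t q n : 1 <= q -> EX P (Bq t q X n) <= 2 * ((mgq t q * b%:R) `^ q^-1) ^+ n.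
Proof.
move=> q1; have q0 : 0 < q by exact: lt_le_trans q1.
set r := _ `^ _.
have mb0 : 0 < mgq t q * b%:R by rewrite mulr_gt0 ?expR_gt0// ltr0n.
have r0 : 0 < r by rewrite powR_gt0.
have rq : r `^ q = mgq t q * b%:R by rewrite -powRrM mulVf ?gt_eqF// powRr1// ltW.
have rn0 : 0 < r ^+ n by rewrite exprn_gt0.
have rnq : (r ^+ n) `^ q = (mgq t q * b%:R) ^+ n.
  by rewrite -powR_mulrn ?ltW// -powRrM mulrC powRrM rq powR_mulrn// ltW.
have mbn0 : 0 < (mgq t q * b%:R) ^+ n by rewrite exprn_gt0.
have nS := nice_Sq t q n.
apply: (@le_trans _ _ (EX P (fun x => r ^+ n * (1 + ((mgq t q * b%:R) ^+ n)^-1 * Sq t q X n x)))).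
  apply: EX_le; first exact: nice_Bq.
    by apply: niceZ; apply: niceD; [exact: nice_cst|exact: niceZ].
  move=> x; rewrite -ler_pdivrMl//.
  have z0 : 0 <= (r ^+ n)^-1 * Bq t q X n x.
    by rewrite mulr_ge0// ?invr_ge0 ltW// Bq_gt0.
  apply: (le_trans (le_1D_powR z0 q1)); rewrite lerD2l.
  rewrite powRM ?invr_ge0 ?(ltW rn0) ?(ltW (Bq_gt0 _ _ _ _ _))//.
  by rewrite Bq_powR// -(powR_inv1 (ltW rn0)) powRAC rnq powR_inv1// ltW.
rewrite EXZ; last by apply: niceD; [exact: nice_cst|exact: niceZ].
rewrite EXD; [|exact: nice_cst|exact: niceZ].
rewrite EX_cst EXZ// EX_Sq mulVf ?gt_eqF//.
by rewrite mulrC.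
Qed.

(** After division by [Bq] the squares of the coefficients sum to at most [b * kap ^+ 2] on every
    path, a word having [b] children. The moments are then bounded by constants, however large the
    weights are. The factor [G] allows one power of [Bq] to be put back. *)
Lemma normalized_moment t q (c : seq 'I_b -> R) (kap : R) n m (G : T -> R) :
  0 < q <= 2 ->
  {in words b n.+1, forall v, `|c v| <= kap} ->
  (forall x, 0 <= G x) -> nice P G -> adapted X (upto n) G ->
  EX P (fun x => G x * (incr t X c n x / Bq t q X n x) ^+ (2 * m)) <=
  momc (step_moment t) m * (b%:R * kap ^+ 2) ^+ m * EX P G.
Proof.
move=> q02 ck G0 nG aG.
have q0 : 0 < q by case/andP: q02.
(* Coefficients are set to zero outside generation [n.+1], since adaptedness and integrability are
   required at every index. *)
pose al v : T -> R := if size v == n.+1 then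
  (fun x => gwt t X (take n v) x / Bq t q X n x * c v) else fun=> 0.
have aal v : adapted X (upto n) (al v).
  rewrite /al; case: ifPn => [/eqP vn|_]; last exact: adapted_cst.
  apply: adaptedM; last exact: adapted_cst.
  apply: adaptedM.
    by apply: adapted_gwt_upto; rewrite size_takel// vn.
  rewrite (_ : (fun x => _) = fun x => Bq t q X n x `^ (-1)); last first.
    by apply/funext => x; rewrite powR_inv1// ltW// Bq_gt0.
  apply: (adapted_comp (h := fun y => y `^ (-1))); first exact: measurable_powR.
  exact: adapted_Bq.
have nal v : nice P (al v).
  apply: (nice_le (g := fun=> c v)); [|exact: nice_cst|].
    exact: (adapted_measurable mX (aal v)).
  move=> x; rewrite /al; case: eqP => [vn|_]; last by rewrite normr0.
  rewrite normrM ler_piMl// ger0_norm; last first.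
    by rewrite divr_ge0 ?gwt_ge0// ltW// Bq_gt0.
  rewrite ler_pdivrMr ?Bq_gt0// mul1r gwt_le_Bq//.
  by rewrite mem_words size_takel// vn.
have -> : (fun x => G x * (incr t X c n x / Bq t q X n x) ^+ (2 * m)) =
    (fun x => G x * (\sum_(v <- words b n.+1) al v x * hstep t (X v x)) ^+ (2 * m)).
  apply/funext => x; congr (_ * _ ^+ _); rewrite /incr mulr_suml.
  apply: eq_big_seq => v; rewrite mem_words /al => ->.
  by ring.
have mh : measurable_fun setT (hstep t).
  apply: measurable_funB => //; apply: measurableT_comp => //.
  by apply: measurable_funB => //; exact: measurable_funM.
have wD : {in words b n.+1, forall v, nonnil v /\ ~ upto n v}.
  move=> v; rewrite mem_words => /eqP vn; split.
    by rewrite /nonnil /= -size_eq0 vn.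
  by move=> [_]; rewrite vn ltnn.
apply: (le_trans (conditional_moment_bound (D := nonnil) (Q := upto n) (h := hstep t)
  (M := step_moment t) iX mX mh (@nice_hstep t) (@EX_hstep t)
  (fun v k nv => @EX_hstep_moment t v k nv) (@upto_nonnil b n) m
  (words_uniq _ _) wD G0 nG aG nal aal)).
rewrite -mulrA ler_wpM2l ?momc_ge0//; first by move=> k; exact: step_moment_ge0.
rewrite -EXZ//; apply: EX_le.
- by apply: niceM => //; apply: niceX; apply: nice_sum => v; exact: niceX.
- exact: niceZ.
move=> x; rewrite mulrC ler_wpM2r// lerXn2r ?nnegrE//.
- by apply: sumr_ge0 => v _; exact: sqr_ge0.
- by rewrite mulr_ge0// sqr_ge0.
rewrite sum_words_rcons.
apply: (@le_trans _ _ (\sum_(u <- words b n) \sum_(a < b)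
    (gwt t X u x / Bq t q X n x) ^+ 2 * kap ^+ 2)).
  rewrite big_seq [leRHS]big_seq; apply: ler_sum => u un; apply: ler_sum => a _.
  have ua : rcons u a \in words b n.+1.
    by move: un; rewrite !mem_words size_rcons.
  move: (ua); rewrite mem_words /al => ->.
  rewrite exprMn; move: un; rewrite mem_words => /eqP un.
  rewrite -cats1 -un take_size_cat// cats1 ler_wpM2l ?sqr_ge0//.
  rewrite -[leLHS]real_normK ?num_real// lerXn2r// ?nnegrE//; last exact: ck.
  exact: le_trans (normr_ge0 _) (ck _ ua).
under eq_bigr do rewrite sumr_const card_ord -mulr_natl mulrA.
rewrite -mulr_suml ler_wpM2r ?sqr_ge0//.
rewrite -mulr_sumr -[leRHS]mulr1 ler_wpM2l//.
exact: sum_gwt_Bq_sqr.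
Qed.

Lemma nice_incr t c n : nice P (incr t X c n).
Proof.
rewrite (_ : incr t X c n = fun x => \sum_(v <- words b n.+1) gwt t X v x * c v -
  \sum_(u <- words b n) gwt t X u x * \sum_(a < b) c (rcons u a)).
  apply: niceB; apply: nice_sum => u; apply: niceM;
    by [exact: nice_gwt|exact: nice_cst].
by apply/funext => x; rewrite incrE.
Qed.

(** [Bq] is at least the weight of one fixed word, whose inverse is a constant times a weight of
    parameter [- t]. *)
Lemma nice_Bq_inv t q n : 0 < q -> nice P (fun x => (Bq t q X n x)^-1).
Proof.
move=> q0; pose u0 := nseq n (Ordinal b0).
have un : u0 \in words b n by rewrite mem_words size_nseq.
apply: (nice_le (g := fun x => expR (((-1) ^+ 2 - -1) * t ^+ 2 / 2) ^+ size u0 * gwt (-1 * t) X u0 x)).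
- rewrite (_ : (fun x => _) = fun x => Bq t q X n x `^ (-1)); last first.
    by apply/funext => x; rewrite powR_inv1// ltW// Bq_gt0.
  apply: (measurableT_comp (measurable_powR (-1))) => //.
  exact: measurable_Bq.
- by apply: niceZ; exact: nice_gwt.
move=> x; rewrite -gwt_powR powR_inv1 ?gwt_ge0//.
rewrite !ger0_norm ?invr_ge0 ?gwt_ge0 ?(ltW (Bq_gt0 _ _ _ _ _))//.
by rewrite lef_pV2 ?posrE ?gwt_gt0 ?Bq_gt0// gwt_le_Bq.
Qed.

Lemma nice_incr_Bq t q c n : 0 < q -> nice P (fun x => incr t X c n x / Bq t q X n x).
Proof. by move=> q0; apply: niceM; [exact: nice_incr|exact: nice_Bq_inv]. Qed.

Lemma Zmass_incr t n x :
  Zmass t X n.+1 x - Zmass t X n x = incr t X (fun=> b%:R ^- n.+1) n x.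
Proof.
have bR0 : b%:R != 0 :> R by rewrite pnatr_eq0 -lt0n.
have E : \sum_(a < b) b%:R ^- n.+1 = b%:R ^- n :> R.
  by rewrite sumr_const card_ord -[LHS]mulr_natl exprS invfM mulrA mulfV// mul1r.
by rewrite incrE /Zmass E -!mulr_suml; congr (_ - _); rewrite mulrC.
Qed.

(** The increment is [Bq] times a normalised variable of typical size [b ^ (- n)], so the rate is
    that of [Bq] divided by [b]. Only moments of order [q] of the weights matter, hence second
    moments of the masses may be unbounded in [n]. *)
Lemma EX_Zmass_incr t q n : 1 <= q <= 2 ->
  EX P (fun x => `|Zmass t X n.+1 x - Zmass t X n x|) <=
  (momc (step_moment t) 1 + 1) * ((mgq t q * b%:R) `^ q^-1 / b%:R) ^+ n.
Proof.
move=> /andP[q1 q2]; have q0 : 0 < q by exact: lt_le_trans q1.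
have bR : 1 <= b%:R :> R by rewrite ler1n.
have bR0 : 0 < b%:R :> R by exact: lt_le_trans bR.
pose kap : R := b%:R ^- n.+1.
have kap0 : 0 < kap by rewrite invr_gt0 exprn_gt0.
have bn0 : 0 < b%:R ^+ n :> R by rewrite exprn_gt0.
have nB := nice_Bq t n q1.
have B0 x := Bq_gt0 t q X n x.
have nD := nice_incr t (fun=> kap) n.
(* With [y] the absolute normalised increment, [y <= (b ^ n * y ^ 2 + b ^ (- n)) / 2]; multiplied by
   [Bq], this leaves a second moment weighted by [Bq], which is [normalized_moment] with
   [G = Bq]. *)
pose F x := Bq t q X n x * (incr t X (fun=> kap) n x / Bq t q X n x) ^+ (2 * 1).
have nF : nice P F by apply: niceM => //; apply: niceX; exact: nice_incr_Bq.
have q02 : 0 < q <= 2 by rewrite q0.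
set A := momc _ _.
have A0 : 0 <= A by apply: momc_ge0 => k; exact: step_moment_ge0.
have HF : EX P F <= A * (b%:R * kap ^+ 2) * EX P (Bq t q X n).
  have ck : {in words b n.+1, forall v, `|kap| <= kap} by move=> v _; rewrite gtr0_norm.
  have := @normalized_moment t q (fun=> kap) kap n 1 _ q02 ck (fun x => ltW (B0 x)) nB
    (@adapted_Bq t q X n).
  by rewrite expr1.
have HB := EX_Bq t n q1.
set r := _ `^ _ in HB *.
apply: (@le_trans _ _ (EX P (fun x => 2^-1 * (b%:R ^+ n * F x + b%:R ^- n * Bq t q X n x)))).
  apply: EX_le.
  - by apply: nice_norm; apply: niceB; exact: nice_Zmass.
  - by apply: niceZ; apply: niceD; exact: niceZ.
  move=> x; rewrite Zmass_incr -/kap /F muln1.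
  set D := incr _ _ _ _ _; set B := Bq _ _ _ _ _.
  have Bx : 0 < B by exact: B0.
  have -> : D = B * (D / B) by rewrite mulrCA mulfV ?mulr1// gt_eqF.
  rewrite [B * (D / B) / B]mulrAC mulfV ?gt_eqF// mul1r normrM gtr0_norm//.
  rewrite -[(D / B) ^+ 2]real_normK ?num_real//.
  move: (`|D / B|) => y; move: (b%:R ^+ n) bn0 => e e0.
  rewrite mulrCA [e^-1 * B]mulrC -mulrDr mulrCA ler_pM2l// ler_pdivlMl//.
  have -> : e * y ^+ 2 + e^-1 = e^-1 * ((e * y) ^+ 2 + 1).
    by field; rewrite gt_eqF.
  rewrite ler_pdivlMl//.
  have := sqr_ge0 (e * y - 1); rewrite sqrrB expr1n mulr1; lra.
rewrite EXZ; last by apply: niceD; exact: niceZ.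
rewrite EXD; [|exact: niceZ|exact: niceZ].
rewrite !EXZ//.
have r0 : 0 <= r ^+ n by rewrite exprn_ge0// powR_ge0.
have EB0 : 0 <= EX P (Bq t q X n) by apply: EX_ge0 => x; exact: ltW.
apply: (@le_trans _ _ (2^-1 * ((A + 1) * b%:R ^- n * EX P (Bq t q X n)))).
  rewrite ler_wpM2l ?invr_ge0// mulrDl mulrDl mul1r lerD2r.
  apply: (le_trans (ler_wpM2l (ltW bn0) HF)).
  rewrite [leLHS]mulrA ler_wpM2r// mulrCA ler_wpM2l//.
  have -> : b%:R ^+ n * (b%:R * kap ^+ 2) = kap.
    rewrite mulrA -exprSr /kap expr2 mulrA mulfV ?mul1r//.
    by rewrite gt_eqF// exprn_gt0.
  by rewrite /kap lef_pV2 ?posrE ?exprn_gt0// ler_weXn2l.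
rewrite exprMn exprVn ler_pdivrMl//.
apply: (le_trans (ler_wpM2l _ HB)).
  by rewrite mulr_ge0 ?addr_ge0// invr_ge0 ltW.
rewrite le_eqVlt; apply/orP; left; apply/eqP; ring.
Qed.

End increments.

(** * Probability of a small mass *)

Section pr.
Context {d : measure_display} {T : measurableType d} {R : realType}.
Variable P : probability T R.
Implicit Types (A B : set T) (f : T -> R).

Definition pr A : R := fine (P A).

Lemma EFin_pr A : measurable A -> (pr A)%:E = P A.
Proof. by move=> mA; rewrite /pr fineK// fin_num_measure. Qed.

Lemma pr_ge0 A : 0 <= pr A. Proof. exact: fine_ge0. Qed.

Lemma pr_le A B : measurable A -> measurable B -> A `<=` B -> pr A <= pr B.
Proof.
by move=> mA mB AB; rewrite -lee_fin !EFin_pr// le_measure ?inE.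
Qed.

Lemma pr_setU A B : measurable A -> measurable B -> pr (A `|` B) <= pr A + pr B.
Proof.
move=> mA mB; rewrite -lee_fin EFinD !EFin_pr//; last exact: measurableU.
exact: measureU2.
Qed.

Lemma pr_setC A : measurable A -> pr (~` A) = 1 - pr A.
Proof.
move=> mA; apply: EFin_inj; rewrite EFinB !EFin_pr//; last exact: measurableC.
exact: probability_setC.
Qed.

Lemma nice_indic A : measurable A -> nice P \1_A.
Proof.
move=> mA; apply: (nice_le (g := fun=> 1)); [exact: measurable_indic|exact: nice_cst|].
by move=> x; rewrite normr1 indicE; case: (_ \in _); rewrite ?normr1 ?normr0.
Qed.

Lemma EX_indic A : measurable A -> EX P \1_A = pr A.
Proof.
move=> mA; apply: EFin_inj; rewrite EFin_EX; last exact: nice_indic.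
by rewrite EFin_pr// integral_indic// setIT.
Qed.

Lemma measurable_lt f (r : R) : measurable_fun setT f -> measurable [set x | f x < r].
Proof.
move=> mf; rewrite -[X in measurable X]setTI.
have := mf measurableT `]-oo, r[%classic (measurable_itv _).
by congr (measurable _); apply/seteqP; split => x /=; rewrite in_itv.
Qed.

Lemma measurable_le f (r : R) : measurable_fun setT f -> measurable [set x | f x <= r].
Proof.
move=> mf; rewrite -[X in measurable X]setTI.
have := mf measurableT `]-oo, r]%classic (measurable_itv _).
by congr (measurable _); apply/seteqP; split => x /=; rewrite in_itv.
Qed.

Lemma measurable_gt f (r : R) : measurable_fun setT f -> measurable [set x | r < f x].
Proof.
move=> mf; rewrite (_ : [set _ | _] = ~` [set x | f x <= r]).
  exact/measurableC/measurable_le.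
by apply/seteqP; split => x /=; rewrite ltNge => /negP.
Qed.

Lemma pr_markov f (r : R) : 0 < r -> (forall x, 0 <= f x) -> nice P f ->
  pr [set x | r < f x] <= r^-1 * EX P f.
Proof.
move=> r0 f0 nf; have mA := measurable_gt r (nice_measurable nf).
rewrite -EX_indic// -EXZ//; apply: EX_le; [exact: nice_indic|exact: niceZ|].
move=> x; rewrite indicE; case: (boolP (x \in _)) => [|_].
  by rewrite inE /= => rf; rewrite ler_pdivlMl// mulr1 ltW.
by rewrite mulr_ge0// invr_ge0 ltW.
Qed.

End pr.

Section sqr_sum.
Variable R : realFieldType.

Lemma sqr_sum_le (I : Type) (s : seq I) (x : I -> R) :
  (\sum_(i <- s) x i) ^+ 2 <= (size s)%:R * \sum_(i <- s) x i ^+ 2.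
Proof.
rewrite expr2 big_distrlr /=.
apply: (@le_trans _ _ (\sum_(i <- s) \sum_(j <- s) 2^-1 * (x i ^+ 2 + x j ^+ 2))).
  apply: ler_sum => i _; apply: ler_sum => j _.
  by have := sqr_ge0 (x i - x j); rewrite sqrrB; lra.
set S := \sum_(i <- s) x i ^+ 2.
have cst (r : R) : \sum_(i <- s) r = (size s)%:R * r.
  by rewrite big_const_seq count_predT iter_addr_0 mulr_natl.
rewrite (eq_bigr (fun i => 2^-1 * ((size s)%:R * x i ^+ 2 + S))); last first.
  by move=> i _; rewrite -mulr_sumr big_split/= cst.
rewrite -mulr_sumr big_split/= cst -mulr_sumr -/S; lra.
Qed.

End sqr_sum.

Section geometric.
Variable R : realType.

Lemma exprn_lt (r e : R) : 0 <= r < 1 -> 0 < e -> exists n, r ^+ n < e.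
Proof.
move=> /andP[r0 r1] e0.
have rn : `|r| < 1 by rewrite ger0_norm.
have := cvg_expr rn => /cvgrPdist_lt/(_ e e0)[N _ /(_ N)] /=.
rewrite leqnn sub0r normrN ger0_norm ?exprn_ge0// => /(_ isT) H.
by exists N.
Qed.

End geometric.

Section shifted_past.
Context {d : measure_display} {T : measurableType d} {R : realType} {b : nat}.

Lemma adapted_subtree (X : seq 'I_b -> T -> R) u (Q : set (seq 'I_b)) (f : T -> R) :
  adapted (subtree u X) Q f -> adapted X [set u ++ w | w in Q] f.
Proof.
move=> af _ A mA; have := af measurableT A mA.
apply: sub_sigma_algebra2 => E [w [B [Qw mB ->]]].
by exists (u ++ w), B; split => //; exists w.
Qed.

End shifted_past.

Section small_mass.
Context {R : realType} {b : nat}.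
Hypothesis b1 : (1 < b)%N.
Variable t : R.
Hypothesis tb : t ^+ 2 < 2 * ln b%:R.

Let b0 : (0 < b)%N. Proof. exact: ltnW. Qed.
Let bR : 0 < b%:R :> R. Proof. by rewrite ltr0n. Qed.
Let lnb0 : 0 < ln b%:R :> R. Proof. by rewrite ln_gt0// ltr1n. Qed.

Let exists_q : exists q : R, 1 < q <= 2 /\ (mgq t q * b%:R) `^ q^-1 / b%:R < 1.
Proof.
(* The contraction amounts to [1 < q] and [q * t ^+ 2 < 2 * ln b]. The witness is the harmonic mean
   of [1] and [2 * ln b / t ^+ 2]; in this form it is at most 2 and makes sense for [t = 0]. *)
pose q : R := 1 + (2 * ln b%:R - t ^+ 2) / (2 * ln b%:R + t ^+ 2).
have den : 0 < 2 * ln b%:R + t ^+ 2 by rewrite ltr_wpDr ?sqr_ge0// mulr_gt0.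
have q1 : 1 < q by rewrite /q ltrDl divr_gt0// subr_gt0.
have q0 : 0 < q by exact: lt_trans q1.
exists q; split.
  rewrite q1 /= /q -lerBrDl ler_pdivrMr//.
  by have := sqr_ge0 t; lra.
rewrite ltr_pdivrMr// mul1r.
rewrite [ltRHS](_ : _ = (b%:R `^ q) `^ q^-1); last first.
  by rewrite -powRrM mulfV ?gt_eqF// powRr1// ltW.
apply: gt0_ltr_powR; rewrite ?invr_gt0 ?nnegrE ?powR_ge0 ?mulr_ge0 ?expR_ge0 ?(ltW bR)//.
have bq : b%:R `^ q = expR (q * ln b%:R) :> R by rewrite /powR gt_eqF.
have bE : b%:R = expR (ln b%:R) :> R by rewrite lnK ?posrE.
rewrite bq [X in _ * X < _]bE /mgq -expRD ltr_expR.
rewrite -subr_gt0.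
have -> : q * ln b%:R - ((q ^+ 2 - q) * t ^+ 2 / 2 + ln b%:R) =
   (q - 1) * (ln b%:R - q * t ^+ 2 / 2) by field.
rewrite mulr_gt0 ?subr_gt0// -subr_gt0.
have -> : ln b%:R - q * t ^+ 2 / 2 =
    ln b%:R * (2 * ln b%:R - t ^+ 2) / (2 * ln b%:R + t ^+ 2).
  by rewrite /q; field; rewrite gt_eqF.
by rewrite divr_gt0// mulr_gt0// subr_gt0.
Qed.

(** The bound is uniform over families, so that it applies to subtrees in the recursion, and over
    the depth, so that no limiting mass is involved. *)
Let small_prob (tau : R) : Prop := exists2 del : R, 0 < del & exists k0 : nat,
  forall (d : measure_display) (T : measurableType d) (P : probability T R)
    (X : seq 'I_b -> T -> R), gauss_family P X ->
  forall k, (k0 <= k)%N -> pr P [set x | Zmass t X k x < del] <= tau.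

(** The masses are Cauchy in mean, so [Zmass k] stays within [1/4] in mean of [Zmass n0] for a fixed
    [n0]. At that fixed generation the second moment is finite, and a Paley-Zygmund argument bounds
    from below the chance that the mass is at least [1/4]. *)
Let small_prob0 : exists2 c : R, 0 < c < 1 & small_prob (1 - c).
Proof.
have [q [q12 rho1]] := exists_q.
set rho := _ / _ in rho1.
have q12' : 1 <= q <= 2 by case/andP: q12 => q1 ->; rewrite ltW.
have rho0 : 0 <= rho by rewrite divr_ge0 ?powR_ge0// ltW.
pose C := momc (step_moment t) 1 + 1.
have C1 : 1 <= C.
  by rewrite lerDr; apply: momc_ge0 => k; exact: step_moment_ge0.
have C0 : 0 < C by exact: lt_le_trans C1.
(* Makes the tail [C * rho ^+ n0 / (1 - rho)] of the geometric series less than [1/4]. *)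
have [n0 Hn0] : exists n, rho ^+ n < (1 - rho) / (4 * C).
  apply: exprn_lt; first by rewrite rho0.
  by rewrite divr_gt0 ?subr_gt0// mulr_gt0.
pose M := mgq t 2 ^+ n0.
have M1 : 1 <= M.
  rewrite exprn_ege1// /mgq -[leLHS]expR0 ler_expR.
  have -> : 2 ^+ 2 - 2 = 2 :> R by ring.
  by rewrite divr_ge0// mulr_ge0// sqr_ge0.
have M0 : 0 < M by exact: lt_le_trans M1.
have M4 : 1 < 4 * M by rewrite (@lt_le_trans _ _ 4) ?ltr1n// ler_peMr.
exists (4 * M)^-1.
  by rewrite invr_gt0 invf_lt1 (lt_trans ltr01 M4).
exists 4^-1; first by rewrite invr_gt0.
exists n0 => d T P X gX k n0k.
have nZ j : nice P (Zmass t X j) by exact: nice_Zmass.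
have L1 j : EX P (fun x => `|Zmass t X (n0 + j) x - Zmass t X n0 x|) <=
    C * rho ^+ n0 * (1 - rho ^+ j) / (1 - rho).
  elim: j => [|j IH].
    rewrite expr0 subrr mulr0 mul0r addn0.
    rewrite (_ : (fun x => _) = fun=> 0) ?EX_cst//.
    by apply/funext => x; rewrite subrr normr0.
  apply: (@le_trans _ _ (EX P (fun x => `|Zmass t X (n0 + j).+1 x - Zmass t X (n0 + j) x| +
      `|Zmass t X (n0 + j) x - Zmass t X n0 x|))).
    apply: EX_le.
    - by apply: nice_norm; exact: niceB.
    - by apply: niceD; apply: nice_norm; exact: niceB.
    - by move=> x; rewrite addnS; apply: ler_distD.
  rewrite EXD; [|by apply: nice_norm; exact: niceB|by apply: nice_norm; exact: niceB].
  apply: (le_trans (lerD (EX_Zmass_incr b0 gX t (n0 + j) q12') IH)).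
  rewrite -/rho -/C exprD le_eqVlt; apply/orP; left; apply/eqP.
  rewrite exprS; field.
  by rewrite subr_eq0 gt_eqF.
have {}L1 : EX P (fun x => `|Zmass t X k x - Zmass t X n0 x|) <= 4^-1.
  have := L1 (k - n0)%N; rewrite subnKC// => /le_trans; apply.
  have r1 : 0 < 1 - rho by rewrite subr_gt0.
  rewrite ler_pdivrMr//.
  apply: (@le_trans _ _ (C * rho ^+ n0)).
    rewrite ler_piMr// ?mulr_ge0 ?exprn_ge0 ?(ltW C0)//.
    by rewrite gerBl exprn_ge0.
  rewrite -ler_pdivlMl//; apply: (le_trans (ltW Hn0)).
  rewrite le_eqVlt; apply/orP; left; apply/eqP; field.
  by rewrite gt_eqF.
have Z2 : EX P (fun x => Zmass t X n0 x ^+ 2) <= M.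
  pose f x := (b%:R ^+ n0)^-1 ^+ 2 * (b%:R ^+ n0 * Sq t 2 X n0 x).
  have nS := nice_Sq gX t 2 n0.
  apply: (@le_trans _ _ (EX P f)).
    apply: EX_le; [exact: niceX|by apply: niceZ; exact: niceZ|].
    move=> x; rewrite /f /Zmass exprMn ler_wpM2l ?sqr_ge0//.
    have := sqr_sum_le (words b n0) (fun u => gwt t X u x).
    rewrite size_words natrX => /le_trans; apply.
    rewrite ler_wpM2l ?exprn_ge0// le_eqVlt; apply/orP; left; apply/eqP.
    by apply: eq_bigr => u _; rewrite powR_mulrn// gwt_ge0.
  rewrite EXZ; last exact: niceZ.
  rewrite EXZ// EX_Sq// exprMn /M le_eqVlt; apply/orP; left; apply/eqP.
  by field; rewrite expf_neq0// gt_eqF.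
set A := [set x | _].
have mA : measurable A by apply: measurable_lt; exact: (measurable_Zmass gX).
have mAC : measurable (~` A) by exact: measurableC.
have nI := nice_indic P mAC.
(* On [A], the mass [z] at generation [n0] is below [1/4] plus the difference; off [A],
   [z <= z ^+ 2 / (4 * M) + M]. Taking expectations, [1] is at most three quarters plus
   [M * (1 - pr P A)]. *)
have EZ : EX P (Zmass t X n0) <= EX P (fun x => `|Zmass t X k x - Zmass t X n0 x| +
    (4^-1 + ((4 * M)^-1 * Zmass t X n0 x ^+ 2 + M * \1_(~` A) x))).
  apply: EX_le => //.
    apply: niceD; first by apply: nice_norm; exact: niceB.
    apply: niceD; first exact: nice_cst.
    by apply: niceD; [apply: niceZ; exact: niceX|exact: niceZ].
  move=> x; set z := Zmass t X n0 x; set y := Zmass t X k x.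
  have z0 : 0 <= (4 * M)^-1 * z ^+ 2 by rewrite mulr_ge0 ?sqr_ge0// invr_ge0 mulr_ge0 ?(ltW M0).
  rewrite indicE; case: (boolP (x \in _)) => [_|].
    apply: (@le_trans _ _ ((4 * M)^-1 * z ^+ 2 + M)).
      rewrite -subr_ge0.
      have -> : (4 * M)^-1 * z ^+ 2 + M - z = (4 * M)^-1 * (z - 2 * M) ^+ 2.
        by field; rewrite gt_eqF.
      by rewrite mulr_ge0 ?sqr_ge0// invr_ge0 mulr_ge0 ?(ltW M0).
    rewrite mulr1 addrA lerDr addr_ge0//.
  rewrite in_setC negbK inE /A /= -/y => yA.
  rewrite mulr0 addr0.
  have := ler_norm (z - y); rewrite distrC; lra.
move: EZ; rewrite EX_Zmass// EXD; last 2 first.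
- by apply: nice_norm; exact: niceB.
- apply: niceD; first exact: nice_cst.
  by apply: niceD; [apply: niceZ; exact: niceX|exact: niceZ].
rewrite EXD; [|exact: nice_cst|by apply: niceD; [apply: niceZ; exact: niceX|exact: niceZ]].
rewrite EXD; [|by apply: niceZ; exact: niceX|exact: niceZ].
rewrite EX_cst (EXZ _ (niceX 2 (nZ n0))).
rewrite EXZ// EX_indic// pr_setC//.
move: (pr P A) (EX _ _) (EX _ _) L1 Z2 => p e2 e1 e14 e2M.
have : (4 * M)^-1 * e2 <= 4^-1.
  by rewrite invfM -mulrA ler_piMr ?invr_ge0// ler_pdivrMl// mulr1.
move=> H H1; have : 4^-1 <= M * (1 - p) by lra.
rewrite mulrC -ler_pdivrMr// -invfM; lra.
Qed.

Let small_step (eta : R) d (T : measurableType d) (P : probability T R) X v :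
  0 < eta -> @gauss_family d T R b P X -> nonnil v ->
  pr P [set x | expR (t * X v x - t ^+ 2 / 2) < eta] <= eta * expR (t ^+ 2).
Proof.
move=> e0 gX nv.
have gv : gaussian P (X v) by case: gX => _ _; apply.
have ng := nice_expR_gaussian (- t) gv.
pose f x := expR (t ^+ 2 / 2) * expR (- t * X v x).
have nf : nice P f by exact: niceZ.
have mA := measurable_lt eta (nice_measurable (nice_step gX t nv)).
apply: (@le_trans _ _ (pr P [set x | eta^-1 < f x])).
  apply: pr_le => //; first by apply: measurable_gt; exact: (nice_measurable nf).
  move=> x /= H; rewrite /f -expRD -[ltRHS]invrK ltf_pV2 ?posrE ?invr_gt0 ?expR_gt0//.
  rewrite -expRN; apply: le_lt_trans H; rewrite ler_expR; lra.
have ei0 : 0 < eta^-1 by rewrite invr_gt0.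
have f0 x : 0 <= f x by rewrite mulr_ge0 ?expR_ge0.
apply: (le_trans (pr_markov ei0 f0 nf)).
rewrite invrK ler_pM2l// EXZ// EX_expR_gaussian// sqrrN -expRD ler_expR.
lra.
Qed.

Let small_prob_sqr (tau e : R) : 0 <= tau -> 0 < e -> small_prob tau -> small_prob (tau ^+ 2 + e).
Proof.
move=> tau0 e0 [del del0 [k0 H]].
(* By [small_step], each of the two first-level weights is below [eta] with probability at most
   [e / 2]. *)
pose eta := e / (2 * expR (t ^+ 2)).
have eta0 : 0 < eta by rewrite divr_gt0// mulr_gt0// expR_gt0.
(* The total mass is at least [1 / b] times the weight of any one letter times the mass of its
   subtree. *)
exists (del * eta / b%:R); first by rewrite divr_gt0// mulr_gt0.
exists k0.+1 => d T P X gX [//|k]; rewrite ltnS => k0k.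
pose l0 := Ordinal b0; pose l1 := Ordinal b1.
pose Z (a : 'I_b) := Zmass t (subtree [:: a] X) k.
pose w (a : 'I_b) x := expR (t * X [:: a] x - t ^+ 2 / 2).
have gS a := gauss_family_subtree [:: a] gX.
have mZ a : measurable_fun setT (Z a) by exact: (measurable_Zmass (gS a)).
have nn a : @nonnil b [:: a] by [].
have mw a : measurable_fun setT (w a).
  exact: (nice_measurable (nice_step gX t (nn a))).
have mX : measurable_fun setT (Zmass t X k.+1) by exact: (measurable_Zmass gX).
have Zle a x : Zmass t X k.+1 x >= w a x * Z a x / b%:R.
  rewrite -add1n Zmass_cat expr1 mulrC ler_wpM2l ?invr_ge0 ?(ltW bR)//.
  rewrite sum_words_cons (bigD1 a)//= big_seq1.
  rewrite {1}/gwt /psum big_ord1 /= mulr1 -/(w a x) lerDl.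
  apply: sumr_ge0 => c _; apply: sumr_ge0 => u _.
  by rewrite mulr_ge0 ?gwt_ge0 ?Zmass_ge0.
set E := [set x | _].
pose Ew a := [set x | w a x < eta].
pose EZ a := [set x | Z a x < del].
have mEw a : measurable (Ew a) by exact: measurable_lt.
have mEZ a : measurable (EZ a) by exact: measurable_lt.
have sub : E `<=` (Ew l0 `|` Ew l1) `|` (EZ l0 `&` EZ l1).
  move=> x; rewrite /E /= => Ex.
  have alt a : Ew a x \/ EZ a x.
    rewrite /Ew /EZ /=; case: (ltP (w a x) eta) => [|wx]; first by left.
    right; rewrite ltNge; apply/negP => Zx.
    move: Ex; apply/negP; rewrite -leNgt; apply: le_trans (Zle a x).
    by rewrite ler_wpM2r ?invr_ge0 ?(ltW bR)// mulrC ler_pM// ltW.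
  case: (alt l0) => [|Z0]; first by left; left.
  case: (alt l1) => [|Z1]; first by left; right.
  by right.
have aZ a : adapted (subtree [:: a] X) (upto k) (Z a) by exact: adapted_Zmass.
have ind : P (EZ l0 `&` EZ l1) = (P (EZ l0) * P (EZ l1))%E.
  have [mXu iX _] := gX.
  apply: (indep_past (D := @nonnil b) (Q := [set [:: l0] ++ w | w in upto k])
    (Q' := [set [:: l1] ++ w | w in upto k]) iX mXu).
  - by move=> _ [v _ <-].
  - by move=> _ [v _ <-].
  - by rewrite -subset0 => u [[v _ <-] [v' _ []]].
  - have := adapted_subtree (aZ l0).
    move=> /(_ measurableT `]-oo, del[%classic (measurable_itv _)); rewrite setTI.
    by congr (<<s _ >> _); apply/seteqP; split => x /=; rewrite in_itv.
  - have := adapted_subtree (aZ l1).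
    move=> /(_ measurableT `]-oo, del[%classic (measurable_itv _)); rewrite setTI.
    by congr (<<s _ >> _); apply/seteqP; split => x /=; rewrite in_itv.
have mEZI : measurable (EZ l0 `&` EZ l1) by exact: measurableI.
have mEwU : measurable (Ew l0 `|` Ew l1) by exact: measurableU.
have pI : pr P (EZ l0 `&` EZ l1) = pr P (EZ l0) * pr P (EZ l1).
  by apply: EFin_inj; rewrite EFinM !EFin_pr.
have mE : measurable E by exact: measurable_lt.
apply: (le_trans (pr_le P mE (measurableU _ _ mEwU mEZI) sub)).
apply: (le_trans (pr_setU P mEwU mEZI)).
rewrite addrC; apply: lerD.
  rewrite pI expr2; apply: ler_pM; rewrite ?pr_ge0//; exact: (H _ _ _ _ (gS _)).
apply: (le_trans (pr_setU P (mEw l0) (mEw l1))).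
have e2 : e = eta * expR (t ^+ 2) + eta * expR (t ^+ 2).
  by rewrite /eta; field; rewrite gt_eqF// expR_gt0.
by rewrite [leRHS]e2; apply: lerD; exact: (small_step eta0 gX (nn _)).
Qed.

(* The mass is small only if those of two first-level subtrees are small or one of
   their weights is, so the probability [tau] of a small mass satisfies
   [tau_(k+1) <= tau_k ^ 2 + e]; iterating from some [tau < 1] makes it small. *)
Lemma Zmass_small (e : R) : 0 < e -> exists2 del : R, 0 < del & exists k0 : nat,
  forall (d : measure_display) (T : measurableType d) (P : probability T R)
    (X : seq 'I_b -> T -> R), gauss_family P X ->
  forall k, (k0 <= k)%N -> pr P [set x | Zmass t X k x < del] <= e.
Proof.
move=> e0; have [c /andP[c0 c1] H0] := small_prob0.
(* [r] lies strictly between [1 - c] and [1]. Since [y <= 1 - c < r], the slack [e = y * (r - y)] is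
   positive and turns [y ^+ 2 + e] into [r * y], a geometric decrease. *)
pose r := (2 - c) / 2.
have r01 : 0 <= r < 1 by rewrite /r; apply/andP; split; lra.
have [r0 r1] := andP r01.
have Hn n : small_prob ((1 - c) * r ^+ n).
  elim: n => [|n IH]; first by rewrite expr0 mulr1.
  set y := (1 - c) * r ^+ n in IH *.
  have rr : 0 < r by rewrite /r; lra.
  have y0 : 0 < y by rewrite mulr_gt0 ?exprn_gt0// subr_gt0.
  have yc : y <= 1 - c.
    by rewrite ler_piMr ?exprn_ile1 ?(ltW r1)// subr_ge0 ltW.
  have -> : (1 - c) * r ^+ n.+1 = y ^+ 2 + y * (r - y).
    by rewrite exprS mulrCA -/y; ring.
  apply: small_prob_sqr => //; first exact: ltW.
  by rewrite mulr_gt0// subr_gt0 (le_lt_trans yc)// /r; lra.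
have [n rn] := exprn_lt r01 e0.
have [del del0 [k0 H]] := Hn n; exists del => //; exists k0 => d T P X gX k k0k.
apply: (le_trans (H _ _ _ _ gX _ k0k)); apply: le_trans (ltW rn).
by rewrite ler_piMl ?exprn_ge0// gerBl ltW.
Qed.

End small_mass.

Section energy.
Context {R : realType} {b : nat}.
Hypothesis b1 : (1 < b)%N.

Let b0 : (0 < b)%N. Proof. exact: ltnW. Qed.
Let bR : 0 < b%:R :> R. Proof. by rewrite ltr0n. Qed.

Lemma expR_decay (g e : R) : 0 < g -> 0 < e ->
  exists N0 : nat, forall N, (N0 <= N)%N -> expR (- (N%:R * g)) < e.
Proof.
move=> g0 e0.
have r01 : 0 <= expR (- g) < 1 by rewrite expR_ge0 expR_lt1 oppr_lt0.
have [N0 H] := exprn_lt r01 e0; exists N0 => N NN.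
rewrite -mulrN expRM_natl; apply: le_lt_trans H.
by apply: ler_wiXn2l => //; rewrite ?expR_ge0// ltW//; case/andP: r01.
Qed.

(** If [a <= t], lowering the exponent from [th] to [th'] costs at most [t ^ (th - th')]; if
    [a > t], raising it to 2 costs at most [t ^ (th - 2)]. *)
Lemma powR_split (a t th th' : R) : 0 < a -> 0 < t -> th' <= th <= 2 ->
  a `^ th <= t `^ (th - th') * a `^ th' + t `^ (th - 2) * a ^+ 2.
Proof.
move=> a0 t0 /andP[th1 th2]; rewrite -powR_mulrn ?(ltW a0)//.
have E (r s : R) : 0 < r -> r `^ s = expR (s * ln r) by move=> r0; rewrite /powR gt_eqF.
rewrite !E// -!expRD.
have [at_|ta] := leP (ln a) (ln t).
  apply: ler_wpDr; first exact: expR_ge0.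
  rewrite ler_expR; nra.
apply: ler_wpDl; first exact: expR_ge0.
rewrite ler_expR; nra.
Qed.

Context {d : measure_display} {T : measurableType d}.
Variable P : probability T R.
Variable X : seq 'I_b -> T -> R.
Hypothesis gX : gauss_family P X.

Let mX u : measurable_fun setT (X u). Proof. by case: gX. Qed.
Let iX : indep_family P nonnil X. Proof. by case: gX. Qed.

(* The weights depend on the first [N] generations only, while the masses of the
   subtrees are independent of these. *)
Lemma weighted_small_mass (sig th del e : R) (N k : nat) :
  (forall u, pr P [set x | Zmass sig (subtree u X) k x < del] <= e) ->
  EX P (fun x => \sum_(u <- words b N) gwt sig X u x `^ th / Sq sig th X N x *
     \1_(`]-oo, del[%classic) (Zmass sig (subtree u X) k x)) <= e.
Proof.
move=> He.
have gS u := gauss_family_subtree u gX.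
pose w u : T -> R := if size u == N then (fun x => gwt sig X u x `^ th / Sq sig th X N x) else fun=> 0.
pose I u x : R := \1_(`]-oo, del[%classic) (Zmass sig (subtree u X) k x).
have aw u : adapted X (upto N) (w u).
  rewrite /w; case: eqP => [uN|_]; last exact: adapted_cst.
  apply: adaptedM.
    apply: (adapted_comp (h := fun y => y `^ th)); first exact: measurable_powR.
    by apply: adapted_gwt_upto; rewrite uN.
  rewrite (_ : (fun x => _) = fun x => Sq sig th X N x `^ (-1)); last first.
    by apply/funext => x; rewrite powR_inv1// ltW// Sq_gt0.
  apply: (adapted_comp (h := fun y => y `^ (-1))); first exact: measurable_powR.
  exact: adapted_Sq.
have w0 u x : 0 <= w u x.
  by rewrite /w; case: ifP => // _; rewrite divr_ge0 ?powR_ge0// ltW// Sq_gt0.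
have nw u : nice P (w u).
  apply: (nice_le (g := fun=> 1)); [|exact: nice_cst|].
    exact: (adapted_measurable mX (aw u)).
  move=> x; rewrite normr1 ger0_norm// /w; case: eqP => // uN.
  rewrite ler_pdivrMr ?Sq_gt0// mul1r gwt_le_Sq// mem_words; exact/eqP.
have mh : measurable_fun setT (\1_(`]-oo, del[%classic) : R -> R).
  by apply: measurable_indic; exact: measurable_itv.
have aI u : adapted X [set u ++ v | v in upto k] (I u).
  apply: adapted_subtree; apply: (adapted_comp (h := \1_(`]-oo, del[%classic))) => //.
  exact: adapted_Zmass.
have IE u : I u = \1_([set x | Zmass sig (subtree u X) k x < del]).
  apply/funext => x; rewrite /I !indicE; congr ((nat_of_bool _)%:R).
have mA u : measurable [set x | Zmass sig (subtree u X) k x < del].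
  by apply: measurable_lt; exact: (measurable_Zmass (gS u)).
have nI u : nice P (I u) by rewrite IE; exact: nice_indic.
have sumE x : \sum_(u <- words b N) gwt sig X u x `^ th / Sq sig th X N x *
     \1_(`]-oo, del[%classic) (Zmass sig (subtree u X) k x) =
    \sum_(u <- words b N) w u x * I u x.
  by apply: eq_big_seq => u; rewrite mem_words /w => ->.
rewrite (_ : (fun x => _) = fun x => \sum_(u <- words b N) w u x * I u x); last first.
  by apply/funext => x; exact: sumE.
rewrite EX_sum; last by move=> u; exact: niceM.
apply: (@le_trans _ _ (\sum_(u <- words b N) EX P (w u) * e)).
  rewrite big_seq [leRHS]big_seq; apply: ler_sum => u; rewrite mem_words => /eqP uN.
  rewrite (EX_indep (D := nonnil) (Q := upto N) (Q' := [set u ++ v | v in upto k]) iX mX)//.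
  - rewrite ler_wpM2l//; first exact: EX_ge0.
    by rewrite IE EX_indic.
  - exact: upto_nonnil.
  - by move=> _ [v [v0 _] <-]; move: v0; rewrite /nonnil /=; case: (u).
  - rewrite -subset0 => v [[_ vN] [v' [v'0 _] vE]]; move: vN v'0.
    rewrite -vE size_cat uN -size_eq0 -lt0n.
    by rewrite -{2}[N]addn0 leq_add2l leqn0 => /eqP ->.
rewrite -mulr_suml -EX_sum//.
rewrite (_ : (fun x => _) = fun=> 1); first by rewrite EX_cst mul1r.
apply/funext => x.
transitivity (\sum_(u <- words b N) gwt sig X u x `^ th / Sq sig th X N x).
  by apply: eq_big_seq => u; rewrite mem_words /w => ->.
by rewrite -mulr_suml mulfV// gt_eqF// Sq_gt0.
Qed.

End energy.

(** * Lower bound for the sum of squared masses *)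

Section energy_lower.
Context {R : realType} {b : nat}.
Hypothesis b1 : (1 < b)%N.
Variables (sig th th' kap D' : R).
Hypothesis sigb : sig ^+ 2 < 2 * ln b%:R.
Hypothesis thb : (th * sig) ^+ 2 < 2 * ln b%:R.
Hypothesis th2 : th' < th <= 2.
Hypothesis kap_lt : kap < sig ^+ 2 / 2 * (th + th' - 1).
Hypothesis D'_gt :
  ln b%:R - (2 - th) * kap - sig ^+ 2 / 2 * (th ^+ 2 - th) < D' * ln b%:R.

Let b0 : (0 < b)%N. Proof. exact: ltnW. Qed.
Let bR : 0 < b%:R :> R. Proof. by rewrite ltr0n. Qed.

Let L : R := ln b%:R.
(** The weights are truncated at [expR (N * kap)]. Per generation, the truncated part is then
    smaller than [\sum a_u ^ th] by the rate [2 * eta]; half is spent on Markov's inequality for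
    [\sum a_u ^ th']. As [th'] tends to [th], the bound on [kap] tends to [sig ^+ 2 * (th - 1/2)],
    the typical growth rate of [ln a_u] under the weights [a_u ^ th]. *)
Let eta : R := (sig ^+ 2 / 2 * (th + th' - 1) - kap) * (th - th') / 2.
(** The rate by which [expR (N * kap * (2 - th))] times the expected [\sum a_u ^ th] exceeds
    [b ^ (N * (2 - D'))]. *)
Let gap : R := D' * L - (L - (2 - th) * kap - sig ^+ 2 / 2 * (th ^+ 2 - th)).

Let eta0 : 0 < eta.
Proof.
have [h1 _] := andP th2.
by rewrite /eta divr_gt0// mulr_gt0// subr_gt0.
Qed.

Let gap0 : 0 < gap. Proof. by rewrite subr_gt0. Qed.

Let mgqbE q N : (mgq sig q * b%:R) ^+ N = expR (N%:R * (sig ^+ 2 / 2 * (q ^+ 2 - q) + L)).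
Proof.
rewrite expRM_natl /mgq expRD /L lnK ?posrE//; congr ((expR _ * _) ^+ _).
by field.
Qed.

(** The deterministic part. At least half of [\sum a u ^ th] sits on words with [Z u >= del]. By
    [powR_split] the exponent [th'] accounts for at most a quarter, so another quarter is controlled
    by the squares [a u ^+ 2] over these words. *)
Let pointwise (N : nat) (C del del' : R) (I : eqType) (s : seq I) (a Z : I -> R) :
  0 < del -> 0 < del' -> 0 < C ->
  expR (- (N%:R * eta)) < del' / 4 ->
  expR (- (N%:R * gap)) < del ^+ 2 * del' / 4 / C ->
  (forall u, 0 < a u) -> (forall u, 0 <= Z u) ->
  del' * (mgq sig th * b%:R) ^+ N <= \sum_(u <- s) a u `^ th ->
  \sum_(u <- s) a u `^ th' <= (mgq sig th' * b%:R) ^+ N * expR (N%:R * eta) ->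
  \sum_(u <- s) a u `^ th / (\sum_(u <- s) a u `^ th) * \1_(`]-oo, del[%classic) (Z u) <= 2^-1 ->
  C * expR (N%:R * (2 * L - D' * L)) < \sum_(u <- s) (a u * Z u) ^+ 2.
Proof.
move=> del0 del'0 C0 HN1 HN2 a0 Z0 HS HS' Hbad.
have [h1 h2] := andP th2.
set S := \sum_(u <- s) a u `^ th in HS Hbad.
set S' := \sum_(u <- s) a u `^ th' in HS'.
have mb0 q : 0 < (mgq sig q * b%:R) ^+ N by rewrite exprn_gt0// mulr_gt0// expR_gt0.
have S0 : 0 < S by apply: lt_le_trans HS; rewrite mulr_gt0.
pose good u := del <= Z u.
pose t := expR (N%:R * kap).
have t0 : 0 < t by exact: expR_gt0.
have tpow r : t `^ r = expR (N%:R * (kap * r)) by rewrite /t -expRM mulrA.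
have Sgood : S / 2 <= \sum_(u <- s | good u) a u `^ th.
  have -> : S / 2 = S - S * 2^-1 by field.
  rewrite lerBlDr -[leLHS]/S {1}/S (bigID good) /= lerD2l.
  rewrite mulrC -ler_pdivrMr//.
  apply: le_trans Hbad; rewrite mulr_suml big_mkcond /=; apply: ler_sum => u _.
  case: (boolP (good u)) => [_|ug] /=.
    by rewrite mulr_ge0 ?divr_ge0 ?powR_ge0 ?(ltW S0).
  rewrite indicE mem_set ?mulr1//= in_itv /=.
  by move: ug; rewrite /good -ltNge.
have step1 : S / 2 <= t `^ (th - th') * S' + t `^ (th - 2) * \sum_(u <- s | good u) a u ^+ 2.
  apply: (le_trans Sgood).
  apply: (@le_trans _ _ (\sum_(u <- s | good u)
     (t `^ (th - th') * a u `^ th' + t `^ (th - 2) * a u ^+ 2))).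
    by apply: ler_sum => u _; apply: powR_split => //; rewrite ltW.
  rewrite big_split /= -!mulr_sumr lerD2r ler_wpM2l ?powR_ge0//.
  rewrite /S' [leRHS](bigID good)/= lerDl; apply: sumr_ge0 => u _.
  exact: powR_ge0.
have step2 : t `^ (th - th') * S' <= S / 4.
  apply: (@le_trans _ _ (t `^ (th - th') * ((mgq sig th' * b%:R) ^+ N * expR (N%:R * eta)))).
    by rewrite ler_wpM2l ?powR_ge0.
  have -> : t `^ (th - th') * ((mgq sig th' * b%:R) ^+ N * expR (N%:R * eta)) =
     expR (- (N%:R * eta)) * (mgq sig th * b%:R) ^+ N.
    by rewrite tpow !mgqbE -!expRD /eta; congr expR; field.
  apply: (@le_trans _ _ (del' / 4 * (mgq sig th * b%:R) ^+ N)).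
    by rewrite ler_wpM2r ?ltW.
  by rewrite mulrAC ler_wpM2r ?invr_ge0.
have step3 : S / 4 <= t `^ (th - 2) * \sum_(u <- s | good u) a u ^+ 2.
  by move: step1 step2; lra.
have step4 : del ^+ 2 * \sum_(u <- s | good u) a u ^+ 2 <= \sum_(u <- s) (a u * Z u) ^+ 2.
  rewrite [leRHS](bigID good) /=; apply: ler_wpDr.
    by apply: sumr_ge0 => u _; exact: sqr_ge0.
  rewrite mulr_sumr; apply: ler_sum => u ug.
  by rewrite exprMn mulrC ler_wpM2l ?sqr_ge0// lerXn2r ?nnegrE ?(ltW del0).
apply: lt_le_trans step4.
apply: (@lt_le_trans _ _ (del ^+ 2 * (t `^ (2 - th) * (S / 4)))); last first.
  rewrite ler_wpM2l ?sqr_ge0//.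
  apply: (le_trans (ler_wpM2l (powR_ge0 _ _) step3)).
  have tt : t `^ (2 - th) * t `^ (th - 2) = 1.
    by rewrite !tpow -expRD -[RHS]expR0; congr expR; ring.
  by rewrite mulrA tt mul1r.
apply: (@lt_le_trans _ _ (del ^+ 2 * (t `^ (2 - th) * (del' * (mgq sig th * b%:R) ^+ N / 4)))); last first.
  by rewrite ler_wpM2l ?sqr_ge0// ler_wpM2l ?powR_ge0// ler_wpM2r ?invr_ge0.
have -> : del ^+ 2 * (t `^ (2 - th) * (del' * (mgq sig th * b%:R) ^+ N / 4)) =
    (del ^+ 2 * del' / 4) * (t `^ (2 - th) * (mgq sig th * b%:R) ^+ N) by field.
rewrite tpow mgqbE -expRD.
have -> : expR (N%:R * (2 * L - D' * L)) = expR (- (N%:R * gap)) *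
    expR (N%:R * (kap * (2 - th)) + N%:R * (sig ^+ 2 / 2 * (th ^+ 2 - th) + L)).
  by rewrite -expRD /gap; congr expR; field.
rewrite mulrA ltr_pM2r ?expR_gt0//.
by rewrite mulrC -ltr_pdivlMr.
Qed.

Lemma energy_lower_bound (C e : R) : 0 < C -> 0 < e ->
  exists N0 : nat, forall N, (N0 <= N)%N -> exists k0 : nat,
  forall (d : measure_display) (T : measurableType d) (P : probability T R)
    (X : seq 'I_b -> T -> R), gauss_family P X ->
  forall k, (k0 <= k)%N ->
  pr P [set x | \sum_(u <- words b N) (gwt sig X u x * Zmass sig (subtree u X) k x) ^+ 2 <=
     C * expR (N%:R * (2 * L - D' * L))] <= e.
Proof.
move=> C0 e0.
have e4 : 0 < e / 4 by rewrite divr_gt0.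
have [del del0 [k0 Hk]] := Zmass_small b1 sigb e4.
have [del' del'0 [n0 Hn]] := Zmass_small b1 thb e4.
have [N1 HN1] := expR_decay eta0 (divr_gt0 del'0 (ltr0n R 4)).
have c0 : 0 < del ^+ 2 * del' / 4 / C by rewrite !divr_gt0 ?mulr_gt0 ?exprn_gt0.
have [N2 HN2] := expR_decay gap0 c0.
have [N3 HN3] := expR_decay eta0 e4.
exists (maxn (maxn N1 N2) (maxn N3 n0)) => N.
rewrite !geq_max => /andP[/andP[/HN1 {}HN1 /HN2 {}HN2] /andP[/HN3 {}HN3 Nn0]].
exists k0 => d T P X gX k k0k.
have gS u := gauss_family_subtree u gX.
pose bad x := \sum_(u <- words b N) gwt sig X u x `^ th / Sq sig th X N x *
     \1_(`]-oo, del[%classic) (Zmass sig (subtree u X) k x).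
have Ebad : EX P bad <= e / 4.
  by apply: weighted_small_mass => // u; exact: Hk.
have bad0 x : 0 <= bad x.
  apply: sumr_ge0 => u _; rewrite mulr_ge0 ?divr_ge0 ?powR_ge0//.
  by rewrite ltW// Sq_gt0.
have mZ u : measurable_fun setT (Zmass sig (subtree u X) k).
  exact: (measurable_Zmass (gS u)).
have mSq : measurable_fun setT (Sq sig th X N).
  by exact: (nice_measurable (nice_Sq gX sig th N)).
have mbad : measurable_fun setT bad.
  apply: measurable_sum => u; apply: measurable_funM.
    apply: measurable_funM.
      apply: (measurableT_comp (measurable_powR th)) => //.
      exact: (measurable_gwt gX).
    rewrite (_ : (fun x => _) = fun x => Sq sig th X N x `^ (-1)); last first.
      by apply/funext => x; rewrite powR_inv1// ltW// Sq_gt0.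
    exact: (measurableT_comp (measurable_powR (-1))).
  have mI : measurable_fun setT (\1_(`]-oo, del[%classic) : R -> R).
    by apply: measurable_indic; exact: measurable_itv.
  exact: (measurableT_comp mI (mZ u)).
have nbad : nice P bad.
  apply: (nice_le (g := fun=> 1)) => //; first exact: nice_cst.
  move=> x; rewrite normr1 ger0_norm//.
  rewrite -[leRHS](@mulfV _ (Sq sig th X N x)) ?gt_eqF ?Sq_gt0//.
  rewrite {2}/Sq mulr_suml; apply: ler_sum => u _.
  by rewrite ler_piMr ?divr_ge0 ?powR_ge0 ?(ltW (Sq_gt0 _ _ _ _ _ _))//.
set H := [set x | _].
(* The failure of any hypothesis of [pointwise] lies in one of three events. Markov's inequality at
   level [1/2] gives [e / 2] for [A1]; the other two have probability at most [e / 4] each. *)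
pose A1 := [set x | 2^-1 < bad x].
pose A2 := [set x | Zmass (th * sig) X N x < del'].
pose A3 := [set x | expR (N%:R * eta) < Zmass (th' * sig) X N x].
have mA1 : measurable A1 by exact: measurable_gt.
have mA2 : measurable A2 by apply: measurable_lt; exact: (measurable_Zmass gX).
have mA3 : measurable A3 by apply: measurable_gt; exact: (measurable_Zmass gX).
have mH : measurable H.
  apply: measurable_le; apply: measurable_sum => u; apply: measurable_funX.
  by apply: measurable_funM => //; exact: (measurable_gwt gX).
have sub : H `<=` A1 `|` A2 `|` A3.
  move=> x; rewrite /H /= => Hx; apply: contrapT => /not_orP[/not_orP[]].
  rewrite /A1 /A2 /A3 /= => /negP; rewrite -leNgt => n1 /negP; rewrite -leNgt => n2.
  move=> /negP; rewrite -leNgt => n3.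
  move: Hx; apply/negP; rewrite -ltNge.
  apply: (pointwise (del := del) (del' := del')) => //.
  - by move=> u; exact: gwt_gt0.
  - by move=> u; exact: Zmass_ge0.
  - rewrite -/(Sq sig th X N x) Sq_Zmass// mulrC ler_wpM2l//.
    by rewrite exprn_ge0// mulr_ge0 ?expR_ge0.
  - rewrite -/(Sq sig th' X N x) Sq_Zmass// ler_wpM2l//.
    by rewrite exprn_ge0// mulr_ge0 ?expR_ge0.
apply: (le_trans (pr_le P mH (measurableU _ _ (measurableU _ _ mA1 mA2) mA3) sub)).
apply: (le_trans (pr_setU P (measurableU _ _ mA1 mA2) mA3)).
have := pr_setU P mA1 mA2.
have : pr P A1 <= 2 * (e / 4).
  have h : 0 < 2^-1 :> R by rewrite invr_gt0.
  by apply: (le_trans (pr_markov h bad0 nbad)); rewrite invrK ler_pM2l.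
have : pr P A2 <= e / 4 by exact: (Hn _ _ _ _ gX).
have : pr P A3 <= e / 4.
  apply: (le_trans (pr_markov (expR_gt0 _) (Zmass_ge0 _ _ _) (nice_Zmass gX _ _))).
  by rewrite EX_Zmass// mulr1 -expRN ltW.
lra.
Qed.

End energy_lower.

(** * The Fejer kernel on words *)

Section trigonometry.
Variable R : realType.
Implicit Types x y a c : R.

Lemma lipschitz_of_derive (f df : R -> R) (M a c : R) :
  (forall x, is_derive x 1 f (df x)) -> (forall x, `|df x| <= M) ->
  `|f a - f c| <= M * `|a - c|.
Proof.
move=> fd dfM.
have cf : continuous f.
  by move=> x; apply/differentiable_continuous/derivable1_diffP; have [] := fd x.
wlog ca : a c / c <= a => [H|].
  have [ca|/ltW ac] := leP c a; first exact: H.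
  by rewrite distrC (distrC a); exact: H.
have fd' x : x \in `]c, a[ -> is_derive x 1 f (df x) by move=> _; exact: fd.
have [e _ ->] := MVT_segment ca fd' (continuous_subspaceT cf).
by rewrite normrM ler_wpM2r.
Qed.

Lemma sin_lipschitz a c : `|sin a - sin c| <= `|a - c|.
Proof.
rewrite -[leRHS]mul1r; apply: (@lipschitz_of_derive sin cos) => x; exact: cos_max.
Qed.

Lemma cos_lipschitz a c : `|cos a - cos c| <= `|a - c|.
Proof.
rewrite -[leRHS]mul1r; apply: (@lipschitz_of_derive cos (fun x => - sin x)) => x.
by rewrite normrN; exact: sin_max.
Qed.

Lemma cos_ge_half y : `|y| <= 2^-1 -> 2^-1 <= cos y.
Proof.
move=> y2.
have c0 : 0 < cos y.
  apply: cos_gt0_pihalf; have := pihalf_ge1 R.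
  move: y2; rewrite ler_norml => /andP[]; lra.
have s2 : sin y ^+ 2 <= 4^-1.
  have := sin_lipschitz y 0; rewrite sin0 !subr0 => h.
  rewrite -[leLHS]real_normK ?num_real// (_ : 4^-1 = 2^-1 ^+ 2); last by field.
  by rewrite lerXn2r ?nnegrE ?invr_ge0// (le_trans h).
have := cos2Dsin2 y; move: (sin y ^+ 2) s2 => s s4 cs.
rewrite leNgt; apply/negP => c2.
have : cos y ^+ 2 < 2^-1 ^+ 2 by rewrite ltrXn2r// ?nnegrE ?(ltW c0) ?invr_ge0.
rewrite (_ : 2^-1 ^+ 2 = 4^-1); last by field.
lra.
Qed.

Lemma sum_cosB (K : nat) x :
  \sum_(j < K) \sum_(k < K) cos ((j%:R - k%:R) * x) =
  (\sum_(j < K) cos (j%:R * x)) ^+ 2 + (\sum_(j < K) sin (j%:R * x)) ^+ 2.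
Proof.
rewrite !expr2 !big_distrlr /= -big_split; apply: eq_bigr => j _.
by rewrite /= -big_split; apply: eq_bigr => k _; rewrite mulrBl cosB.
Qed.

Lemma sum_trig_sqr (I : Type) (s : seq I) (p th : I -> R) (z : R) :
  (\sum_(v <- s) p v * cos (- (z * th v))) ^+ 2 +
  (\sum_(v <- s) p v * sin (- (z * th v))) ^+ 2 =
  \sum_(v <- s) \sum_(w <- s) p v * p w * cos (z * (th v - th w)).
Proof.
rewrite !expr2 !big_distrlr /= -big_split; apply: eq_bigr => v _.
rewrite /= -big_split; apply: eq_bigr => w _ /=.
by rewrite !cosN !sinN mulrBr cosB; ring.
Qed.

End trigonometry.

Section fejer.
Context {R : realType} {b : nat}.
Hypothesis b1 : (1 < b)%N.

Let b0 : (0 < b)%N. Proof. exact: ltnW. Qed.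
Let bR : 0 < b%:R :> R. Proof. by rewrite ltr0n. Qed.

(** Summed over [i] and [j], the squared transforms form a double sum of [p v * p w] against the
    nonnegative Fejer kernel. Only pairs with a common prefix of length [n + 4] are kept; there
    every cosine is at least [1/2], so the kernel is at least [(b ^ n / 2) ^ 2]. *)
Lemma fejer_words (p : seq 'I_b -> R) (n k : nat) : (forall u, 0 <= p u) ->
  (b%:R ^+ n / 2) ^+ 2 * \sum_(u <- words b (n + 4)) (\sum_(w <- words b k) p (u ++ w)) ^+ 2 <=
  \sum_(i < b ^ n) \sum_(j < b ^ n)
    ((\sum_(v <- words b (n + 4 + k)) p v * cos (- (2 * pi * (i%:R - j%:R) * word_left v))) ^+ 2 +
     (\sum_(v <- words b (n + 4 + k)) p v * sin (- (2 * pi * (i%:R - j%:R) * word_left v))) ^+ 2).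
Proof.
move=> p0.
pose th (v : seq 'I_b) : R := 2 * pi * word_left v.
pose F x : R := (\sum_(j < b ^ n) cos (j%:R * x)) ^+ 2 + (\sum_(j < b ^ n) sin (j%:R * x)) ^+ 2.
have F0 x : 0 <= F x by rewrite addr_ge0// sqr_ge0.
have -> : \sum_(i < b ^ n) \sum_(j < b ^ n)
    ((\sum_(v <- words b (n + 4 + k)) p v * cos (- (2 * pi * (i%:R - j%:R) * word_left v))) ^+ 2 +
     (\sum_(v <- words b (n + 4 + k)) p v * sin (- (2 * pi * (i%:R - j%:R) * word_left v))) ^+ 2) =
    \sum_(v <- words b (n + 4 + k)) \sum_(w <- words b (n + 4 + k)) p v * p w * F (th v - th w).
  transitivity (\sum_(i < b ^ n) \sum_(j < b ^ n)
    \sum_(v <- words b (n + 4 + k)) \sum_(w <- words b (n + 4 + k))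
      p v * p w * cos ((i%:R - j%:R) * (th v - th w))).
    apply: eq_bigr => i _; apply: eq_bigr => j _; rewrite -sum_trig_sqr.
    have E v : 2 * pi * (i%:R - j%:R) * word_left v = (i%:R - j%:R) * th v.
      by rewrite /th; ring.
    by congr (_ ^+ 2 + _ ^+ 2); apply: eq_bigr => v _; rewrite E.
  under eq_bigr do rewrite exchange_big /=.
  rewrite exchange_big /=; apply: eq_bigr => v _.
  under eq_bigr do rewrite exchange_big /=.
  rewrite exchange_big /=; apply: eq_bigr => w _.
  rewrite /F -sum_cosB mulr_sumr; apply: eq_bigr => i _.
  by rewrite mulr_sumr.
rewrite [leRHS]sum_words_cat mulr_sumr.
rewrite big_seq [leRHS]big_seq; apply: ler_sum => u un.
rewrite [(\sum_(w <- words b k) _) ^+ 2]expr2 big_distrlr /= mulr_sumr; apply: ler_sum => w _.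
rewrite sum_words_cat [leRHS](bigD1_seq u) ?words_uniq//=.
(* Pairs with different prefixes contribute nonnegatively and are dropped. *)
apply: ler_wpDr.
  apply: sumr_ge0 => u' _; apply: sumr_ge0 => w' _.
  by rewrite !mulr_ge0.
rewrite mulr_sumr big_seq [leRHS]big_seq; apply: ler_sum => w' _.
rewrite mulrC ler_wpM2l ?mulr_ge0//.
have bn0 : 0 < b%:R ^+ n :> R by rewrite exprn_gt0.
have half (j : 'I_(b ^ n)) : 2^-1 <= cos (j%:R * (th (u ++ w) - th (u ++ w'))).
  apply: cos_ge_half.
  rewrite /th -mulrBr !word_left_cat// opprD addrACA subrr add0r -mulrBl.
  move: un; rewrite mem_words => /eqP ->.
  have l1 (v : seq 'I_b) : 0 <= @word_left R b v <= 1.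
    rewrite word_left_ge0 /=; apply: le_trans (word_left_le1 b0 v).
    by rewrite lerDl invr_ge0 exprn_ge0// ltW.
  have lw : `|word_left w - word_left w'| <= (1 : R).
    have := l1 w; have := l1 w'; rewrite ler_norml.
    by move=> /andP[? ?] /andP[? ?]; apply/andP; split; lra.
  have dl0 := normr_ge0 (@word_left R b w - word_left w').
  have jb : j%:R <= b%:R ^+ n :> R by rewrite -natrX ler_nat ltnW.
  have pi4 : pi <= 4 :> R by have := pihalf_lt2 R; lra.
  (* The reason for four extra generations: the angles are at most [2 * pi / b ^ 4 <= 8 / 16], as
     [cos_ge_half] demands. *)
  have b4 : 16 <= b%:R ^+ 4 :> R.
    by rewrite -natrX ler_nat (@leq_trans (2 ^ 4))// leq_exp2r.
  have b40 : 0 < b%:R ^+ 4 :> R by exact: lt_le_trans b4.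
  move: (word_left w - word_left w') lw dl0 => dl lw dl0.
  have pi0 := pi_ge0 R.
  have c0 : 0 <= j%:R * (2 * pi) / b%:R ^+ (n + 4) :> R.
    by rewrite divr_ge0 ?mulr_ge0// exprn_ge0// ltW.
  rewrite (_ : j%:R * _ = j%:R * (2 * pi) / b%:R ^+ (n + 4) * dl); last by ring.
  rewrite normrM ger0_norm// exprD invfM.
  rewrite [leLHS](_ : _ = (j%:R / b%:R ^+ n) * (2 * pi / b%:R ^+ 4 * `|dl|)); last by ring.
  apply: (@le_trans _ _ (1 * (2^-1 * 1))); last by rewrite mul1r mulr1.
  apply: ler_pM.
  - by rewrite divr_ge0// ltW.
  - by rewrite mulr_ge0// divr_ge0 ?mulr_ge0// ltW.
  - by rewrite ler_pdivrMr// mul1r.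
  - apply: ler_pM => //; first by rewrite divr_ge0 ?mulr_ge0// ltW.
    by rewrite ler_pdivrMr//; lra.
apply: (@le_trans _ _ ((\sum_(j < b ^ n) cos (j%:R * (th (u ++ w) - th (u ++ w')))) ^+ 2)); last first.
  by rewrite /F lerDl sqr_ge0.
rewrite lerXn2r ?nnegrE ?divr_ge0 ?(ltW bn0)//.
  by apply: sumr_ge0 => j _; apply: le_trans (half j); rewrite invr_ge0.
apply: (@le_trans _ _ (\sum_(j < b ^ n) 2^-1)).
  by rewrite sumr_const card_ord -[leRHS]mulr_natl natrX.
by apply: ler_sum => j _; exact: half.
Qed.

End fejer.

(** * Integrals against the approximating measures *)

Section density_map.
Context {d d' : measure_display} {T : measurableType d} {T' : measurableType d'} {R : realType}.
Variables (mu : {sigma_finite_measure set T -> \bar R}) (nu : {measure set T' -> \bar R}).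
Variables (phi : T' -> T) (g : T -> R).
Hypothesis mphi : measurable_fun setT phi.
Hypothesis g0 : forall x, 0 <= g x.
Hypothesis mg : measurable_fun setT g.
Hypothesis nuE : forall A, measurable A -> nu (phi @^-1` A) = (\int[mu]_(x in A) (g x)%:E)%E.
Hypothesis nu_fin : (nu setT < +oo)%E.

Let nu_phi_fin : fin_num_fun (pushforward nu phi).
Proof.
move=> A mA; rewrite /pushforward ge0_fin_numE ?measure_ge0//.
apply: le_lt_trans nu_fin; apply: le_measure; rewrite ?inE//.
by rewrite -[X in measurable X]setTI; exact: mphi.
Qed.

Let nu_phi_measure : {measure set T -> \bar R}.
Proof. by refine (HB.pack_for (measure T R) (pushforward nu phi)); exact: mphi. Defined.

Let nu_phi : {finite_measure set T -> \bar R} :=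
  HB.pack (Measure.sort nu_phi_measure)
    (Measure_isFinite.Build _ _ _ nu_phi_measure nu_phi_fin).

(** Positive and negative parts are treated by [ge0_integral_density] for the image measure. In its
    application [phi] is the identity between two measurable structures on the line, that of the
    cascade and that of Lebesgue measure. *)
Lemma integral_density_map (E : set T) (f : T -> R) :
  measurable E -> measurable_fun setT f ->
  (\int[nu]_(x in phi @^-1` E) (f (phi x))%:E = \int[mu]_(x in E) (f x * g x)%:E)%E.
Proof.
move=> mE mf.
have mf' : measurable_fun setT (EFin \o f) by apply/measurable_EFinP.
have ge0 (h : T -> \bar R) : measurable_fun setT h -> (forall x, 0 <= h x)%E ->
    (\int[nu]_(x in phi @^-1` E) h (phi x) = \int[mu]_(x in E) (h x * (g x)%:E))%E.
  move=> mh h0.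
  rewrite -(@ge0_integral_density _ _ _ mu nu_phi g g0 mg nuE)//.
    by rewrite (ge0_integral_pushforward mphi)//; exact: measurable_funTS.
  exact: measurable_funTS.
rewrite integralE [RHS]integralE; congr (_ - _)%E.
  transitivity (\int[nu]_(x in phi @^-1` E) (EFin \o f)^\+%E (phi x))%E.
    by apply: eq_integral => x _; rewrite !funeposE.
  rewrite ge0//; last exact: measurable_funepos.
  apply: eq_integral => x _.
  by rewrite !funeposE muleC maxe_pMr ?lee_fin// mule0 -EFinM mulrC.
transitivity (\int[nu]_(x in phi @^-1` E) (EFin \o f)^\-%E (phi x))%E.
  by apply: eq_integral => x _; rewrite !funenegE.
rewrite ge0//; last exact: measurable_funeneg.
apply: eq_integral => x _.
by rewrite !funenegE muleC maxe_pMr ?lee_fin// mule0 -EFinN -EFinM mulrN mulrC.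
Qed.

End density_map.

Section cascade_integral.
Context {R : realType} {b : nat}.
Hypothesis b0 : (0 < b)%N.
Variables (w : seq 'I_b -> R) (w0 : forall u, 0 <= w u).
Variables (f F : R -> R).
Hypothesis Ff : forall x : R, is_derive x 1 F (f x).
Hypothesis cf : continuous f.

Let bR : 0 < b%:R :> R. Proof. by rewrite ltr0n. Qed.

Let mf : measurable_fun setT f. Proof. exact: continuous_measurable_fun. Qed.

Let intI (u : seq 'I_b) :
  (\int[lebesgue_measure]_(x in word_interval u) (f x)%:E = (word_coef F u)%:E)%E.
Proof.
rewrite /word_interval integral_itv_bndo_bndc; last first.
  by apply/measurable_EFinP; apply: measurable_funTS; exact: mf.
have cF : continuous F.
  by move=> x; apply/differentiable_continuous/derivable1_diffP; have [] := Ff x.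
rewrite (continuous_FTC2 (F := F)).
- by rewrite /word_coef EFinB.
- by rewrite ltrDl invr_gt0 exprn_gt0.
- exact: continuous_subspaceT.
- split.
  + by move=> x _; have [] := Ff x.
  + by apply: cvg_at_right_filter; exact: cF.
  + by apply: cvg_at_left_filter; exact: cF.
- by move=> x _; rewrite derive1E; have [_] := Ff x.
Qed.

Let cascade_approx_fin n : (cascade_approx w0 n setT < +oo)%E.
Proof.
rewrite /cascade_approx /cascade_density.
under eq_integral do rewrite -sumEFin.
have mI (u : seq 'I_b) : measurable (word_interval u : set (measurableTypeR R)).
  exact: measurable_itv.
rewrite ge0_integral_sum//; last 2 first.
- move=> u; apply/measurable_EFinP; apply: measurable_funM => //.
- by move=> u x _; rewrite lee_fin mulr_ge0// prodr_ge0.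
apply: lte_sum_pinfty => u _.
under eq_integral do rewrite EFinM.
rewrite ge0_integralZl//; last 2 first.
- exact/measurable_EFinP.
- by rewrite lee_fin prodr_ge0.
rewrite integral_indic// setIT lte_mul_pinfty ?lee_fin ?prodr_ge0//.
have /= -> := lebesgue_measure_itv `[word_left u : R, word_left u + b%:R ^- size u[.
by case: ifP => _; rewrite -?EFinB ltry.
Qed.

Lemma cascade_integral n :
  (\int[cascade_approx w0 n]_(t in `[0%R, 1%R]) f t)%R =
  \sum_(u <- words b n) (\prod_(j < n.+1) w (take j u)) * word_coef F u.
Proof.
have mid : measurable_fun setT (idfun : R -> measurableTypeR R) by exact: measurable_id.
pose g := cascade_density w n.
have mg : measurable_fun setT (g : measurableTypeR R -> R).
  exact: measurable_cascade_density.
have nuE (A : set (measurableTypeR R)) : measurable A ->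
   cascade_approx w0 n (idfun @^-1` A) = (\int[lebesgue_measure]_(x in A) (g x)%:E)%E by [].
have m01 : measurable (`[0%R, 1%R]%classic : set (measurableTypeR R)).
  exact: measurable_itv.
have := integral_density_map mid (cascade_density_ge0 w0 n) mg nuE
  (cascade_approx_fin n) m01 (mf : measurable_fun setT (f : measurableTypeR R -> R)).
rewrite /Rintegral => -> .
pose p (u : seq 'I_b) := \prod_(j < n.+1) w (take j u).
have mI (u : seq 'I_b) : measurable (word_interval u : set (measurableTypeR R)).
  exact: measurable_itv.
have i01 : lebesgue_measure.-integrable `[0%R, 1%R]%classic
    (EFin \o (f : measurableTypeR R -> R)).
  apply: (@continuous_compact_integrable R f).
    exact: (@segment_compact R 0 1).
  exact: continuous_subspaceT.
have fIE (u : seq 'I_b) : (fun x : measurableTypeR R => (p u * (f x * \1_(word_interval u) x))%:E) =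
    (fun x => ((p u)%:E * ((EFin \o f) \_ (word_interval u) x))%E).
  apply/funext => x; rewrite /patch indicE EFinM; congr (_ * _)%E.
  by case: (_ \in _); rewrite ?mulr1 ?mulr0.
have iP (u : seq 'I_b) : lebesgue_measure.-integrable `[0%R, 1%R]%classic
    ((EFin \o (f : measurableTypeR R -> R)) \_ (word_interval u)).
  apply: (le_integrable _ _ _ i01) => //.
    apply: measurable_funTS; apply/(measurable_restrictT (EFin \o f) (mI u)).
    by apply/measurable_EFinP; apply: measurable_funTS; exact: mf.
  by move=> x _; rewrite /patch; case: ifP => // _; rewrite abse0 abse_ge0.
have iI (u : seq 'I_b) : lebesgue_measure.-integrable `[0%R, 1%R]%classic
    (fun x : measurableTypeR R => (p u * (f x * \1_(word_interval u) x))%:E).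
  by rewrite fIE; exact: integrableZl.
have -> : (\int[lebesgue_measure]_(x in `[0%R, 1%R]) (f x * g x)%:E =
    \int[lebesgue_measure]_(x in `[0%R, 1%R])
      (\sum_(u <- words b n) (p u * (f x * \1_(word_interval u) x))%:E))%E.
  apply: eq_integral => x _; rewrite sumEFin; congr EFin.
  rewrite /g /cascade_density.
  rewrite (sum_words_tuple n (fun u : seq 'I_b => (\prod_(j < n.+1) w (take j u)) * \1_(word_interval u) x)).
  by rewrite mulr_sumr; apply: eq_bigr => u _; rewrite mulrCA.
rewrite integral_sum// -[RHS]/(fine (_%:E)); congr fine.
rewrite -sumEFin; apply: eq_bigr => u _.
rewrite fIE integralZl// -integral_mkcondr EFinM -intI.
congr (_ * _)%E; congr (integral _ _ _).
apply/seteqP; split => [x [] //|x xI]; split => //.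
move: xI; rewrite /word_interval /= !in_itv /= => /andP[x1 x2].
rewrite (le_trans (word_left_ge0 u) x1)/=.
by rewrite (le_trans (ltW x2))// word_left_le1.
Qed.

End cascade_integral.

(** * Almost sure bound for the increments *)

Section negligible.
Context {d : measure_display} {T : measurableType d} {R : realType}.
Variable P : probability T R.

(** Stated for an arbitrary [B], because events such as the existence of a bounding constant come
    without a proof of measurability. *)
Lemma negligible_small (B : set T) :
  (forall e : R, 0 < e -> exists A, [/\ measurable A, B `<=` A & pr P A <= e]) ->
  P.-negligible B.
Proof.
move=> H.
have /choice[A HA] : forall n : nat, exists A, [/\ measurable A, B `<=` A & pr P A <= n.+1%:R^-1].
  by move=> n; apply: H; rewrite invr_gt0.
have mA : measurable (\bigcap_n A n) by apply: bigcapT_measurable => n; have [] := HA n.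
exists (\bigcap_n A n); split => //; last by move=> x Bx n _; have [_ + _] := HA n; exact.
rewrite -EFin_pr//; congr EFin; apply/eqP; rewrite eq_le pr_ge0 andbT.
apply/ler_addgt0Pr => e e0; rewrite add0r.
have [n _ ne] : exists2 n : nat, True & n.+1%:R^-1 <= e.
  exists (Num.truncn e^-1) => //.
  rewrite -[leRHS]invrK lef_pV2 ?posrE ?invr_gt0//.
  by rewrite ltW// truncnS_gt.
have [mAn _ An] := HA n.
by apply: le_trans (pr_le P mA mAn _) (le_trans An ne) => x /(_ n I).
Qed.

Lemma pr_bigcup_nondecreasing (A : nat -> set T) (e : R) :
  (forall n, measurable (A n)) -> {homo A : m n / (m <= n)%N >-> m `<=` n} ->
  (forall n, pr P (A n) <= e) -> pr P (\bigcup_n A n) <= e.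
Proof.
move=> mA ndA Ae.
have mU : measurable (\bigcup_n A n) by exact: bigcupT_measurable.
rewrite -lee_fin EFin_pr//.
have ndA' : {homo A : n m / (n <= m)%N >-> (n <= m)%O}.
  by move=> n m nm; apply/subsetPset; exact: ndA.
have H := nondecreasing_cvg_mu (mu := P) mA mU ndA'.
rewrite -(cvg_lim _ H)//; apply: lime_le; first by apply/cvg_ex; eexists; exact: H.
by near=> n; rewrite /= -EFin_pr// lee_fin.
Unshelve. all: by end_near.
Qed.

Lemma ae_bounded_of_EX (S : nat -> T -> R) (C : R) :
  (forall n x, 0 <= S n x) -> (forall n x, S n x <= S n.+1 x) ->
  (forall n, nice P (S n)) -> (forall n, EX P (S n) <= C) ->
  {ae P, forall x, exists K : R, 0 < K /\ forall n, S n x <= K}.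
Proof.
move=> S0 Smono nS SC; apply: negligible_small => e e0.
have C0 : 0 <= C by apply: le_trans (SC 0%N); exact: EX_ge0.
pose K : R := (C + 1) / e.
have K0 : 0 < K by rewrite divr_gt0// ltr_wpDl.
pose A n := [set x | K < S n x].
have mA n : measurable (A n) by apply: measurable_gt; exact: (nice_measurable (nS n)).
exists (\bigcup_n A n); split; first exact: bigcupT_measurable.
  move=> x /= nx; apply: contrapT => nA; apply: nx; exists K; split => // n.
  rewrite leNgt; apply/negP => KS; apply: nA.
  by exists n.
have monoS x : {homo (fun n => S n x) : m n / (m <= n)%N >-> m <= n}.
  by apply: homo_leq => //; exact: le_trans.
apply: pr_bigcup_nondecreasing => //.
  by move=> m n mn x /=; rewrite /A /= => /lt_le_trans; apply; exact: monoS.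
move=> n; apply: (le_trans (pr_markov K0 (S0 n) (nS n))).
rewrite ler_pdivrMl// /K divfK ?gt_eqF//.
by rewrite (le_trans (SC n))// lerDl.
Qed.

Lemma geometric_sum_le (r : R) n : 0 <= r < 1 -> \sum_(i < n) r ^+ i <= (1 - r)^-1.
Proof.
move=> /andP[r0 r1]; have r1' : 0 < 1 - r by rewrite subr_gt0.
rewrite -[leRHS]mul1r ler_pdivlMr//.
have -> : (\sum_(i < n) r ^+ i) * (1 - r) = 1 - r ^+ n.
  elim: n => [|n IH]; first by rewrite big_ord0 mul0r expr0 subrr.
  by rewrite big_ord_recr /= mulrDl IH exprS; ring.
by rewrite gerBl exprn_ge0.
Qed.

Lemma telescopic_sum_le n : \sum_(i < n) ((i.+1 * i.+2)%:R : R)^-1 <= 1.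
Proof.
suff -> : \sum_(i < n) ((i.+1 * i.+2)%:R : R)^-1 = 1 - n.+1%:R^-1.
  by rewrite gerBl invr_ge0.
elim: n => [|n IH]; first by rewrite big_ord0 invr1 subrr.
rewrite big_ord_recr /= IH natrM.
have h : n.+2%:R = n.+1%:R + 1 :> R by rewrite -natr1.
have a0 : n.+1%:R != 0 :> R by rewrite pnatr_eq0.
have a1 : n.+1%:R + 1 != 0 :> R by rewrite -h pnatr_eq0.
rewrite h; move: (n.+1%:R) a0 a1 => a a0 a1; field.
by rewrite a0 a1.
Qed.

(** In place of Borel-Cantelli: the sum of all [f n j] with the summable weights
    [r ^ n / ((j + 1) * (j + 2))] has bounded expectation, hence is almost surely bounded, and it
    dominates each of its terms. *)
Lemma ae_bounded_double (f : nat -> nat -> T -> R) (C r : R) : 0 < r < 1 ->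
  (forall n j x, 0 <= f n j x) -> (forall n j, nice P (f n j)) ->
  (forall n j, EX P (f n j) <= C) ->
  {ae P, forall x, exists K : R, 0 < K /\ forall n j,
    f n j x <= K * r ^- n * (j.+1 * j.+2)%:R}.
Proof.
move=> /andP[r0 r1] f0 nf fC.
have C0 : 0 <= C by apply: le_trans (fC 0%N 0%N); exact: EX_ge0.
pose c (n j : nat) : R := r ^+ n * ((j.+1 * j.+2)%:R)^-1.
have c0 n j : 0 < c n j by rewrite mulr_gt0 ?exprn_gt0// invr_gt0 ltr0n muln_gt0.
pose S N x := \sum_(n < N) \sum_(j < N) c n j * f n j x.
have cf0 n j x : 0 <= c n j * f n j x by rewrite mulr_ge0// ltW.
have S0 N x : 0 <= S N x by do 2 (apply: sumr_ge0 => ? _).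
have Smono N x : S N x <= S N.+1 x.
  rewrite /S big_ord_recr /=; apply: ler_wpDr; first by apply: sumr_ge0.
  by apply: ler_sum => n _; rewrite big_ord_recr /= lerDl.
have nS N : nice P (S N).
  by apply: nice_sum => n; apply: nice_sum => j; exact: niceZ.
have SC N : EX P (S N) <= (1 - r)^-1 * C.
  rewrite EX_sum; last by move=> n; apply: nice_sum => j; exact: niceZ.
  apply: (@le_trans _ _ (\sum_(n < N) r ^+ n * C)).
    apply: ler_sum => n _; rewrite EX_sum; last by move=> j; exact: niceZ.
    apply: (@le_trans _ _ (\sum_(j < N) ((j.+1 * j.+2)%:R : R)^-1 * (r ^+ n * C))).
      apply: ler_sum => j _; rewrite EXZ// /c mulrAC mulrC ler_wpM2l ?invr_ge0//.
      by rewrite ler_wpM2l ?exprn_ge0 ?(ltW r0).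
    by rewrite -mulr_suml ler_piMl ?telescopic_sum_le// mulr_ge0// exprn_ge0// ltW.
  by rewrite -mulr_suml ler_wpM2r// geometric_sum_le// ltW//= r1.
apply: filterS (ae_bounded_of_EX S0 Smono nS SC) => x [K [K0 SK]].
exists K; split => // n j.
have : c n j * f n j x <= K.
  apply: le_trans (SK (maxn n j).+1).
  have nN : (n < (maxn n j).+1)%N by rewrite ltnS leq_maxl.
  have jN : (j < (maxn n j).+1)%N by rewrite ltnS leq_maxr.
  rewrite /S (bigD1 (Ordinal nN))//= (bigD1 (Ordinal jN))//= -addrA lerDl.
  by rewrite addr_ge0// sumr_ge0// => i _; apply: sumr_ge0.
rewrite mulrC -ler_pdivlMr// => /le_trans; apply.
by rewrite /c invfM invrK mulrA.
Qed.

End negligible.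

Section increment_bound.
Context {d : measure_display} {T : measurableType d} {R : realType} {b : nat}.
Hypothesis b1 : (1 < b)%N.
Variable P : probability T R.
Variable X : seq 'I_b -> T -> R.
Hypothesis gX : gauss_family P X.

Let b0 : (0 < b)%N. Proof. exact: ltnW. Qed.
Let bR : 0 < b%:R :> R. Proof. by rewrite ltr0n. Qed.

(** Controlling all frequencies at once costs a factor of order [j ^ 2] on the moment of order
    [2 * m], that is [j ^ (1 / m)] on the increment. Large [m] makes this smaller than the room
    between [gam] and [th / 2]. *)
Lemma incr_ae_bound (sig q th gam : R) (c : nat -> seq 'I_b -> R) :
  1 < q <= 2 ->
  (mgq sig q * b%:R) `^ q^-1 * b%:R `^ (th - 1) < 1 ->
  gam < th / 2 ->
  (forall n j, {in words b n.+1, forall v,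
    `|c j v| <= (b%:R `^ (th - 1)) ^+ n.+1 * j.+1%:R `^ (- (th / 2))}) ->
  {ae P, forall x, exists K rho : R, [/\ 0 < K, 0 < rho < 1 & forall n j,
    `|incr sig X (c j) n x| <= K * rho ^+ n * j.+1%:R `^ (- gam)]}.
Proof.
move=> /andP[q1 q2] rho01 gth ck.
have q0 : 0 < q by exact: lt_trans q1.
set R1 := _ `^ q^-1 in rho01; set kap := b%:R `^ (th - 1) in rho01 ck.
have mb0 : 0 < mgq sig q * b%:R by rewrite mulr_gt0// expR_gt0.
have R10 : 0 < R1 by rewrite powR_gt0.
have kap0 : 0 < kap by rewrite powR_gt0.
pose rho0 := R1 * kap.
have rho00 : 0 < rho0 by rewrite mulr_gt0.
(* Two almost sure bounds are used, each losing a factor [r ^- n]. By the arithmetic-geometric mean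
   inequality [rho0 < r ^+ 2], so the product still decays geometrically. *)
pose r : R := (1 + rho0) / 2.
have r01 : 0 < r < 1.
  by move: rho01 rho00; rewrite -/rho0 /r => ? ?; apply/andP; split; lra.
have [r0 r1] := andP r01.
have rr : rho0 / r ^+ 2 < 1.
  rewrite ltr_pdivrMr ?exprn_gt0// mul1r -subr_gt0 /r.
  have -> : ((1 + rho0) / 2) ^+ 2 - rho0 = ((1 - rho0) / 2) ^+ 2 by field.
  by rewrite exprn_gt0// divr_gt0// subr_gt0.
have [m [m0 mth]] : exists m : nat, (0 < m)%N /\ m%:R^-1 <= th / 2 - gam.
  have e0 : 0 < th / 2 - gam by rewrite subr_gt0.
  exists (Num.truncn (th / 2 - gam)^-1).+1; split => //.
  by rewrite -[leRHS]invrK lef_pV2 ?posrE ?invr_gt0// ltW// truncnS_gt.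
pose kk n j : R := kap ^+ n.+1 * j.+1%:R `^ (- (th / 2)).
have kk0 n j : 0 < kk n j by rewrite mulr_gt0 ?exprn_gt0 ?powR_gt0// ltr0n.
pose f n j x := (b%:R * kk n j ^+ 2) ^- m * (incr sig X (c j) n x / Bq sig q X n x) ^+ (2 * m).
have nD n j : nice P (fun x => (incr sig X (c j) n x / Bq sig q X n x) ^+ (2 * m)).
  by apply: niceX; exact: nice_incr_Bq.
have bk0 n j : 0 < (b%:R * kk n j ^+ 2) ^+ m by rewrite exprn_gt0// mulr_gt0// exprn_gt0.
have f0 n j x : 0 <= f n j x.
  by rewrite mulr_ge0 ?invr_ge0 ?(ltW (bk0 _ _))// exprM exprn_ge0// sqr_ge0.
have nf n j : nice P (f n j) by exact: niceZ.
have fA n j : EX P (f n j) <= momc (step_moment sig) m.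
  rewrite EXZ// ler_pdivrMl// mulrC.
  have q02 : 0 < q <= 2 by rewrite q0.
  have := @normalized_moment _ _ _ _ b0 P X gX sig q (c j) (kk n j) n m (fun=> 1) q02
    (ck n j) (fun _ => ler01) (nice_cst P 1) (@adapted_cst _ _ _ _ X (upto n) 1).
  rewrite EX_cst mulr1.
  by rewrite (_ : (fun x => _) = fun x => (incr sig X (c j) n x / Bq sig q X n x) ^+ (2 * m))//;
    apply/funext => x; rewrite mul1r.
have H1 := ae_bounded_double r01 f0 nf fA.
(* The same lemma with an idle index [j] controls the growth of [Bq], whose [q]-th power is a
   deterministic factor times [Zmass (q * sig)]. *)
have H2 : {ae P, forall x, exists K : R, 0 < K /\ forall n (j : nat),
    Zmass (q * sig) X n x <= K * r ^- n * (j.+1 * j.+2)%:R}.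
  apply: (@ae_bounded_double _ _ _ P (fun n _ => Zmass (q * sig) X n) 1 r r01).
  - by move=> n _ x; exact: Zmass_ge0.
  - by move=> n _; exact: nice_Zmass.
  - by move=> n _; rewrite EX_Zmass.
apply: filterS2 H1 H2 => x [K [K0 HK]] [K' [K'0 HK']].
pose K1 : R := 1 + 2 * K * b%:R ^+ m.
have K11 : 1 <= K1 by rewrite lerDl !mulr_ge0 ?exprn_ge0 ?(ltW K0) ?(ltW bR).
have K10 : 0 < K1 by exact: lt_le_trans K11.
pose K2 : R := 1 + 2 * K'.
have K21 : 1 <= K2 by rewrite lerDl mulr_ge0// ltW.
have K20 : 0 < K2 by exact: lt_le_trans K21.
have rn1 n : 1 <= r ^- n.
  by rewrite invf_ge1 ?exprn_gt0// exprn_ile1// ltW.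
have rn0 n : 0 < r ^- n by rewrite invr_gt0 exprn_gt0.
have Bx n : 0 < Bq sig q X n x by exact: Bq_gt0.
(* root extraction: 1 <= y implies y <= y^(2m) and y^(1/q) <= y *)
have pk1 n j : 0 < K1 * r ^- n * j.+1%:R `^ (m%:R^-1) * kk n j.
  apply: mulr_gt0 => //; apply: mulr_gt0; last by rewrite powR_gt0// ltr0n.
  exact: mulr_gt0.
have DB n j : `|incr sig X (c j) n x| <=
    K1 * r ^- n * j.+1%:R `^ (m%:R^-1) * kk n j * Bq sig q X n x.
  rewrite -ler_pdivrMr//.
  rewrite -[X in _ / X](gtr0_norm (Bx n)) -normf_div.
  have m20 : (0 < 2 * m)%N by rewrite muln_gt0.
  have jm0 : 0 < j.+1%:R `^ m%:R^-1 :> R by rewrite powR_gt0// ltr0n.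
  rewrite -(ler_pXn2r m20) ?nnegrE//; last first.
    exact: (ltW (pk1 n j)).
  have := HK n j; rewrite /f ler_pdivrMl// => h.
  have -> : `|incr sig X (c j) n x / Bq sig q X n x| ^+ (2 * m) =
      (incr sig X (c j) n x / Bq sig q X n x) ^+ (2 * m).
    by rewrite !exprM real_normK ?num_real.
  apply: (le_trans h).
  move: (kk n j) (kk0 n j) (r ^- n) (rn1 n) => k /ltW k0 s s1.
  have s0 : 0 <= s by exact: le_trans s1.
  have -> : (b%:R * k ^+ 2) ^+ m = b%:R ^+ m * k ^+ (2 * m).
    by rewrite exprMn -exprM.
  have -> (J : R) : (K1 * s * J * k) ^+ (2 * m) =
      K1 ^+ (2 * m) * s ^+ (2 * m) * J ^+ (2 * m) * k ^+ (2 * m).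
    by rewrite !exprMn.
  have -> : (j.+1%:R `^ m%:R^-1) ^+ (2 * m) = j.+1%:R ^+ 2 :> R.
    rewrite -powR_mulrn ?powR_ge0// -powRrM natrM mulrCA mulVf ?mulr1 ?pnatr_eq0 ?gtn_eqF//.
    by rewrite powR_mulrn.
  have -> : b%:R ^+ m * k ^+ (2 * m) * (K * s * (j.+1 * j.+2)%:R) =
     (K * b%:R ^+ m * (j.+1 * j.+2)%:R) * s * k ^+ (2 * m) by ring.
  rewrite ler_wpM2r ?exprn_ge0 ?k0//.
  have -> : K1 ^+ (2 * m) * s ^+ (2 * m) * j.+1%:R ^+ 2 =
     (K1 ^+ (2 * m) * j.+1%:R ^+ 2) * s ^+ (2 * m) by ring.
  apply: ler_pM.
  - by rewrite !mulr_ge0 ?exprn_ge0 ?(ltW K0) ?(ltW bR).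
  - exact: s0.
  - apply: (@le_trans _ _ (2 * K * b%:R ^+ m * j.+1%:R ^+ 2)).
      rewrite -mulrA [X in _ <= X](_ : _ = K * (b%:R ^+ m * (2 * j.+1%:R ^+ 2))); last by ring.
      rewrite ler_wpM2l ?(ltW K0)// ler_wpM2l ?exprn_ge0 ?(ltW bR)//.
      rewrite natrM expr2 mulrCA ler_wpM2l// -natrM ler_nat.
      by rewrite mul2n -addnn addSn ltnS leq_addl.
    rewrite ler_wpM2r ?exprn_ge0//.
    apply: (@le_trans _ _ K1); first by rewrite lerDr.
    by rewrite -[leLHS]expr1 ler_weXn2l.
  - by rewrite -[leLHS]expr1 ler_weXn2l.
have Bb n : Bq sig q X n x <= K2 * r ^- n * R1 ^+ n.
  have qV1 : q^-1 <= 1 by rewrite invf_le1// ltW.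
  rewrite /Bq Sq_Zmass//.
  have Zle : Zmass (q * sig) X n x <= K2 * r ^- n.
    apply: (le_trans (HK' n 0%N)); rewrite mulrAC ler_wpM2r ?(ltW (rn0 _))//.
    by rewrite /K2 mul1n mulrC lerDr.
  apply: (@le_trans _ _ (((mgq sig q * b%:R) ^+ n * (K2 * r ^- n)) `^ q^-1)).
    apply: ge0_ler_powR; rewrite ?nnegrE ?invr_ge0 ?(ltW q0)//.
    - by rewrite mulr_ge0 ?exprn_ge0 ?(ltW mb0)// Zmass_ge0.
    - by rewrite mulr_ge0 ?exprn_ge0 ?(ltW mb0)// mulr_ge0// ltW.
    - by rewrite ler_wpM2l ?exprn_ge0 ?(ltW mb0).
  have KR1 : 1 <= K2 * r ^- n by rewrite -[leLHS]mulr1 ler_pM.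
  rewrite powRM ?exprn_ge0 ?(ltW mb0)//; last by rewrite (le_trans ler01).
  have -> : ((mgq sig q * b%:R) ^+ n) `^ q^-1 = R1 ^+ n.
    by rewrite -(powR_mulrn n (ltW mb0)) powRAC powR_mulrn ?powR_ge0.
  rewrite mulrC ler_wpM2r ?exprn_ge0 ?(ltW R10)//.
  rewrite -[leRHS]powRr1; last by rewrite (le_trans ler01).
  exact: ler_powR.
exists (K1 * K2 * kap), (rho0 / r ^+ 2); split.
- by rewrite !mulr_gt0.
- by rewrite rr andbT divr_gt0// exprn_gt0.
move=> n j; apply: (le_trans (DB n j)).
apply: (le_trans (ler_wpM2l (ltW (pk1 n j)) (Bb n))).
rewrite /kk.
have -> : K1 * r ^- n * j.+1%:R `^ m%:R^-1 * (kap ^+ n.+1 * j.+1%:R `^ (- (th / 2))) *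
    (K2 * r ^- n * R1 ^+ n) =
    K1 * K2 * kap * (rho0 / r ^+ 2) ^+ n * (j.+1%:R `^ m%:R^-1 * j.+1%:R `^ (- (th / 2))).
  have -> : (rho0 / r ^+ 2) ^+ n = R1 ^+ n * kap ^+ n * (r ^- n * r ^- n).
    by rewrite exprMn [rho0 ^+ n]exprMn exprVn -exprM mulnC exprM expr2 invfM.
  by rewrite exprS; move: (r ^- n) => s; ring.
rewrite ler_wpM2l//.
  by rewrite !mulr_ge0 ?exprn_ge0 ?divr_ge0 ?exprn_ge0 ?(ltW K10) ?(ltW K20) ?(ltW kap0) ?(ltW rho00) ?(ltW r0).
rewrite -powRD; last by rewrite pnatr_eq0 /= implybT.
by apply: ler_powR; [rewrite ler1n|rewrite lerBlDr addrC -lerBlDr opprK addrC -lerBrDr; lra].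
Qed.

End increment_bound.

(** * Fourier transform of a measure on [0, 1] *)

Section trig_primitives.
Variable R : realType.
Implicit Types z x y a : R.

Definition cosw z x : R := cos (- (2 * pi * z * x)).
Definition sinw z x : R := sin (- (2 * pi * z * x)).
Definition cosw_prim z x : R := (2 * pi * z)^-1 * sin (2 * pi * z * x).
Definition sinw_prim z x : R := (2 * pi * z)^-1 * cos (2 * pi * z * x).

Lemma is_derive_scale_comp (f df : R -> R) a x :
  (forall y, is_derive y 1 f (df y)) -> a != 0 ->
  is_derive x 1 (fun y => a^-1 * f (a * y)) (df (a * x)).
Proof.
move=> fd a0.
have h1 : is_derive x (1 : R) (a \*: (id : R -> R)) (a *: (1 : R)) by apply: is_deriveZ.
have h2 := is_derive1_comp (fd ((a \*: (id : R -> R)) x)) h1.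
have h3 := is_deriveZ a^-1 h2.
apply: is_derive_eq.
rewrite /GRing.scale /= mulr1 mulrCA mulVf// mulr1.
by [].
Qed.

Lemma is_derive_cosw_prim z x : z != 0 -> is_derive x 1 (cosw_prim z) (cosw z x).
Proof.
move=> z0; rewrite /cosw cosN.
apply: (is_derive_scale_comp (f := sin) (df := cos)).
by rewrite !mulf_neq0// gt_eqF// pi_gt0.
Qed.

Lemma is_derive_sinw_prim z x : z != 0 -> is_derive x 1 (sinw_prim z) (sinw z x).
Proof.
move=> z0; rewrite /sinw sinN.
apply: (is_derive_scale_comp (f := cos) (df := fun y => - sin y)).
by rewrite !mulf_neq0// gt_eqF// pi_gt0.
Qed.

Lemma continuous_lipschitz (f : R -> R) (M : R) :
  (forall x y, `|f x - f y| <= M * `|x - y|) -> continuous f.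
Proof.
move=> fM x; apply/cvgrPdist_lt => e e0.
have M1 : 0 < `|M| + 1 by rewrite ltr_wpDl.
near=> y.
apply: le_lt_trans (fM x y) _.
apply: (@le_lt_trans _ _ ((`|M| + 1) * `|x - y|)).
  by rewrite ler_wpM2r// (le_trans (ler_norm M))// lerDl.
rewrite mulrC -ltr_pdivlMr//.
near: y; apply: cvgr_dist_lt; last by rewrite divr_gt0.
exact: cvg_id.
Unshelve. all: by end_near. Qed.

Lemma cosw_lipschitz z x y : `|cosw z x - cosw z y| <= 2 * pi * `|z| * `|x - y|.
Proof.
apply: (le_trans (cos_lipschitz _ _)).
rewrite -opprB normrN opprK addrC -mulrBr !normrM (ger0_norm (pi_ge0 R)) ger0_norm//.
Qed.

Lemma sinw_lipschitz z x y : `|sinw z x - sinw z y| <= 2 * pi * `|z| * `|x - y|.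
Proof.
apply: (le_trans (sin_lipschitz _ _)).
rewrite -opprB normrN opprK addrC -mulrBr !normrM (ger0_norm (pi_ge0 R)) ger0_norm//.
Qed.

Lemma cosw_lipschitz_freq z z' x : `|cosw z x - cosw z' x| <= 2 * pi * `|z - z'| * `|x|.
Proof.
apply: (le_trans (cos_lipschitz _ _)).
rewrite -opprB normrN opprK addrC -mulrBl -mulrBr !normrM (ger0_norm (pi_ge0 R)) ger0_norm//.
Qed.

Lemma sinw_lipschitz_freq z z' x : `|sinw z x - sinw z' x| <= 2 * pi * `|z - z'| * `|x|.
Proof.
apply: (le_trans (sin_lipschitz _ _)).
rewrite -opprB normrN opprK addrC -mulrBl -mulrBr !normrM (ger0_norm (pi_ge0 R)) ger0_norm//.
Qed.

Lemma continuous_cosw z : continuous (cosw z).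
Proof. exact: continuous_lipschitz (cosw_lipschitz z). Qed.

Lemma continuous_sinw z : continuous (sinw z).
Proof. exact: continuous_lipschitz (sinw_lipschitz z). Qed.

(** Frequency zero needs its own primitive, since the factor [(2 * pi * z)^-1] degenerates; it does
    occur, as the diagonal of the energy sums. *)
Lemma exists_prim_cosw z : exists F : R -> R, forall x, is_derive x 1 F (cosw z x).
Proof.
have [->|z0] := eqVneq z 0; last by exists (cosw_prim z) => x; exact: is_derive_cosw_prim.
exists id => x; rewrite /cosw mulr0 mul0r oppr0 cos0; exact: is_derive_id.
Qed.

Lemma exists_prim_sinw z : exists F : R -> R, forall x, is_derive x 1 F (sinw z x).
Proof.
have [->|z0] := eqVneq z 0; last by exists (sinw_prim z) => x; exact: is_derive_sinw_prim.
exists (cst 0) => x; rewrite /sinw mulr0 mul0r oppr0 sin0; exact: is_derive_cst.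
Qed.

Context {b : nat}.
Hypothesis b0 : (0 < b)%N.
Let bR : 0 < b%:R :> R. Proof. by rewrite ltr0n. Qed.

Lemma interpolate_le (x y1 y2 th : R) : 0 <= x -> x <= y1 -> x <= y2 -> 0 <= th <= 1 ->
  x <= y1 `^ (1 - th) * y2 `^ th.
Proof.
move=> x0 xy1 xy2 /andP[th0 th1].
have [->|xn0] := eqVneq x 0; first by rewrite mulr_ge0 ?powR_ge0.
rewrite -[leLHS]powRr1// -[X in x `^ X](subrK th) powRD ?xn0 ?implybT//.
by apply: ler_pM; rewrite ?powR_ge0//; apply: ge0_ler_powR;
  rewrite ?nnegrE ?subr_ge0// (le_trans x0).
Qed.

Lemma word_coef_bound (F f : R -> R) (u : seq 'I_b) (M : R) :
  (forall x, is_derive x 1 F (f x)) -> (forall x, `|f x| <= M) ->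
  `|word_coef F u| <= M * b%:R ^- size u.
Proof.
move=> Ff fM; rewrite /word_coef; apply: (le_trans (lipschitz_of_derive _ _ Ff fM)).
by rewrite addrAC subrr add0r ger0_norm// invr_ge0 exprn_ge0// ltW.
Qed.

(** Short intervals give the bound by their length, oscillation gives the bound [1 / z]. Their
    geometric interpolation is one estimate for all generations, a power of [z] times a geometric
    factor in the generation. *)
Lemma word_coef_trig (z th : R) (u : seq 'I_b) (f df : R -> R) : 0 < z -> 0 <= th <= 1 ->
  (forall y, is_derive y 1 f (df y)) -> (forall y, `|f y| <= 1) -> (forall y, `|df y| <= 1) ->
  `|word_coef (fun y => (2 * pi * z)^-1 * f (2 * pi * z * y)) u| <=
    (b%:R `^ (th - 1)) ^+ size u * z `^ (- th).
Proof.
move=> z0 th01 fd f1 df1.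
have pi1 := pi_ge2 R.
have a0 : 0 < 2 * pi * z by rewrite !mulr_gt0// pi_gt0.
set F := fun _ => _.
have h1 : `|word_coef F u| <= b%:R ^- size u.
  rewrite -[leRHS]mul1r; apply: (@word_coef_bound _ (fun y => df (2 * pi * z * y))) => // x.
  by apply: is_derive_scale_comp; rewrite // gt_eqF.
have h2 : `|word_coef F u| <= z^-1.
  rewrite /word_coef /F -mulrBr normrM gtr0_norm ?invr_gt0// ler_pdivrMl//.
  rewrite mulfK ?gt_eqF//; apply: (le_trans (ler_normB _ _)).
  by apply: (@le_trans _ _ (1 + 1)); [exact: lerD|lra].
apply: (le_trans (interpolate_le (normr_ge0 _) h1 h2 th01)).
rewrite le_eqVlt; apply/orP; left; apply/eqP; congr (_ * _).
  have bV0 : 0 <= b%:R^-1 :> R by rewrite invr_ge0 ltW.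
  rewrite -exprVn -(powR_mulrn _ bV0) powRAC powR_mulrn ?powR_ge0//.
  by congr (_ ^+ _); rewrite -(powR_inv1 (ltW bR)) -powRrM mulN1r opprB.
by rewrite -(powR_inv1 (ltW z0)) -powRrM mulN1r.
Qed.

Lemma cosw_prim_coef (z th : R) (u : seq 'I_b) : 0 < z -> 0 <= th <= 1 ->
  `|word_coef (cosw_prim z) u| <= (b%:R `^ (th - 1)) ^+ size u * z `^ (- th).
Proof.
move=> z0 th01; apply: (@word_coef_trig z th u sin cos) => // y.
- exact: sin_max.
- exact: cos_max.
Qed.

Lemma sinw_prim_coef (z th : R) (u : seq 'I_b) : 0 < z -> 0 <= th <= 1 ->
  `|word_coef (sinw_prim z) u| <= (b%:R `^ (th - 1)) ^+ size u * z `^ (- th).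
Proof.
move=> z0 th01; apply: (@word_coef_trig z th u cos (fun y => - sin y)) => // y.
- exact: cos_max.
- by rewrite normrN; exact: sin_max.
Qed.

End trig_primitives.

(** * Sums of negative powers *)

Section power_sums.
Variable R : realType.

(** Bernoulli's inequality for an exponent below one, obtained from Young's inequality for
    [(1 - y) ^ a] and [1] with conjugate exponents [1 / a] and [1 / (1 - a)]. *)
Lemma powR_oneDN_le (a y : R) : 0 < a < 1 -> 0 <= y <= 1 -> (1 - y) `^ a <= 1 - a * y.
Proof.
move=> /andP[a0 a1] /andP[y0 y1].
have oa0 : 0 < 1 - a by rewrite subr_gt0.
have := @conjugate_powR R ((1 - y) `^ a) 1 a^-1 (1 - a)^-1 (powR_ge0 _ _) ler01.
rewrite !invr_gt0 a0 oa0 !invrK => /(_ isT isT).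
rewrite addrC subrK => /(_ erefl); rewrite mulr1 -powRrM mulfV ?gt_eqF// powRr1 ?subr_ge0//.
rewrite powR1 mul1r => /le_trans; apply.
by rewrite le_eqVlt; apply/orP; left; apply/eqP; ring.
Qed.

(** By induction in place of a comparison with an integral: the step from [K] to [K.+1] is
    [powR_oneDN_le] with [y = 1 / K.+1]. *)
Lemma power_sum_le (D : R) (K : nat) : 0 < D < 1 ->
  \sum_(k < K) k.+1%:R `^ (- D) <= (1 - D)^-1 * K%:R `^ (1 - D).
Proof.
move=> /andP[D0 D1]; have a0 : 0 < 1 - D by rewrite subr_gt0.
elim: K => [|K IH]; first by rewrite big_ord0 mulr_ge0 ?powR_ge0 ?invr_ge0 ?(ltW a0).
rewrite big_ord_recr /=; apply: (le_trans (lerD IH (lexx _))).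
rewrite -(ler_pM2l a0) mulrDr !mulrA !mulfV ?gt_eqF// !mul1r.
set N : R := K.+1%:R.
have N0 : 0 < N by rewrite ltr0n.
have a01 : 0 < 1 - D < 1 by rewrite a0 gtrBl.
have y01 : 0 <= N^-1 <= 1 by rewrite invr_ge0 ltW//= invf_le1// ler1n.
have h := powR_oneDN_le a01 y01.
have KN : K%:R = N * (1 - N^-1) by rewrite mulrBr mulr1 mulfV ?gt_eqF// /N -natr1 addrK.
rewrite KN powRM ?(ltW N0) ?subr_ge0//; last by case/andP: y01.
have ND : N `^ (- D) = N `^ (1 - D) * N^-1.
  rewrite -(powR_inv1 (ltW N0)) -powRD; last by rewrite (gt_eqF N0) implybT.
  by congr (_ `^ _); ring.
rewrite ND mulrCA -mulrDr -[leRHS]mulr1 ler_wpM2l ?powR_ge0//.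
by rewrite -lerBrDr.
Qed.

Lemma sum_dist_le (phi : nat -> R) (K : nat) : (forall k, 0 <= phi k) ->
  \sum_(i < K) \sum_(j < K) phi (if (j <= i)%N then i - j else j - i)%N <=
  2 * K%:R * \sum_(k < K) phi k.
Proof.
move=> phi0.
have half : \sum_(i < K) \sum_(j < K | (j < i.+1)%N) phi (i - j)%N <= K%:R * \sum_(k < K) phi k.
  rewrite -[X in X%:R](card_ord K) mulr_natl -sumr_const; apply: ler_sum => i _.
  rewrite (big_ord_narrow (ltn_ord i)) /= (reindex_inj rev_ord_inj) /=.
  rewrite (eq_bigr (fun k : 'I_i.+1 => phi k)); last first.
    by move=> k _; rewrite subSS subKn// -ltnS.
  rewrite -(big_ord_narrow (F := fun k : 'I_K => phi k) (ltn_ord i)).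
  by rewrite big_mkcond /=; apply: ler_sum => k _; case: ifP.
apply: (@le_trans _ _ (\sum_(i < K) (\sum_(j < K | (j < i.+1)%N) phi (i - j)%N +
   \sum_(j < K | (i < j.+1)%N) phi (j - i)%N))).
  apply: ler_sum => i _; rewrite !(big_mkcond (fun j : 'I_K => (_ < _)%N)) -big_split /=.
  apply: ler_sum => j _; rewrite !ltnS; case: (leqP j i) => ji; first by rewrite lerDl; case: ifP.
  by rewrite (ltnW ji) add0r.
rewrite big_split /= -mulrA mulr_natl mulr2n; apply: lerD => //.
by rewrite (exchange_big_dep xpredT)//=.
Qed.

Lemma cvg_big_sum (I : Type) (s : seq I) (f : I -> nat -> R) (l : I -> R) :
  (forall i, f i n @[n --> \oo] --> l i) ->
  (\sum_(i <- s) f i n) @[n --> \oo] --> \sum_(i <- s) l i.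
Proof.
move=> fl; elim: s => [|i s IH].
  by rewrite big_nil; under eq_fun do rewrite big_nil; exact: cvg_cst.
by rewrite big_cons; under eq_fun do rewrite big_cons; apply: cvgD.
Qed.

End power_sums.

Section fourier_measure.
Context {R : realType}.
Variable nu : {finite_measure set R -> \bar R}.
Hypothesis nu01 : carried_by01 nu.

Definition Cw (z : R) : R := (\int[nu]_(x in `[0%R, 1%R]) cosw z x)%R.
Definition Sw (z : R) : R := (\int[nu]_(x in `[0%R, 1%R]) sinw z x)%R.
Definition total_mass : R := fine (nu `[0%R, 1%R]%classic).

Let m01 : measurable (`[0%R, 1%R]%classic : set R). Proof. exact: measurable_itv. Qed.

Let fin (A : set R) : measurable A -> (nu A < +oo)%E.
Proof. by move=> mA; rewrite ltey_eq fin_num_measure. Qed.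

Let int_bounded (A : set R) (f : R -> R) : measurable A -> continuous f ->
  (forall x, `|f x| <= 1) -> nu.-integrable A (EFin \o f).
Proof.
move=> mA cf f1; apply: measurable_bounded_integrable => //.
- exact: fin.
- by apply: measurable_funTS; exact: continuous_measurable_fun.
- exists 1; split => // M M1 x _; exact: le_trans (f1 x) (ltW M1).
Qed.

Let icos A z : measurable A -> nu.-integrable A (EFin \o cosw z).
Proof.
by move=> mA; apply: int_bounded => //; [exact: continuous_cosw|move=> x; exact: cos_max].
Qed.

Let isin A z : measurable A -> nu.-integrable A (EFin \o sinw z).
Proof.
by move=> mA; apply: int_bounded => //; [exact: continuous_sinw|move=> x; exact: sin_max].
Qed.

Let int01 (f : R -> R) : nu.-integrable setT (EFin \o f) ->
  (\int[nu]_x f x = \int[nu]_(x in `[0%R, 1%R]) f x)%R.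
Proof.
move=> If; rewrite /Rintegral; congr fine.
rewrite (@negligible_integral _ _ _ nu setT (~` `[0%R, 1%R]%classic))//; last first.
  exact: measurableC.
by rewrite setTD setCK.
Qed.

Lemma normc_fourier_transform z :
  ComplexField.Normc.normc (fourier_transform nu z) ^+ 2 = Cw z ^+ 2 + Sw z ^+ 2.
Proof.
rewrite /fourier_transform /cintegral /=.
rewrite sqr_sqrtr ?addr_ge0 ?sqr_ge0//; congr (_ ^+ 2 + _ ^+ 2).
  by rewrite int01//; exact: icos.
by rewrite int01//; exact: isin.
Qed.

Lemma total_mass_ge0 : 0 <= total_mass. Proof. exact: fine_ge0. Qed.

Let lip (f g : R -> R) (M : R) : nu.-integrable `[0%R, 1%R]%classic (EFin \o f) ->
  nu.-integrable `[0%R, 1%R]%classic (EFin \o g) ->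
  (forall x, `[0%R, 1%R]%classic x -> `|f x - g x| <= M) ->
  `|(\int[nu]_(x in `[0%R, 1%R]) f x)%R - (\int[nu]_(x in `[0%R, 1%R]) g x)%R| <= M * total_mass.
Proof.
move=> If Ig fg.
have Ifg : nu.-integrable `[0%R, 1%R]%classic (EFin \o (fun x => f x - g x)).
  exact: (integrableB m01 If Ig).
rewrite -RintegralB//; apply: (le_trans (le_normr_Rintegral m01 Ifg)).
rewrite /total_mass -Rintegral_cst//; apply: le_Rintegral => //.
- exact: (integrable_norm Ifg).
- apply: measurable_bounded_integrable => //; first exact: fin.
  by exists `|M|; split => [|r Mr x _]; [exact: num_real|exact: ltW].
Qed.

Lemma Cw_lipschitz z z' : `|Cw z - Cw z'| <= 2 * pi * `|z - z'| * total_mass.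
Proof.
apply: lip; [exact: icos|exact: icos|] => x /=; rewrite in_itv /= => /andP[x0 x1].
apply: (le_trans (cosw_lipschitz_freq _ _ _)).
by rewrite ler_piMr ?mulr_ge0 ?pi_ge0// ger0_norm.
Qed.

Lemma Sw_lipschitz z z' : `|Sw z - Sw z'| <= 2 * pi * `|z - z'| * total_mass.
Proof.
apply: lip; [exact: isin|exact: isin|] => x /=; rewrite in_itv /= => /andP[x0 x1].
apply: (le_trans (sinw_lipschitz_freq _ _ _)).
by rewrite ler_piMr ?mulr_ge0 ?pi_ge0// ger0_norm.
Qed.

Lemma Cw_norm z : Cw `|z| = Cw z.
Proof.
have [z0|z0] := leP 0 z; first by rewrite ger0_norm.
rewrite ltr0_norm// /Cw; apply: eq_Rintegral => x _.
by rewrite /cosw mulrN mulNr opprK cosN.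
Qed.

Lemma Sw_norm z : Sw `|z| ^+ 2 = Sw z ^+ 2.
Proof.
have [z0|z0] := leP 0 z; first by rewrite ger0_norm.
rewrite ltr0_norm//; have -> : Sw (- z) = -1 * Sw z.
  rewrite /Sw -RintegralZl//; last exact: isin.
  by apply: eq_Rintegral => x _; rewrite /sinw mulrN mulNr opprK sinN mulN1r opprK.
by rewrite mulN1r sqrrN.
Qed.

Lemma Cw_le z : `|Cw z| <= total_mass.
Proof.
have := @lip (cosw z) (fun=> 0) 1; rewrite Rintegral_cst// mul0r subr0 mul1r; apply.
- exact: icos.
- by apply: int_bounded => // [|x]; [move=> x; exact: cvg_cst|rewrite normr0].
- by move=> x _; rewrite subr0; exact: cos_max.
Qed.

Lemma Sw_le z : `|Sw z| <= total_mass.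
Proof.
have := @lip (sinw z) (fun=> 0) 1; rewrite Rintegral_cst// mul0r subr0 mul1r; apply.
- exact: isin.
- by apply: int_bounded => // [|x]; [move=> x; exact: cvg_cst|rewrite normr0].
- by move=> x _; rewrite subr0; exact: sin_max.
Qed.

(* The grid sqrt(j+1) has gaps of order 1/z near z, which the Lipschitz bound absorbs. *)
Lemma fourier_decay_of_grid (gam K : R) : 0 <= gam <= 4^-1 -> 0 <= K ->
  (forall j : nat, `|Cw (j.+1%:R `^ 2^-1)| <= K * j.+1%:R `^ (- gam)) ->
  (forall j : nat, `|Sw (j.+1%:R `^ 2^-1)| <= K * j.+1%:R `^ (- gam)) ->
  fourier_decay nu (4 * gam).
Proof.
move=> /andP[g0 g4] K0 HC HS.
pose K5 := 4 * K + 2 * pi * total_mass.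
have pi0 := pi_gt0 R; have M0 := total_mass_ge0.
have K50 : 0 <= K5 by rewrite addr_ge0 ?mulr_ge0// ltW.
have main (f : R -> R) z : 2 <= z ->
    (forall j : nat, `|f (j.+1%:R `^ 2^-1)| <= K * j.+1%:R `^ (- gam)) ->
    (forall z z', `|f z - f z'| <= 2 * pi * `|z - z'| * total_mass) ->
    `|f z| <= K5 * z `^ (- (2 * gam)).
  move=> z2 Hf Lf.
  have z0 : 0 < z by exact: lt_le_trans z2.
  have zz0 : 0 <= z ^+ 2 by exact: sqr_ge0.
  (* The grid point [y] is the root of the integer part [N] of [z ^ 2]: from [(z - y) * (z + y) < 1]
     follows [z - y <= 1 / z], which is at most [z ^ (- 2 gam)]. *)
  have := truncn_itv zz0; set N := Num.trunc _ => /andP[N1 N2].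
  have zz4 : 4 <= z ^+ 2.
    by rewrite (_ : 4 = 2 ^+ 2) ?lerXn2r ?nnegrE ?(ltW z0)//; ring.
  have Nz : z ^+ 2 / 4 <= N%:R by rewrite -natr1 in N2; lra.
  have N0 : (0 < N)%N by rewrite -(ltr0n R); apply: lt_le_trans Nz; rewrite divr_gt0// exprn_gt0.
  have := Hf N.-1; rewrite prednK//.
  set y := N%:R `^ 2^-1 => Hy.
  have y0 : 0 < y by rewrite powR_gt0// ltr0n.
  have yy : y ^+ 2 = N%:R by rewrite -powR_mulrn ?(ltW y0)// -powRrM mulVf// powRr1.
  have yz : y <= z by rewrite -(ler_pXn2r (ltn0Sn 1)) ?nnegrE ?(ltW y0) ?(ltW z0)// yy.
  have zy : `|z - y| <= z^-1.
    rewrite ger0_norm ?subr_ge0// -[leRHS]mul1r ler_pdivlMr//.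
    apply: (@le_trans _ _ ((z - y) * (z + y))).
      by rewrite ler_wpM2l ?subr_ge0// lerDl ltW.
    rewrite -subr_sqr yy lerBlDr addrC natr1; exact: ltW.
  have zg1 : z^-1 <= z `^ (- (2 * gam)).
    rewrite -(powR_inv1 (ltW z0)); apply: ler_powR; first by rewrite (le_trans _ z2)// ler1n.
    lra.
  have Ng : N%:R `^ (- gam) <= 4 * z `^ (- (2 * gam)).
    apply: (@le_trans _ _ ((z ^+ 2 / 4) `^ (- gam))).
      rewrite !powRN lef_pV2 ?posrE ?powR_gt0 ?ltr0n ?divr_gt0 ?exprn_gt0//.
      by apply: ge0_ler_powR; rewrite ?nnegrE ?divr_ge0.
    rewrite powRM ?invr_ge0// mulrC; apply: ler_pM; rewrite ?powR_ge0//.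
      rewrite -powR_inv1// -powRrM mulrN mulN1r opprK.
      by rewrite -[leRHS]powRr1//; apply: ler_powR; [rewrite ler1n|lra].
    by rewrite -powR_mulrn ?(ltW z0)// -powRrM mulrN.
  have -> : f z = f y + (f z - f y) by ring.
  apply: (le_trans (ler_normD _ _)); rewrite mulrDl; apply: lerD.
    by apply: (le_trans Hy); rewrite -mulrA mulrCA ler_wpM2l.
  apply: (le_trans (Lf z y)); rewrite mulrAC; apply: ler_wpM2l.
    by rewrite !mulr_ge0// ltW.
  exact: le_trans zg1.
exists (2 * K5 ^+ 2), 2 => z z2.
rewrite normc_fourier_transform -Cw_norm -Sw_norm.
have z0 : 0 < `|z| by exact: lt_le_trans z2.
have zp : `|z| `^ (- (4 * gam)) = (`|z| `^ (- (2 * gam))) ^+ 2.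
  by rewrite -powR_mulrn ?powR_ge0// -powRrM; congr (_ `^ _); ring.
rewrite zp -mulrA -exprMn mulr_natl mulr2n; apply: lerD.
  rewrite -[leLHS]real_normK ?num_real// lerXn2r ?nnegrE ?mulr_ge0 ?powR_ge0//.
  by apply: main => //; exact: Cw_lipschitz.
rewrite -[leLHS]real_normK ?num_real// lerXn2r ?nnegrE ?mulr_ge0 ?powR_ge0//.
by apply: main => //; exact: Sw_lipschitz.
Qed.

End fourier_measure.

(** * Decay of the Fourier transform and sums of squared masses *)

Section energy_of_decay.
Context {R : realType} {b : nat}.
Hypothesis b1 : (1 < b)%N.
Variable nu : {finite_measure set R -> \bar R}.
Hypothesis nu01 : carried_by01 nu.

Let b0 : (0 < b)%N. Proof. exact: ltnW. Qed.
Let bR : 0 < b%:R :> R. Proof. by rewrite ltr0n. Qed.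

(** Writing [k.+1] includes frequency zero. The finitely many integers below the threshold [M] are
    absorbed in the constant by the trivial bound by the total mass. *)
Lemma decay_integers (D : R) : 0 < D < 1 -> fourier_decay nu D ->
  exists2 C : R, 0 < C & forall k : nat, Cw nu k%:R ^+ 2 + Sw nu k%:R ^+ 2 <= C * k.+1%:R `^ (- D).
Proof.
move=> /andP[D0 D1] [C [M H]].
have tm := total_mass_ge0 nu.
pose N := (Num.truncn `|M|).+1.
have MN : M <= N%:R.
  by rewrite (le_trans (ler_norm M))// ltW// truncnS_gt.
have pw k : 0 < k.+1%:R `^ (- D) :> R by rewrite powR_gt0// ltr0n.
exists (1 + 2 * `|C| + 2 * total_mass nu ^+ 2 * N.+1%:R).
  by rewrite -addrA ltr_wpDr// addr_ge0 ?mulr_ge0 ?sqr_ge0.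
move=> k; have [kN|Nk] := ltnP k N.
  apply: (@le_trans _ _ (2 * total_mass nu ^+ 2)).
    rewrite mulr_natl mulr2n; apply: lerD;
      rewrite -[leLHS]real_normK ?num_real// lerXn2r ?nnegrE//.
    - exact: Cw_le.
    - exact: Sw_le.
  apply: (@le_trans _ _ (2 * total_mass nu ^+ 2 * N.+1%:R * k.+1%:R `^ (- D))); last first.
    by rewrite ler_wpM2r ?(ltW (pw _))// lerDr addr_ge0// mulr_ge0.
  rewrite -mulrA ler_peMr ?mulr_ge0 ?sqr_ge0//.
  rewrite powRN -ler_pdivrMr ?invr_gt0 ?powR_gt0 ?ltr0n// invrK mul1r.
  apply: (@le_trans _ _ (k.+1%:R `^ 1)).
    by apply: ler_powR; [rewrite ler1n|exact: ltW].
  by rewrite powRr1// ler_nat ltnS ltnW.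
have := H k%:R; rewrite ger0_norm// => /(_ _)/wrap[].
  by rewrite (le_trans MN)// ler_nat.
rewrite normc_fourier_transform// => h; apply: (le_trans h).
apply: (@le_trans _ _ (2 * `|C| * k.+1%:R `^ (- D))); last first.
  rewrite ler_wpM2r ?(ltW (pw _))// addrAC lerDr addr_ge0//.
  by rewrite mulr_ge0 ?mulr_ge0 ?sqr_ge0.
have k0 : (0 < k)%N by exact: leq_trans Nk.
apply: (@le_trans _ _ (`|C| * k%:R `^ (- D))).
  by rewrite ler_wpM2r ?powR_ge0// ler_norm.
rewrite -[leRHS]mulrA mulrCA ler_wpM2l//.
rewrite !powRN -ler_pdivrMr ?invr_gt0 ?powR_gt0 ?ltr0n// invrK.
rewrite mulrC ler_pdivrMr ?powR_gt0 ?ltr0n//.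
apply: (@le_trans _ _ ((2 * k%:R) `^ D)).
  apply: ge0_ler_powR; rewrite ?nnegrE ?(ltW D0)//.
  by rewrite -natrM ler_nat mul2n -addnn -addn1 leq_add2l.
rewrite powRM// ler_wpM2r ?powR_ge0//.
rewrite -[leRHS]powRr1//; apply: ler_powR; [by rewrite ler1n|exact: ltW].
Qed.

(** A given distance is realised by at most [2 * b ^ n] pairs, and the sum of [k ^ (- D)] up to
    [b ^ n] has order [(b ^ n) ^ (1 - D)] because [D < 1]. *)
Lemma decay_energy (D : R) : 0 < D < 1 -> fourier_decay nu D ->
  exists2 C : R, 0 < C & forall n : nat,
    \sum_(i < b ^ n) \sum_(j < b ^ n)
      (Cw nu (i%:R - j%:R) ^+ 2 + Sw nu (i%:R - j%:R) ^+ 2) <=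
    C * (b%:R ^+ n) `^ (2 - D).
Proof.
move=> D01 /(decay_integers D01)[C C0 HC].
have [D0 D1] := andP D01.
exists (2 * C * (1 - D)^-1); first by rewrite !mulr_gt0// invr_gt0 subr_gt0.
move=> n; pose phi k : R := C * k.+1%:R `^ (- D).
have phi0 k : 0 <= phi k by rewrite mulr_ge0 ?powR_ge0// ltW.
apply: (@le_trans _ _ (\sum_(i < b ^ n) \sum_(j < b ^ n)
    phi (if (j <= i)%N then i - j else j - i)%N)).
  apply: ler_sum => i _; apply: ler_sum => j _.
  rewrite -Cw_norm -Sw_norm.
  have -> : `|i%:R - j%:R| = (if (j <= i)%N then i - j else j - i)%N%:R :> R.
    case: leqP => [ji|/ltnW ij]; first by rewrite natrB// ger0_norm// subr_ge0 ler_nat.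
    by rewrite distrC natrB// ger0_norm// subr_ge0 ler_nat.
  exact: HC.
apply: (le_trans (sum_dist_le _ phi0)).
rewrite -mulr_sumr natrX.
have bn0 : 0 < b%:R ^+ n :> R by rewrite exprn_gt0.
have := power_sum_le (b ^ n)%N D01; rewrite natrX => h.
have bE : (b%:R ^+ n) `^ (2 - D) = b%:R ^+ n * (b%:R ^+ n) `^ (1 - D) :> R.
  rewrite -[X in X * _](powRr1 (ltW bn0)) -powRD; last by rewrite (gt_eqF bn0) implybT.
  by congr (_ `^ _); ring.
rewrite bE.
have -> : 2 * C / (1 - D) * (b%:R ^+ n * (b%:R ^+ n) `^ (1 - D)) =
   2 * b%:R ^+ n * (C * ((1 - D)^-1 * (b%:R ^+ n) `^ (1 - D))) by ring.
by rewrite ler_wpM2l ?mulr_ge0 ?(ltW bn0)// ler_wpM2l// ltW.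
Qed.

Variables (w : seq 'I_b -> R) (w0 : forall u, 0 <= w u).
Hypothesis wnu : weak_cvg01 (cascade_approx w0) nu.

(** For [u] of length [m], the mass of [word_interval u] under the approximation of generation
    [m]. *)
Definition pword (w : seq 'I_b -> R) (m : nat) (u : seq 'I_b) : R :=
  b%:R ^- m * \prod_(j < m.+1) w (take j u).

Lemma pword_ge0 m u : 0 <= pword w m u.
Proof. by rewrite mulr_ge0 ?prodr_ge0// invr_ge0 exprn_ge0// ltW. Qed.

Lemma pword_sum_cvg : (\sum_(u <- words b m) pword w m u) @[m --> \oo] --> total_mass nu.
Proof.
have c1 : continuous (fun _ : R => 1 : R) by move=> x; exact: cvg_cst.
have := wnu (continuous_subspaceT c1).
have m01 : measurable (`[0%R, 1%R]%classic : set R) by exact: measurable_itv.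
rewrite (Rintegral_cst _ m01) mul1r.
rewrite -/(total_mass nu) => H; apply: cvg_trans H; apply: near_eq_cvg; near=> m.
rewrite (@cascade_integral _ _ b0 w w0 (fun=> 1) id)//.
apply: eq_big_seq => u; rewrite mem_words => /eqP um.
by rewrite /word_coef /= addrAC subrr add0r um /pword mulrC.
Unshelve. all: by end_near.
Qed.

(** Moving the mass of each interval to its left end changes the integral by at most [M * b ^ (- m)]
    times the total mass. This produces the point masses to which [fejer_words] applies. *)
Lemma discrete_transform_cvg (f F : R -> R) (M : R) :
  (forall x : R, is_derive x 1 F (f x)) -> (forall x y, `|f x - f y| <= M * `|x - y|) ->
  (\sum_(u <- words b m) pword w m u * f (word_left u)) @[m --> \oo] -->
    (\int[nu]_(x in `[0%R, 1%R]) f x)%R.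
Proof.
move=> Ff fM.
have cf : continuous f by exact: continuous_lipschitz fM.
have cF : continuous F.
  by move=> x; apply/differentiable_continuous/derivable1_diffP; have [] := Ff x.
have M0 : 0 <= M by have := fM 1 0; rewrite subr0 normr1 mulr1; apply: le_trans.
have H := wnu (continuous_subspaceT cf).
pose I m := (\int[cascade_approx w0 m]_(t in `[0%R, 1%R]) f t)%R.
pose S m := \sum_(u <- words b m) pword w m u * f (word_left u).
pose Z m := \sum_(u <- words b m) pword w m u.
have IS m : `|I m - S m| <= M * b%:R ^- m * Z m.
  rewrite /I (cascade_integral b0 w0 Ff cf) /S /Z -sumrB mulr_sumr.
  apply: (le_trans (ler_norm_sum _ _ _)).
  rewrite big_seq [leRHS]big_seq; apply: ler_sum => u; rewrite mem_words => /eqP um.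
  have bm0 : 0 < b%:R ^- m :> R by rewrite invr_gt0 exprn_gt0.
  rewrite /pword -mulrA [b%:R ^- m * _]mulrC -[X in _ - X]mulrA -mulrBr normrM.
  rewrite ger0_norm ?prodr_ge0// [leRHS](_ : _ = \prod_(j < m.+1) w (take j u) * (b%:R ^- m * (M * b%:R ^- m))); last by ring.
  rewrite ler_wpM2l ?prodr_ge0// /word_coef um.
  have lr : word_left u <= word_left u + b%:R ^- m :> R by rewrite lerDl ltW.
  have Ff' x : x \in `]word_left u, (word_left u + b%:R ^- m)[ -> is_derive x 1 F (f x).
    by move=> _; exact: Ff.
  have [c] := MVT_segment lr Ff' (continuous_subspaceT cF).
  rewrite in_itv /= => /andP[c1 c2] ->.
  rewrite [word_left u + _]addrC addrK [f c * _]mulrC -mulrBr normrM gtr0_norm//.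
  rewrite ler_wpM2l ?(ltW bm0)//; apply: (le_trans (fM _ _)); rewrite ler_wpM2l//.
  by rewrite ger0_norm ?subr_ge0// lerBlDr addrC.
have bm : M * b%:R ^- m @[m --> \oo] --> M * 0.
  apply: cvgMr; under eq_fun do rewrite -exprVn; apply: cvg_expr.
  by rewrite ger0_norm ?invr_ge0 ?(ltW bR)// invf_lt1// ltr1n.
have d0 : (I m - S m) @[m --> \oo] --> (0 : R).
  apply/norm_cvg0P; apply: (@squeeze_cvgr _ _ _ _ (fun=> 0) (fun m => M * b%:R ^- m * Z m)).
  - by near=> m; rewrite normr_ge0 IS.
  - exact: cvg_cst.
  - have := cvgM bm pword_sum_cvg; rewrite mulr0 mul0r; exact.
have HH := cvgB H d0; rewrite subr0 in HH.
have -> : (fun m => \sum_(u <- words b m) pword w m u * f (word_left u)) =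
    (fun m => I m - (I m - S m)).
  by apply/funext => m; rewrite opprB addrC subrK.
exact: HH.
Unshelve. all: by end_near.
Qed.

(** For fixed [n] only finitely many frequencies occur, so the limit is taken in the depth alone,
    through the transforms. The factor [2] in the constant gives the strict inequality that survives
    at finite depth. *)
Lemma energy_eventually (D : R) : 0 < D < 1 -> fourier_decay nu D ->
  exists2 C : R, 0 < C & forall n : nat, exists m0 : nat, forall k, (m0 <= k)%N ->
    (b%:R ^+ n / 2) ^+ 2 * \sum_(u <- words b (n + 4))
       (\sum_(v <- words b k) pword w (n + 4 + k) (u ++ v)) ^+ 2 <=
    C * (b%:R ^+ n) `^ (2 - D).
Proof.
move=> D01 /(decay_energy D01)[C C0 HC]; exists (2 * C); first by rewrite mulr_gt0.
move=> n.
have bn0 : 0 < b%:R ^+ n :> R by rewrite exprn_gt0.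
pose c z m := \sum_(u <- words b m) pword w m u * cosw z (word_left u).
pose s z m := \sum_(u <- words b m) pword w m u * sinw z (word_left u).
have cc z : c z m @[m --> \oo] --> Cw nu z.
  have [F FF] := exists_prim_cosw z.
  exact: (discrete_transform_cvg FF (cosw_lipschitz z)).
have sc z : s z m @[m --> \oo] --> Sw nu z.
  have [F FF] := exists_prim_sinw z.
  exact: (discrete_transform_cvg FF (sinw_lipschitz z)).
have H : (\sum_(i < b ^ n) \sum_(j < b ^ n) (c (i%:R - j%:R) m ^+ 2 + s (i%:R - j%:R) m ^+ 2))
   @[m --> \oo] --> \sum_(i < b ^ n) \sum_(j < b ^ n)
      (Cw nu (i%:R - j%:R) ^+ 2 + Sw nu (i%:R - j%:R) ^+ 2).
  apply: (@cvg_big_sum R) => i; apply: (@cvg_big_sum R) => j.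
  by rewrite !expr2; under eq_fun do rewrite !expr2; apply: cvgD; apply: cvgM.
have lt2 : \sum_(i < b ^ n) \sum_(j < b ^ n)
      (Cw nu (i%:R - j%:R) ^+ 2 + Sw nu (i%:R - j%:R) ^+ 2) <
      2 * C * (b%:R ^+ n) `^ (2 - D).
  apply: (le_lt_trans (HC n)).
  by rewrite -mulrA mulr_natl mulr2n ltrDl mulr_gt0// powR_gt0.
have [m0 _ Hm] := cvgr_lt _ H _ lt2.
exists m0 => k mk.
apply: (le_trans (fejer_words b1 n k (pword_ge0 (n + 4 + k)))).
apply: ltW; apply: (Hm (n + 4 + k)%N) => /=.
by rewrite (leq_trans mk)// leq_addl.
Qed.

End energy_of_decay.

(** * The dimension of the cascade measure *)

Section weights.
Context {R : realType} {b : nat} (sigma : R).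
Hypothesis sigma0 : 0 < sigma.
Context {d0 : measure_display} {T0 : measurableType d0} (P0 : probability T0 R).
Variable N : {RV P0 >-> R}.
Hypothesis hN : distribution P0 N = normal_prob 0 1.
Context {d : measure_display} {T : measurableType d} (P : probability T R).
Variable W : seq 'I_b -> {RV P >-> R}.
Hypothesis Wnil : forall x : T, W [::] x = 1.
Hypothesis Wiid : iid_copies P (fun (u : nonempty_word b) (x : T) => W (val u) x)
  P0 (fun y : T0 => expR (sigma * N y - sigma ^+ 2 / 2)).

(** Inverse of [exp (sigma y - sigma ^ 2 / 2)]; what it does to nonpositive [y] matters only on a
    null event. *)
Definition log_weight (y : R) : R := (ln y + sigma ^+ 2 / 2) / sigma.

Definition gauss_weight (u : seq 'I_b) (x : T) : R := log_weight (W u x).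

Let mlog : measurable_fun setT log_weight.
Proof.
apply: measurable_funM => //; apply: measurable_funD => //; exact: measurable_ln.
Qed.

Let mW u : measurable_fun setT (W u). Proof. exact: measurable_funP. Qed.

Let nw (u : seq 'I_b) (hu : u != [::]) : nonempty_word b := Sub u hu.

Lemma gauss_weight_family : gauss_family P gauss_weight.
Proof.
have mg u : measurable_fun setT (gauss_weight u) by apply: measurableT_comp.
have [ind law] := Wiid.
split=> //.
  move=> s A us sn mA.
  pose s' : seq (nonempty_word b) := pmap insub s.
  have vs : map val s' = s.
    rewrite /s' pmap_filter; last by move=> u; exact: insubK.
    by apply/all_filterP/allP => u /sn; rewrite /nonnil /= isSome_insub.
  have us' : uniq s' by rewrite -(map_inj_uniq val_inj) vs.
  have mB (u : nonempty_word b) : measurable (log_weight @^-1` A (val u)).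
    by rewrite -[X in measurable X]setTI; exact: mlog.
  have := ind s' (fun u : nonempty_word b => log_weight @^-1` A (val u)) us' mB.
  rewrite -vs big_map => H.
  rewrite -[RHS]H; congr (P _); apply/seteqP; split => x /= xs u /=.
    by move=> us2; apply: (xs (val u)); apply/mapP; exists u.
  by move=> /mapP[v vs2 ->]; exact: (xs v vs2).
move=> u nu; split=> // A mA.
have mB : measurable (log_weight @^-1` A).
  by rewrite -[X in measurable X]setTI; exact: mlog.
have := law (nw nu) _ mB.
rewrite (_ : (fun x => W (val (nw nu)) x) @^-1` (log_weight @^-1` A) = gauss_weight u @^-1` A)//.
move=> ->; rewrite -hN /distribution /pushforward /=; congr (P0 _).
apply/seteqP; split => y; rewrite /= /log_weight expRK subrK mulrAC mulfV ?mul1r// gt_eqF//.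
Qed.

(** The weights are known in law only, so positivity holds almost surely for each word, then for all
    words at once since they can be enumerated by [unpickle]. *)
Lemma weight_ae : {ae P, forall x, forall u, u != [::] ->
  W u x = expR (sigma * gauss_weight u x - sigma ^+ 2 / 2)}.
Proof.
have H : forall k : nat, {ae P, forall x, forall u, unpickle k = Some u -> u != [::] ->
    W u x = expR (sigma * gauss_weight u x - sigma ^+ 2 / 2)}.
  move=> k; case E : (unpickle k) => [u|]; last by apply: aeW.
  have [->|un] := eqVneq u [::]; first by apply: aeW => x v [<-].
  have [_ law] := Wiid.
  have mI : measurable (`]-oo, 0%R]%classic : set R) by exact: measurable_itv.
  have := law (nw un) _ mI.
  rewrite (_ : (fun y : T0 => _) @^-1` _ = set0); last first.
    by apply/seteqP; split => y //=; rewrite in_itv /= leNgt expR_gt0.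
  rewrite measure0 => P0'.
  exists (W u @^-1` `]-oo, 0%R]%classic); split => //.
    by rewrite -[X in measurable X]setTI; exact: mW.
  move=> x /= nx; rewrite in_itv /= leNgt; apply/negP => Wx; apply: nx => v [<-] _.
  rewrite /gauss_weight /log_weight mulrC divfK ?gt_eqF// addrK.
  by rewrite lnK.
apply: filterS (ae_foralln H) => x Hx u un.
by apply: (Hx (pickle u)) => //; rewrite pickleK.
Qed.

Lemma prod_weights x u : (forall u, u != [::] ->
    W u x = expR (sigma * gauss_weight u x - sigma ^+ 2 / 2)) ->
  \prod_(j < (size u).+1) W (take j u) x = gwt sigma gauss_weight u x.
Proof.
move=> H; rewrite big_ord_recl take0 Wnil mul1r.
rewrite (eq_bigr (fun j : 'I_(size u) =>
  expR (sigma * gauss_weight (take j.+1 u) x - sigma ^+ 2 / 2))); last first.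
  by move=> j _; apply: H; rewrite -size_eq0 size_takel ?lift0 ?ltn_ord.
transitivity (expR (\sum_(j < size u) (sigma * gauss_weight (take j.+1 u) x - sigma ^+ 2 / 2))).
  by rewrite expR_sum.
rewrite /gwt /psum; congr expR.
rewrite sumrB -mulr_sumr; congr (_ - _).
by rewrite sumr_const card_ord mulr_natr.
Qed.

End weights.

(** * Almost sure decay below the critical exponent *)

Section decay.
Context {R : realType} {b : nat} (sigma : R).
Hypothesis b1 : (1 < b)%N.
Context {d : measure_display} {T : measurableType d} (P : probability T R).
Variable X : seq 'I_b -> T -> R.
Hypothesis gX : gauss_family P X.
Variable W : seq 'I_b -> {RV P >-> R}.
Hypothesis W0 : forall (u : seq 'I_b) (x : T), 0 <= W u x.
Variable mu : T -> {finite_measure set R -> \bar R}.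
Hypothesis hmu : is_cascade_measure P W0 mu.
Hypothesis WX : {ae P, forall x, forall u,
  \prod_(j < (size u).+1) W (take j u) x = gwt sigma X u x}.

Let b0 : (0 < b)%N. Proof. exact: ltnW. Qed.

Let zeta (j : nat) : R := j.+1%:R `^ 2^-1.

Let zeta0 j : 0 < zeta j. Proof. by rewrite powR_gt0// ltr0n. Qed.

(** On one path, the integral is the limit of sums that telescope into increments, bounded by a
    geometric series. The summand [1] in the constant is the contribution of the empty word. *)
Let bounded_transform (F f : nat -> R -> R) (th gam K rho : R) x : gam < th / 2 ->
  0 < K -> 0 < rho < 1 ->
  (forall j y, is_derive (y : R) 1 (F j) (f j y)) -> (forall j, continuous (f j)) ->
  (forall j (u : seq 'I_b), `|word_coef (F j) u| <= (b%:R `^ (th - 1)) ^+ size u * zeta j `^ (- th)) ->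
  (forall n j, `|incr sigma X (word_coef (F j)) n x| <= K * rho ^+ n * j.+1%:R `^ (- gam)) ->
  (forall u, \prod_(j < (size u).+1) W (take j u) x = gwt sigma X u x) ->
  weak_cvg01 (cascade_approx (fun u => W0 u x)) (mu x) ->
  forall j, `|(\int[mu x]_(t in `[0%R, 1%R]) f j t)%R| <=
    (1 + K / (1 - rho)) * j.+1%:R `^ (- gam).
Proof.
move=> gth K0 /andP[rho0 rho1] Ff cf Fb Fi Wx wx j.
set B := (1 + _) * _.
pose S n := \sum_(u <- words b n) gwt sigma X u x * word_coef (F j) u.
have J0 : 0 <= j.+1%:R `^ (- gam) :> R by exact: powR_ge0.
have r1 : 0 < 1 - rho by rewrite subr_gt0.
have Sn n : `|S n| <= (1 + K * (1 - rho ^+ n) / (1 - rho)) * j.+1%:R `^ (- gam).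
  elim: n => [|n IH].
    rewrite expr0 subrr mulr0 mul0r addr0 mul1r /S big_seq1 gwt_nil mul1r.
    apply: (le_trans (Fb j [::])); rewrite expr0 mul1r /zeta -powRrM.
    by apply: ler_powR; [rewrite ler1n|rewrite mulrN lerN2 mulrC ltW].
  have -> : S n.+1 = S n + incr sigma X (word_coef (F j)) n x.
    rewrite incrE /S.
    under [X in _ = _ + (_ - X)]eq_bigr do rewrite (word_coef_rcons b0).
    by rewrite addrC subrK.
  apply: (le_trans (ler_normD _ _)); apply: (le_trans (lerD IH (Fi n j))).
  rewrite -mulrDl ler_wpM2r// -addrA lerD2l le_eqVlt; apply/orP; left; apply/eqP.
  rewrite exprS; field; by rewrite gt_eqF.
have SB n : `|S n| <= B.
  apply: (le_trans (Sn n)); rewrite ler_wpM2r// lerD2l ler_wpM2r ?invr_ge0 ?(ltW r1)//.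
  by rewrite ler_piMr ?(ltW K0)// gerBl exprn_ge0// ltW.
have cS : S n @[n --> \oo] --> (\int[mu x]_(t in `[0%R, 1%R]) f j t)%R.
  have -> : S = fun n => (\int[cascade_approx (fun u => W0 u x) n]_(t in `[0%R, 1%R]) f j t)%R.
    apply/funext => n; rewrite (cascade_integral b0 (fun u => W0 u x) (Ff j) (cf j)) /S.
    by apply: eq_big_seq => u; rewrite mem_words => /eqP <-; rewrite Wx.
  exact: (wx _ (continuous_subspaceT (cf j))).
have := cvg_norm cS => cN.
rewrite leNgt; apply/negP => BL.
have [n0 _ Hn] := cvgr_gt _ (cN _) _ BL.
by have := Hn n0 (leqnn n0); rewrite /= ltNge SB.
Qed.

(** The factor 4: a bound [j ^ (- gam)] at frequency [sqrt j] is [z ^ (- 2 gam)], and the decay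
    concerns the square of the modulus. *)
Lemma decay_ae (q th gam : R) : 1 < q <= 2 -> 0 <= th <= 1 ->
  (mgq sigma q * b%:R) `^ q^-1 * b%:R `^ (th - 1) < 1 ->
  0 <= gam <= 4^-1 -> gam < th / 2 ->
  {ae P, forall x, fourier_decay (mu x) (4 * gam)}.
Proof.
move=> q12 th01 hq g04 gth.
have [[mu01 _] wmu] := hmu.
have zth j : zeta j `^ (- th) = j.+1%:R `^ (- (th / 2)).
  by rewrite /zeta -powRrM; congr (_ `^ _); ring.
have Hc := @incr_ae_bound _ _ _ _ b1 P X gX sigma q th gam
  (fun j => word_coef (cosw_prim (zeta j))) q12 hq gth.
have Hs := @incr_ae_bound _ _ _ _ b1 P X gX sigma q th gam
  (fun j => word_coef (sinw_prim (zeta j))) q12 hq gth.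
have {}Hc := Hc _; have {}Hs := Hs _.
have kc n j : {in words b n.+1, forall v, `|word_coef (cosw_prim (zeta j)) v| <=
    (b%:R `^ (th - 1)) ^+ n.+1 * j.+1%:R `^ (- (th / 2))}.
  move=> v; rewrite mem_words => /eqP <-; rewrite -zth.
  exact: (cosw_prim_coef b0 v (zeta0 j) th01).
have ks n j : {in words b n.+1, forall v, `|word_coef (sinw_prim (zeta j)) v| <=
    (b%:R `^ (th - 1)) ^+ n.+1 * j.+1%:R `^ (- (th / 2))}.
  move=> v; rewrite mem_words => /eqP <-; rewrite -zth.
  exact: (sinw_prim_coef b0 v (zeta0 j) th01).
have {kc}Hc := Hc kc; have {ks}Hs := Hs ks.
have H2 : {ae P, forall x, weak_cvg01 (cascade_approx (fun u => W0 u x)) (mu x) /\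
    forall u, \prod_(j < (size u).+1) W (take j u) x = gwt sigma X u x}.
  by apply: filterS2 wmu WX => x.
apply: filterS3 Hc Hs H2 => x [K [rho [K0 rho01 HK]]] [K' [rho' [K'0 rho'01 HK']]] [wx Wx].
have zn0 j : zeta j != 0 by rewrite gt_eqF.
have HC := bounded_transform gth K0 rho01
  (fun j y => is_derive_cosw_prim y (zn0 j)) (fun j => @continuous_cosw _ (zeta j))
  (fun j u => cosw_prim_coef b0 u (zeta0 j) th01) HK Wx wx.
have HS := bounded_transform gth K'0 rho'01
  (fun j y => is_derive_sinw_prim y (zn0 j)) (fun j => @continuous_sinw _ (zeta j))
  (fun j u => sinw_prim_coef b0 u (zeta0 j) th01) HK' Wx wx.
have nn (k r : R) : 0 < k -> 0 < r < 1 -> 0 <= 1 + k / (1 - r).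
  by move=> k0 /andP[r0 r1]; rewrite addr_ge0// divr_ge0// ?subr_ge0 ltW.
pose KK := Num.max (1 + K / (1 - rho)) (1 + K' / (1 - rho')).
apply: (@fourier_decay_of_grid _ (mu x) (mu01 x) gam KK) => //.
- by rewrite le_max nn.
- move=> j; apply: (le_trans (HC j)).
  by rewrite ler_wpM2r ?powR_ge0// le_max lexx.
- move=> j; apply: (le_trans (HS j)).
  by rewrite ler_wpM2r ?powR_ge0// le_max lexx orbT.
Qed.

End decay.

(** * Almost sure failure of decay above the critical exponent *)

Section no_decay.
Context {R : realType} {b : nat} (sigma : R).
Hypothesis b1 : (1 < b)%N.
Context {d : measure_display} {T : measurableType d} (P : probability T R).
Variable X : seq 'I_b -> T -> R.
Hypothesis gX : gauss_family P X.
Variable W : seq 'I_b -> {RV P >-> R}.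
Hypothesis W0 : forall (u : seq 'I_b) (x : T), 0 <= W u x.
Variable mu : T -> {finite_measure set R -> \bar R}.
Hypothesis hmu : is_cascade_measure P W0 mu.
Hypothesis WX : {ae P, forall x, forall u,
  \prod_(j < (size u).+1) W (take j u) x = gwt sigma X u x}.

Let b0 : (0 < b)%N. Proof. exact: ltnW. Qed.
Let bR : 0 < b%:R :> R. Proof. by rewrite ltr0n. Qed.

Let pword_cat N k u x :
  (forall u, \prod_(j < (size u).+1) W (take j u) x = gwt sigma X u x) ->
  u \in words b N ->
  \sum_(v <- words b k) pword (fun u => W u x) (N + k) (u ++ v) =
  b%:R ^- N * (gwt sigma X u x * Zmass sigma (subtree u X) k x).
Proof.
move=> Wx; rewrite mem_words => /eqP uN.
rewrite /Zmass 2!mulrA mulr_sumr; apply: eq_big_seq => v; rewrite mem_words => /eqP vk.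
have := Wx (u ++ v); rewrite size_cat uN vk /pword => ->.
by rewrite gwt_cat exprD invfM; ring.
Qed.

(** On a path with decay, some integer constant bounds the energy at every generation and all large
    depths. For each constant this has probability zero, since [energy_lower_bound] makes it
    arbitrarily unlikely at a single well-chosen generation. *)
Lemma no_decay_ae (th th' kap D : R) : 0 < D < 1 ->
  sigma ^+ 2 < 2 * ln b%:R -> (th * sigma) ^+ 2 < 2 * ln b%:R ->
  th' < th <= 2 ->
  kap < sigma ^+ 2 / 2 * (th + th' - 1) ->
  ln b%:R - (2 - th) * kap - sigma ^+ 2 / 2 * (th ^+ 2 - th) < D * ln b%:R ->
  {ae P, forall x, ~ fourier_decay (mu x) D}.
Proof.
move=> D01 sb tsb th2 kl Dg.
have [[mu01 _] wmu] := hmu.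
pose H (C : R) N k : set T := [set x |
  \sum_(u <- words b N) (gwt sigma X u x * Zmass sigma (subtree u X) k x) ^+ 2 <=
     C * expR (N%:R * (2 * ln b%:R - D * ln b%:R))].
(* The factor [4 * b ^ 8] undoes [(b ^ n / 2) ^ 2 * b ^ (- 2 (n + 4))] from [energy_eventually]; the
   integers [i.+1] exhaust the random constant. *)
pose E (i : nat) : set T := [set x | forall n : nat, exists m0 : nat, forall k, (m0 <= k)%N ->
   H (4 * b%:R ^+ 8 * i.+1%:R) (n + 4)%N k x].
have mH C N k : measurable (H C N k).
  apply: measurable_le; apply: measurable_sum => u; apply: measurable_funX.
  apply: measurable_funM; first exact: (measurable_gwt gX).
  exact: (measurable_Zmass (gauss_family_subtree u gX)).
have negE i : P.-negligible (E i).
  apply: negligible_small => e e0.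
  set C : R := 4 * b%:R ^+ 8 * i.+1%:R.
  have C0 : 0 < C by rewrite !mulr_gt0 ?exprn_gt0.
  have [N0 HN0] := energy_lower_bound b1 sb tsb th2 kl Dg C0 e0.
  have [k0 Hk0] := HN0 (N0 + 4)%N (leq_addr _ _).
  (* These sets increase with [M], and each is contained in the event at the single depth
     [maxn M k0], which has probability at most [e]. *)
  pose A M := \bigcap_(k in [set k | (M <= k)%N]) H C (N0 + 4)%N k.
  have mA M : measurable (A M).
    by apply: bigcap_measurable => [|k _]; [exists M => /=|exact: mH].
  exists (\bigcup_M A M); split; first exact: bigcupT_measurable.
    by move=> x /(_ N0)[m0 Hm]; exists m0 => // k /= mk; exact: Hm.
  apply: pr_bigcup_nondecreasing => //.
    by move=> m n mn x Ax k /= nk; apply: Ax => /=; exact: leq_trans nk.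
  move=> M; apply: le_trans (Hk0 _ _ P X gX (maxn M k0) (leq_maxr _ _)).
  apply: pr_le => //; first exact: (mH C (N0 + 4)%N (maxn M k0)).
  by move=> x Ax; apply: (Ax (maxn M k0)) => /=; exact: leq_maxl.
have negU : {ae P, forall x, ~ (\bigcup_i E i) x}.
  have := negligible_bigcup negE.
  by apply: negligibleS => x /= /contrapT.
apply: filterS3 negU wmu WX => x nE wx Wx dec; apply: nE.
have [C C0 HC] := energy_eventually b1 (mu01 x) wx D01 dec.
exists (Num.truncn C) => // n; have [m0 Hm] := HC n; exists m0 => k mk.
have := Hm k mk; rewrite /H /=.
have bn0 : 0 < b%:R ^+ n :> R by rewrite exprn_gt0.
have bN0 : 0 < b%:R ^+ (n + 4) :> R by rewrite exprn_gt0.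
rewrite (eq_big_seq (fun u => (b%:R ^- (n + 4)) ^+ 2 *
   (gwt sigma X u x * Zmass sigma (subtree u X) k x) ^+ 2)); last first.
  by move=> u uN; rewrite pword_cat// exprMn.
rewrite -mulr_sumr; set S := \sum_(u <- _) _ => h.
have -> : (n + 4)%:R * (2 * ln b%:R - D * ln b%:R) = (2 - D) * ((n + 4)%:R * ln b%:R) by ring.
have bE : expR ((2 - D) * ((n + 4)%:R * ln b%:R)) = (b%:R ^+ (n + 4)) `^ (2 - D).
  by rewrite /powR gt_eqF// lnXn// mulr_natl.
rewrite bE.
have mono : (b%:R ^+ n) `^ (2 - D) <= (b%:R ^+ (n + 4)) `^ (2 - D) :> R.
  apply: ge0_ler_powR; rewrite ?nnegrE ?exprn_ge0 ?(ltW bR)//.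
    by case/andP: D01 => _ D1; rewrite subr_ge0 (le_trans (ltW D1))// ler1n.
  by apply: ler_weXn2l; [rewrite ler1n|exact: leq_addr].
have -> : S = 4 * b%:R ^+ 8 * ((b%:R ^+ n / 2) ^+ 2 * ((b%:R ^- (n + 4)) ^+ 2 * S)).
  rewrite exprD invfM.
  have e8 : b%:R ^+ 8 = b%:R ^+ 4 * b%:R ^+ 4 :> R by rewrite -exprD.
  have b40 : b%:R ^+ 4 != 0 :> R by rewrite gt_eqF// exprn_gt0.
  rewrite e8; move: (b%:R ^+ 4) b40 (b%:R ^+ n) bn0 => B B0 B' /gt_eqF/negbT B'0.
  by field; rewrite B0 B'0.
rewrite -[leRHS]mulrA; apply: ler_wpM2l; first by rewrite mulr_ge0// exprn_ge0// ltW.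
apply: (le_trans h); apply: ler_pM; rewrite ?powR_ge0 ?(ltW C0)//.
by rewrite ltW// truncnS_gt.
Qed.

End no_decay.

(** * From decay to dimension, and choice of the parameters *)

Section dimension.
Context {R : realType}.

Lemma fourier_decay_le (nu : {measure set R -> \bar R}) (D D' : R) : D' <= D ->
  fourier_decay nu D -> fourier_decay nu D'.
Proof.
move=> DD' [C [M H]]; exists `|C|, (Num.max M 1) => z.
rewrite ge_max => /andP[Mz z1]; apply: (le_trans (H z Mz)).
apply: (@le_trans _ _ (`|C| * `|z| `^ (- D))).
  by rewrite ler_wpM2r ?powR_ge0// ler_norm.
by rewrite ler_wpM2l//; apply: ler_powR => //; rewrite lerN2.
Qed.

(** Countably many test exponents on either side of [D] suffice, so that the almost sure statements
    can be intersected. The denominator [k.+2] keeps the upper ones below 1. *)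
Lemma fourier_dim_eq (nu : {measure set R -> \bar R}) (D : R) : 0 < D < 1 ->
  (forall k : nat, fourier_decay nu (D * (1 - k.+1%:R^-1))) ->
  (forall k : nat, ~ fourier_decay nu (D + (1 - D) / k.+2%:R)) ->
  fourier_dim nu = D.
Proof.
move=> /andP[D0 D1] dec ndec.
rewrite /fourier_dim; set A := [set D : R | _].
have arch (e : R) : 0 < e -> exists k : nat, k.+1%:R^-1 < e.
  move=> e0; exists (Num.truncn e^-1).
  by rewrite -[ltRHS]invrK ltf_pV2 ?posrE ?invr_gt0// truncnS_gt.
have ub : ubound A D.
  move=> y [/andP[y0 y1] hy]; rewrite leNgt; apply/negP => Dy.
  have [|k ky] := arch ((y - D) / (1 - D)); first by rewrite divr_gt0 ?subr_gt0.
  apply: (ndec k); apply: fourier_decay_le hy.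
  rewrite -lerBrDl; move: ky; rewrite ltr_pdivlMr ?subr_gt0// => /ltW.
  apply: le_trans; rewrite mulrC ler_wpM2r ?subr_ge0 ?(ltW D1)//.
  by rewrite lef_pV2 ?posrE// ler_nat.
have Ak k : A (D * (1 - k.+1%:R^-1)).
  have k1 : k.+1%:R^-1 <= 1 :> R by rewrite invf_le1// ler1n.
  have k0 : 0 <= k.+1%:R^-1 :> R by rewrite invr_ge0.
  split; last exact: dec.
  rewrite mulr_ge0 ?subr_ge0 ?(ltW D0)//=.
  by apply: mulr_ile1; rewrite ?subr_ge0 ?(ltW D0) ?(ltW D1)// gerBl.
have hs : has_sup A by split; [exists (D * (1 - 1%:R^-1)); exact: (Ak 0%N)|exists D].
apply/eqP; rewrite eq_le; apply/andP; split.
  by apply: sup_le_ub => //; case: hs.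
apply/ler_addgt0Pr => e e0.
have [k ke] := arch e e0.
have := sup_upper_bound hs (Ak k); rewrite -(lerD2r e); apply: le_trans.
rewrite mulrBr mulr1 -addrA lerDl addrC subr_ge0; apply: le_trans (ltW ke).
by rewrite ler_piMl ?invr_ge0// ltW.
Qed.

(** The parameters sit at distance of order [e] from the critical ones: [th] and [th'] just below
    [1 / a], and [kap] below its bound by [L * e]. The resulting exponent exceeds [2 * (1 - a) ^+ 2]
    by at most [8 * e]. *)
Lemma exists_bound_params (a L D : R) : 2^-1 <= a < 1 -> 0 < L -> 2 * (1 - a) ^+ 2 < D ->
  exists th th' kap : R, [/\ (th * a) ^+ 2 < 1, th' < th <= 2,
    kap < a ^+ 2 * L * (th + th' - 1) &
    L - (2 - th) * kap - a ^+ 2 * L * (th ^+ 2 - th) < D * L].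
Proof.
move=> /andP[a2 a1] L0 aD.
have a0 : 0 < a by apply: lt_le_trans a2; rewrite invr_gt0.
have ia2 : a^-1 <= 2 by rewrite -[leRHS]invrK lef_pV2 ?posrE ?invr_gt0.
pose del := D - 2 * (1 - a) ^+ 2.
have del0 : 0 < del by rewrite subr_gt0.
(* This choice gives both [e < 1] and [8 * e < del]; the 8 is the product of [3 * a ^+ 2 + 1 <= 4]
   and [2 - a^-1 + e <= 2]. *)
pose e := del / (del + 9).
have d9 : 0 < del + 9 by rewrite addr_gt0.
have e0 : 0 < e by rewrite divr_gt0.
have e1 : e < 1 by rewrite ltr_pdivrMr// mul1r ltrDl.
have e8 : 8 * e < del.
  rewrite mulrA ltr_pdivrMr// mulrC ltr_pM2l//.
  by move: del0; lra.
pose th := a^-1 - e.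
exists th, (th - e), (L * (a ^+ 2 * (2 * th - e - 1) - e)).
have tha : th * a = 1 - e * a by rewrite /th mulrBl mulVf ?gt_eqF.
split.
- rewrite tha; have : 0 < e * a by rewrite mulr_gt0.
  have : e * a < 1 by rewrite -[ltRHS]mulr1 ltr_pM// ltW.
  by nra.
- rewrite gtrBl e0 /th; lra.
- have -> : a ^+ 2 * L * (th + (th - e) - 1) = L * (a ^+ 2 * (2 * th - e - 1)) by ring.
  by rewrite ltr_pM2l// gtrBl.
have -> : L - (2 - th) * (L * (a ^+ 2 * (2 * th - e - 1) - e)) - a ^+ 2 * L * (th ^+ 2 - th) =
   (1 - (2 - th) * (a ^+ 2 * (2 * th - e - 1) - e) - a ^+ 2 * (th ^+ 2 - th)) * L by ring.
rewrite ltr_pM2r//.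
have -> : 1 - (2 - th) * (a ^+ 2 * (2 * th - e - 1) - e) - a ^+ 2 * (th ^+ 2 - th) =
   2 * (1 - a) ^+ 2 + (e * (3 * a ^+ 2 + 1) * (2 - a^-1 + e) - a ^+ 2 * e ^+ 2).
  by rewrite /th; field; rewrite gt_eqF.
rewrite -ltrBrDl -/del; apply: le_lt_trans e8.
apply: (@le_trans _ _ (e * (3 * a ^+ 2 + 1) * (2 - a^-1 + e))).
  by rewrite gerBl mulr_ge0 ?sqr_ge0.
have ia1 : 1 < a^-1 by rewrite invf_gt1.
rewrite -mulrA mulrC ler_wpM2r ?(ltW e0)//.
have h1 : 3 * a ^+ 2 + 1 <= 4 by nra.
apply: (@le_trans _ _ (4 * 2)); last by lra.
apply: ler_pM => //.
- by rewrite addr_ge0// mulr_ge0// sqr_ge0.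
- by rewrite addr_ge0 ?(ltW e0)// subr_ge0.
- lra.
Qed.

End dimension.

Section cascade_dimension.
Context {R : realType} {b : nat} (sigma a : R).
Hypothesis b1 : (1 < b)%N.
Hypothesis a01 : 0 < a < 1.
Hypothesis sigE : sigma ^+ 2 = 2 * a ^+ 2 * ln b%:R.
Context {d : measure_display} {T : measurableType d} (P : probability T R).
Variable X : seq 'I_b -> T -> R.
Hypothesis gX : gauss_family P X.
Variable W : seq 'I_b -> {RV P >-> R}.
Hypothesis W0 : forall (u : seq 'I_b) (x : T), 0 <= W u x.
Variable mu : T -> {finite_measure set R -> \bar R}.
Hypothesis hmu : is_cascade_measure P W0 mu.
Hypothesis WX : {ae P, forall x, forall u,
  \prod_(j < (size u).+1) W (take j u) x = gwt sigma X u x}.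

Let L : R := ln b%:R.
Let L0 : 0 < L. Proof. by rewrite ln_gt0// ltr1n. Qed.
Let bR : 0 < b%:R :> R. Proof. by rewrite ltr0n ltnW. Qed.

(** In base [b] the left side has exponent [((q ^+ 2 - q) * a ^+ 2 + 1) / q + th - 1]; the bound on
    [th] says that it is negative. *)
Lemma mgq_contraction (q th : R) : 1 < q -> th < (q - 1) * (1 - q * a ^+ 2) / q ->
  (mgq sigma q * b%:R) `^ q^-1 * b%:R `^ (th - 1) < 1.
Proof.
move=> q1; have q0 : 0 < q by exact: lt_trans q1.
rewrite ltr_pdivlMr// => h.
have E r : b%:R `^ r = expR (r * L) :> R by rewrite /powR gt_eqF.
have -> : mgq sigma q * b%:R = expR (L * ((q ^+ 2 - q) * a ^+ 2 + 1)).
  rewrite /mgq sigE -[X in _ * X = _](@lnK _ b%:R) ?posrE// -expRD; congr expR.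
  by rewrite -/L; field.
rewrite -expRM E -expRD expR_lt1.
have -> : L * ((q ^+ 2 - q) * a ^+ 2 + 1) / q + (th - 1) * L =
    (th * q - (q - 1) * (1 - q * a ^+ 2)) * (L / q) by field; rewrite gt_eqF.
by rewrite pmulr_llt0 ?divr_gt0// subr_lt0.
Qed.

Lemma cascade_fourier_dim (q D0 : R) : 1 < q <= 2 ->
  D0 = 2 * ((q - 1) * (1 - q * a ^+ 2) / q) -> 0 < D0 < 1 ->
  (forall D, D0 < D -> exists th th' kap : R, [/\ (th * a) ^+ 2 < 1, th' < th <= 2,
    kap < a ^+ 2 * L * (th + th' - 1) &
    L - (2 - th) * kap - a ^+ 2 * L * (th ^+ 2 - th) < D * L]) ->
  {ae P, forall x, fourier_dim (mu x) = D0}.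
Proof.
move=> q12 D0E D01 par; have [D0_gt0 D0_lt1] := andP D01.
have [a0 a1] := andP a01.
have [q1 _] := andP q12.
have dec (k : nat) : {ae P, forall x, fourier_decay (mu x) (D0 * (1 - k.+1%:R^-1))}.
  have k0 : 0 < k.+1%:R^-1 :> R by rewrite invr_gt0.
  have k1 : k.+1%:R^-1 <= 1 :> R by rewrite invf_le1// ler1n.
  set y := _^-1 in k0 k1.
  pose gam := D0 * (1 - y) / 4.
  have -> : D0 * (1 - y) = 4 * gam by rewrite /gam; field.
  have yD : D0 * (1 - y) < D0 by rewrite gtr_pMr// gtrBl.
  have yD0 : 0 <= D0 * (1 - y) by rewrite mulr_ge0 ?subr_ge0// ltW.
  (* The midpoint between [2 * gam], needed for the decay, and [D0 / 2], the limit allowed by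
     [mgq_contraction]. *)
  pose th := (2 * gam + D0 / 2) / 2.
  apply: (decay_ae b1 gX hmu WX (q := q) (th := th)) => //.
  - by rewrite /th /gam; apply/andP; split; lra.
  - by apply: mgq_contraction => //; rewrite /th /gam; lra.
  - by rewrite /gam; apply/andP; split; lra.
  - by rewrite /th /gam; lra.
have ndec (k : nat) : {ae P, forall x, ~ fourier_decay (mu x) (D0 + (1 - D0) / k.+2%:R)}.
  have k0 : 0 < k.+2%:R^-1 :> R by rewrite invr_gt0.
  have k1 : k.+2%:R^-1 < 1 :> R by rewrite invf_lt1// ltr1n.
  have e0 : 0 < (1 - D0) / k.+2%:R by rewrite mulr_gt0// subr_gt0.
  have e1 : (1 - D0) / k.+2%:R < 1 - D0 by rewrite gtr_pMr// subr_gt0.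
  set D := D0 + _.
  have D0D : D0 < D by rewrite ltrDl.
  have [th [th' [kap [h1 h2 h3 h4]]]] := par D D0D.
  have s2 : sigma ^+ 2 / 2 = a ^+ 2 * L by rewrite sigE -/L; field.
  apply: (no_decay_ae b1 gX hmu WX (th := th) (th' := th') (kap := kap)) => //.
  - apply/andP; split; first exact: lt_trans D0D.
    by rewrite /D -ltrBrDl.
  - rewrite sigE -/L -[ltRHS]mulr1 mulrAC ltr_pM2l ?mulr_gt0//.
    by rewrite expr_lt1// ltW.
  - rewrite exprMn sigE -/L.
    have -> : th ^+ 2 * (2 * a ^+ 2 * L) = 2 * L * (th * a) ^+ 2 by ring.
    by rewrite -[ltRHS]mulr1 ltr_pM2l ?mulr_gt0.
  - by rewrite s2.
  - by rewrite s2.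
apply: filterS2 (ae_foralln dec) (ae_foralln ndec) => x Hd Hn.
exact: fourier_dim_eq.
Qed.

End cascade_dimension.

Theorem corollary1p3 (R : realType) (b : nat) (hb : (2 <= b)%N)
    (sigma : R) (hsigma : 0 < sigma < Num.sqrt (2 * ln b%:R))
    (d0 : measure_display) (T0 : measurableType d0) (P0 : probability T0 R)
    (N : {RV P0 >-> R}) (hN : distribution P0 N = normal_prob 0 1)
    (d : measure_display) (T : measurableType d) (P : probability T R)
    (W : seq 'I_b -> {RV P >-> R})
    (W0 : forall (u : seq 'I_b) (x : T), 0 <= W u x)
    (Wnil : forall x : T, W [::] x = 1)
    (Wiid : iid_copies P (fun (u : nonempty_word b) (x : T) => W (val u) x)
              P0 (fun y : T0 => expR (sigma * N y - sigma ^+ 2 / 2)))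
    (mu : T -> {finite_measure set R -> \bar R})
    (hmu : is_cascade_measure P W0 mu) :
  {ae P, forall x,
    (sigma ^+ 2 / ln b%:R <= 2^-1 ->
       fourier_dim (mu x) = 1 - sigma ^+ 2 / ln b%:R) /\
    (2^-1 < sigma ^+ 2 / ln b%:R < 2 ->
       fourier_dim (mu x) = 2 * (1 - sigma / Num.sqrt (2 * ln b%:R)) ^+ 2 /\
       2 * (1 - sigma / Num.sqrt (2 * ln b%:R)) ^+ 2 =
         1 - sigma ^+ 2 / ln b%:R +
           (1 - Num.sqrt (2 * sigma ^+ 2 / ln b%:R)) ^+ 2)}.
Proof.
have [sigma0 sigma1] := andP hsigma.
have L0 : 0 < ln b%:R :> R by rewrite ln_gt0// ltr1n.
have sq0 : 0 < Num.sqrt (2 * ln b%:R) :> R by exact: lt_trans sigma1.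
set a := sigma / Num.sqrt (2 * ln b%:R).
have a0 : 0 < a by rewrite divr_gt0.
have a1 : a < 1 by rewrite ltr_pdivrMr// mul1r.
have a01 : 0 < a < 1 by rewrite a0.
have a2 : a ^+ 2 = sigma ^+ 2 / (2 * ln b%:R).
  by rewrite /a expr_div_n sqr_sqrtr// mulr_ge0// ltW.
have sigE : sigma ^+ 2 = 2 * a ^+ 2 * ln b%:R.
  by rewrite a2; field; rewrite gt_eqF.
have sE : sigma ^+ 2 / ln b%:R = 2 * a ^+ 2.
  by rewrite sigE mulfK// gt_eqF.
have s2E : 2 * sigma ^+ 2 / ln b%:R = (2 * a) ^+ 2.
  by rewrite -mulrA sE; ring.
have gX := gauss_weight_family sigma0 hN Wiid.
have WX : {ae P, forall x, forall u,
    \prod_(j < (size u).+1) W (take j u) x = gwt sigma (gauss_weight sigma W) u x}.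
  by apply: filterS (weight_ae sigma0 Wiid) => x Wx u; apply: prod_weights.
rewrite sE s2E sqrtr_sqr (gtr0_norm (mulr_gt0 _ a0))//.
have [a_small|a_large] := leP (2 * a ^+ 2) 2^-1.
  have ah : a <= 2^-1.
    rewrite leNgt; apply/negP => ah; move: a_small; apply/negP; rewrite -ltNge.
    by nra.
  have H : {ae P, forall x, fourier_dim (mu x) = 1 - 2 * a ^+ 2}.
    apply: (cascade_fourier_dim hb a01 sigE gX hmu WX (q := 2)).
    - by apply/andP; split; lra.
    - by field.
    - by have := exprn_gt0 2 a0 => ?; apply/andP; split; lra.
    move=> D hD; have [ah'|ah'] := ltP a 2^-1.
      exists 2, 1, (a ^+ 2 * ln b%:R * (2 + 1 - 1) - 1); split.
      - by rewrite expr_lt1 ?mulr_ge0 ?(ltW a0)//; lra.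
      - by apply/andP; split; lra.
      - by rewrite gtrBl.
      - have -> : ln b%:R - (2 - 2) * (a ^+ 2 * ln b%:R * (2 + 1 - 1) - 1) -
            a ^+ 2 * ln b%:R * (2 ^+ 2 - 2) = (1 - 2 * a ^+ 2) * ln b%:R by ring.
        by rewrite ltr_pM2r.
    (* At [a = 1/2] the power 2 is exactly critical, so powers slightly below it are used; the two
       formulas for the dimension agree there. *)
    apply: exists_bound_params => //; first by rewrite ah'.
    have aE : a = 2^-1 by apply/eqP; rewrite eq_le ah ah'.
    suff -> : 2 * (1 - a) ^+ 2 = 1 - 2 * a ^+ 2 :> R by [].
    by rewrite aE; field.
  by apply: filterS H => x Hx; split.
have ah : 2^-1 < a.
  rewrite ltNge; apply/negP => ah; move: a_large; apply/negP; rewrite -leNgt.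
  by nra.
have ia2 : a^-1 < 2 by rewrite -[ltRHS]invrK ltf_pV2 ?posrE ?invr_gt0.
have ia1 : 1 < a^-1 by rewrite invf_gt1.
have H : {ae P, forall x, fourier_dim (mu x) = 2 * (1 - a) ^+ 2}.
  apply: (cascade_fourier_dim hb a01 sigE gX hmu WX (q := a^-1)).
  - by rewrite ia1 ltW.
  - by field; rewrite gt_eqF.
  - apply/andP; split; first by rewrite mulr_gt0// exprn_gt0// subr_gt0.
    by nra.
  - by move=> D hD; apply: exists_bound_params; rewrite ?(ltW ah).
apply: filterS H => x Hx; split=> // _; split=> //.
by ring.
Qed.
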